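(* Let $u^*(\cdot)\in\mathcal{U}[0,T]$, let $(X^*(\cdot),Y^*(\cdot),Z^*(\cdot))$ be the corresponding solution of the controlled forward-backward system (with initial time $0$), and let $\vec p(\cdot)=(p_1(\cdot),p_2(\cdot),p_3(\cdot))^\top$, $q(\cdot)$, $\vec k(\cdot)=(k_1(\cdot),k_2(\cdot))^\top$ be the corresponding solution of the adjoint equation. Suppose that (i) for all $t\in[0,T]$, the map $(x,x_1,x_2,y,z,u)\mapsto H(t,x,x_1,x_2,y,z,u,\vec p(t),q(t),\vec k(t))$ is convex; (ii) $\phi(x,x_1)=Mx+Nx_1$ for some $M,N\in\mathbb{R}$; (iii) $p_3(t)=0$ for all $t\in[0,T]$; (iv) $\dfrac{\partial H^*}{\partial u}(t)\,(u^*(t)-u)\le0$ for all $u\in\mathbb{U}$, a.s., for all $t\in[0,T]$. Then $u^*(\cdot)$ is an optimal control, i.e. $J(0,\varphi;u^*(\cdot))=\operatorname{essinf}_{u(\cdot)\in\mathcal{U}[0,T]}J(0,\varphi;u(\cdot))$.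
   Context: Setting. $\{W(t),t\ge0\}$ is a one-dimensional Brownian motion on $(\Omega,\mathcal{F},\mathbb{P})$; $\mathcal{F}^0_t=\sigma\{W(\tau);0\le\tau\le t\}$ augmented by the $\mathbb{P}$-null sets. $0<T<\infty$, $0\le\delta<\infty$, $\lambda\in\mathbb{R}$ are constants, $\mathbb{U}\subset\mathbb{R}$ is nonempty and convex. The initial time is $0$ and $\varphi\in C([-\delta,0];\mathbb{R})$ is the initial path. For an $\mathcal{F}^0_t$-adapted $\mathbb{U}$-valued control $u(\cdot)$ the controlled forward-backward system is $$\begin{aligned} dX(t)&=b(t,X(t),X_1(t),X_2(t),u(t))dt+\sigma(t,X(t),X_1(t),X_2(t),u(t))dW(t), \\ -dY(t)&=f(t,X(t),X_1(t),X_2(t),Y(t),Z(t),u(t))dt-Z(t)dW(t),\quad t\in[0,T], \\ X(t)&=\varphi(t),\ t\in[-\delta,0],\qquad Y(T)=\phi(X(T),X_1(T)),\end{aligned}$$ with $X_1(t)=\int_{-\delta}^0e^{\lambda\tau}X(t+\tau)d\tau$, $X_2(t)=X(t-\delta)$. $\mathcal{U}[0,T]$ is the set of such controls for which this system has a unique adapted solution. The cost is $J(0,\varphi;u(\cdot))=-Y(0)$. Hamiltonian: for $\vec p=(p_1,p_2,p_3)^\top$, $q\in\mathbb{R}$, $\vec k=(k_1,k_2)^\top$, $$H(t,x,x_1,x_2,y,z,u,\vec p,q,\vec k)=p_1b(t,x,x_1,x_2,u)+p_2(x-\lambda x_1-e^{-\lambda\delta}x_2)+k_1\sigma(t,x,x_1,x_2,u)-qf(t,x,x_1,x_2,y,z,u).$$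 Write $H^*(t)=H(t,X^*(t),X_1^*(t),X_2^*(t),Y^*(t),Z^*(t),u^*(t),\vec p(t),q(t),\vec k(t))$, and similarly for partial derivatives. Adjoint equation: $$\begin{aligned}-dp_1(t)&=\tfrac{\partial H^*}{\partial x}(t)dt-k_1(t)dW(t),\quad -dp_2(t)=\tfrac{\partial H^*}{\partial x_1}(t)dt-k_2(t)dW(t),\quad -dp_3(t)=\tfrac{\partial H^*}{\partial x_2}(t)dt, \\ dq(t)&=-\tfrac{\partial H^*}{\partial y}(t)dt-\tfrac{\partial H^*}{\partial z}(t)dW(t),\quad t\in[0,T], \\ q(0)&=1,\quad p_1(T)=-\tfrac{\partial\phi}{\partial x}(X^*(T),X_1^*(T))q(T),\quad p_2(T)=-\tfrac{\partial\phi}{\partial x_1}(X^*(T),X_1^*(T))q(T),\quad p_3(T)=0.\end{aligned}$$ Standing assumptions. $b,\sigma$ are jointly continuous and globally Lipschitz in $(x,x_1,x_2)$, with $|b|+|\sigma|\le C(1+|x|+|x_1|+|x_2|)$; the initial path is $\mathcal{F}^0_0$-measurable with $\mathbb{E}\|\varphi\|_C^2<\infty$; $f(\cdot,x,x_1,x_2,y,z,u)$ is $\mathcal{F}^0_t$-measurable; $f,\phi$ are jointly continuous and globally Lipschitz in $(x,x_1,x_2,y,z)$; $|f(t,x,x_1,x_2,0,0,u)|+|\phi(x,x_1)|\le C(1+|x|+|x_1|+|x_2|)$. Moreover $b,\sigma$ are continuously differentiable in $(x,x_1,x_2,u)$, $f$ in $(x,x_1,x_2,y,z,u)$ and $\phi$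 in $(x,x_1)$, and along the controlled processes: $\mathbb{E}\int_0^T(|\partial_\rho b|^2+|\partial_\rho\sigma|^2)dt<\infty$ for $\rho=x,x_1,x_2,u$; $\mathbb{E}\int_0^T|\partial_\rho f|^2dt<\infty$ for $\rho=x,x_1,x_2,y,z,u$; $\mathbb{E}[|\partial_x\phi(X(T),X_1(T))|^2+|\partial_{x_1}\phi(X(T),X_1(T))|^2]<\infty$. *)

(* Defs.v *)
From HB Require Import structures.
From mathcomp Require Import all_boot all_order all_algebra.
From mathcomp Require Import all_classical all_reals all_analysis.
From mathcomp Require Import measurable_realfun.
Set Implicit Arguments.
Unset Strict Implicit.
Unset Printing Implicit Defensive.
Import Order.TTheory GRing.Theory Num.Theory.
Import numFieldNormedType.Exports.
Local Open Scope classical_set_scope.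
Local Open Scope ring_scope.

(* A process is a function of time, then of the outcome; only its values for
   times in the relevant interval matter. *)
Section processes.
Context (R : realType) (d : measure_display) (Omega : measurableType d)
  (P : probability Omega R).
Local Notation mu := (@lebesgue_measure R).
Implicit Types (W X H : R -> Omega -> R) (s t a T : R).

Definition past_events W t : set (set Omega) :=
  [set A | exists2 s, s \in `[0, t] & exists2 B : set R, measurable B &
     A = W s @^-1` B].

(* generators of the Brownian filtration augmented by the null sets *)
Definition filtration_events W t : set (set Omega) :=
  past_events W t `|` [set N | measurable N /\ P N = 0%E].

Definition filtration_measurable W t (xi : Omega -> R) :=
  measurable_fun setT (xi : g_sigma_algebraType (filtration_events W t) -> R).

Definition increment W s t : Omega -> R := fun w => W t w - W s w.

Record brownian_motion W : Prop := {
  bm_measurable : forall t, 0 <= t -> measurable_fun setT (W t);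
  bm_start : {ae P, forall w, W 0 w = 0};
  bm_continuous : {ae P, forall w, {within `[0, +oo[, continuous (W ^~ w)}};
  bm_gaussian : forall s t, 0 <= s -> s < t -> forall B : set R, measurable B ->
    P (increment W s t @^-1` B) = normal_prob 0 (Num.sqrt (t - s)) B;
  bm_independent : forall s t, 0 <= s -> s < t ->
    forall A, <<s past_events W s >> A -> forall B : set R, measurable B ->
    P (A `&` increment W s t @^-1` B) =
      (P A * P (increment W s t @^-1` B))%E
}.

(* jointly measurable and adapted on [0, T] *)
Definition adapted W T X :=
  measurable_fun (`[0, T] `*` [set: Omega])
    (fun tw : measurableTypeR R * Omega => X tw.1 tw.2) /\
  (forall t, t \in `[0, T] -> filtration_measurable W t (X t)).

(* E of the integral of |X(t)|^2 over [0, T] *)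
Definition sqnorm T X : \bar R :=
  (\int[P]_w \int[mu]_(t in `[0%R, T]) ((X t w) ^+ 2)%:E)%E.

(* the space L^2_F([0, T]; R) *)
Definition L2_process W T X := adapted W T X /\ (sqnorm T X < +oo)%E.

(* the space L^2_F(Omega; C([a, T]; R)), for a <= 0 *)
Definition S2_process W a T X :=
  [/\ adapted W T X,
      forall w, {within `[a, T], continuous (X ^~ w)} &
      (\int[P]_w ereal_sup [set ((X t w) ^+ 2)%:E | t in `[a, T]] < +oo)%E].

(* The simple process equal to step_value i on ]step_time i, step_time i.+1],
   for i < step_size. *)
Record step_process := StepProcess {
  step_size : nat;
  step_time : nat -> R;
  step_value : nat -> Omega -> R
}.

Definition simple W T (S : step_process) :=
  [/\ step_time S 0 = 0 /\ step_time S (step_size S) = T,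
      forall i, (i < step_size S)%N -> step_time S i <= step_time S i.+1,
      forall i, (i < step_size S)%N ->
        filtration_measurable W (step_time S i) (step_value S i) &
      exists C, forall i w, (i < step_size S)%N -> `|step_value S i w| <= C].

Definition step_fun (S : step_process) t w : R :=
  \sum_(i < step_size S)
    step_value S i w * \1_(`]step_time S i, step_time S i.+1]) t.

Definition step_integral W (S : step_process) t w : R :=
  \sum_(i < step_size S) step_value S i w *
    (W (Num.min (step_time S i.+1) t) w - W (Num.min (step_time S i) t) w).

(* I(t) is the Ito integral of H over [0, t], as the L^2(P)-limit of the
   integrals of simple processes converging to H in L^2_F([0, T]; R). *)
Definition ito_integral W T H (I : R -> Omega -> R) :=
  [/\ L2_process W T H,
      forall t, t \in `[0, T] -> measurable_fun setT (I t) &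
      exists S : nat -> step_process,
        [/\ forall n, simple W T (S n),
            sqnorm T (fun t w => step_fun (S n) t w - H t w) @[n --> \oo]
              --> 0%E &
            forall t, t \in `[0, T] ->
              (\int[P]_w ((step_integral W (S n) t w - I t w) ^+ 2)%:E)%E
                @[n --> \oo] --> 0%E]].

(* dX(t) = a(t) dt + c(t) dW(t) on [0, T] *)
Definition ito_process W T X (a c : R -> Omega -> R) :=
  {ae P, forall w, mu.-integrable `[0, T] (fun s => (a s w)%:E)} /\
  exists2 I, ito_integral W T c I &
    forall t, t \in `[0, T] ->
      {ae P, forall w,
        X t w = X 0 w + \int[mu]_(s in `[0, t]) a s w + I t w}.

(* xi is the essential infimum of the family S of random variables *)
Definition is_essinf (S : set (Omega -> R)) (xi : Omega -> R) :=
  [/\ measurable_fun setT xi,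
      forall eta, S eta -> {ae P, forall w, xi w <= eta w} &
      forall zeta : Omega -> \bar R, measurable_fun [set: Omega] zeta ->
        (forall eta, S eta -> {ae P, forall w, (zeta w <= (eta w)%:E)%E}) ->
        {ae P, forall w, (zeta w <= (xi w)%:E)%E}].

End processes.

Section partial_derivatives.
Context (R : realType).

(* functions of (x, x1, x2, y, z, u) *)
Definition coef := R -> R -> R -> R -> R -> R -> R.
Implicit Types (U : set R) (G : coef).

(* Controls range over U only, so derivatives in u are limits of difference
   quotients inside U (one-sided at an endpoint of U). *)
Definition quotients (g : R -> R) (u v : R) : R := (g v - g u) / (v - u).

Definition derivable_within U (g : R -> R) (u : R) :=
  cvg (quotients g u v @[v --> within U u^']).

Definition derive_within U (g : R -> R) (u : R) : R :=
  lim (quotients g u v @[v --> within U u^']).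

Definition partial_x G : coef :=
  fun x x1 x2 y z u => derive1 (fun v => G v x1 x2 y z u) x.
Definition partial_x1 G : coef :=
  fun x x1 x2 y z u => derive1 (fun v => G x v x2 y z u) x1.
Definition partial_x2 G : coef :=
  fun x x1 x2 y z u => derive1 (fun v => G x x1 v y z u) x2.
Definition partial_y G : coef :=
  fun x x1 x2 y z u => derive1 (fun v => G x x1 x2 v z u) y.
Definition partial_z G : coef :=
  fun x x1 x2 y z u => derive1 (fun v => G x x1 x2 y v u) z.
Definition partial_u U G : coef :=
  fun x x1 x2 y z u => derive_within U (G x x1 x2 y z) u.

Definition space6 : lmodType R := (R^o * R^o * R^o * R^o * R^o * R^o)%type.

Definition uncurry6 G (v : R * R * R * R * R * R) : R :=
  let: (x, x1, x2, y, z, u) := v in G x x1 x2 y z u.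

Definition dom6 U : set (R * R * R * R * R * R) := [set v | U v.2].

Definition cont6 U G := {within dom6 U, continuous (uncurry6 G)}.

Definition C1 U G :=
  [/\ forall x x1 x2 y z u, U u ->
        [/\ derivable (fun v => G v x1 x2 y z u) x 1,
            derivable (fun v => G x v x2 y z u) x1 1 &
            derivable (fun v => G x x1 v y z u) x2 1] /\
        [/\ derivable (fun v => G x x1 x2 v z u) y 1,
            derivable (fun v => G x x1 x2 y v u) z 1 &
            derivable_within U (G x x1 x2 y z) u],
      [/\ cont6 U (partial_x G), cont6 U (partial_x1 G) &
          cont6 U (partial_x2 G)] &
      [/\ cont6 U (partial_y G), cont6 U (partial_z G) &
          cont6 U (partial_u U G)]].

Definition convex6 U G :=
  @convex_function R space6 (dom6 U) (uncurry6 G).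

End partial_derivatives.

Section control_problem.
Context (R : realType) (d : measure_display) (Omega : measurableType d)
  (P : probability Omega R) (W : R -> Omega -> R).

(* b and sigma take (t, x, x1, x2, u); f takes (t, w, x, x1, x2, y, z, u); the
   initial path varphi takes (t, w). *)
Record control_problem := ControlProblem {
  T : R;
  delta : R;
  lambda : R;
  U : set R;
  b : R -> R -> R -> R -> R -> R;
  sigma : R -> R -> R -> R -> R -> R;
  f : R -> Omega -> coef R;
  phi : R -> R -> R;
  varphi : R -> Omega -> R
}.

Variable cp : control_problem.
Implicit Types (X Y Z : R -> Omega -> R).

(* X_1(t) *)
Definition avg_delay X t w : R :=
  \int[lebesgue_measure]_(tau in `[- delta cp, 0])
    (expR (lambda cp * tau) * X (t + tau) w).

(* X_2(t) *)
Definition pt_delay X t w : R := X (t - delta cp) w.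

(* b and sigma seen as functions of the full state (x, x1, x2, y, z, u) *)
Definition b_coef (t : R) (w : Omega) : coef R :=
  fun x x1 x2 _ _ u => b cp t x x1 x2 u.
Definition sigma_coef (t : R) (w : Omega) : coef R :=
  fun x x1 x2 _ _ u => sigma cp t x x1 x2 u.

Definition along (G : R -> Omega -> coef R) X Y Z (u : R -> Omega -> R) t w : R :=
  G t w (X t w) (avg_delay X t w) (pt_delay X t w) (Y t w) (Z t w) (u t w).

(* adapted solution of the controlled forward-backward system *)
Record solution u X Y Z : Prop := {
  sol_X : S2_process P W (- delta cp) (T cp) X;
  sol_Y : S2_process P W 0 (T cp) Y;
  sol_Z : L2_process P W (T cp) Z;
  sol_forward :
    ito_process P W (T cp) X (along b_coef X Y Z u) (along sigma_coef X Y Z u);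
  sol_initial : {ae P, forall w,
    forall t, t \in `[- delta cp, 0] -> X t w = varphi cp t w};
  sol_backward :
    ito_process P W (T cp) Y (fun t w => - along (f cp) X Y Z u t w) Z;
  sol_terminal : {ae P, forall w,
    Y (T cp) w = phi cp (X (T cp) w) (avg_delay X (T cp) w)}
}.

(* the set of controls U[0, T] *)
Record admissible u : Prop := {
  adm_adapted : adapted P W (T cp) u;
  adm_range : forall t w, t \in `[0, T cp] -> U cp (u t w);
  adm_exists : exists X Y Z, solution u X Y Z;
  adm_unique : forall X Y Z X' Y' Z',
    solution u X Y Z -> solution u X' Y' Z' ->
    [/\ {ae P, forall w,
           forall t, t \in `[- delta cp, T cp] -> X t w = X' t w},
        {ae P, forall w, forall t, t \in `[0, T cp] -> Y t w = Y' t w} &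
        sqnorm P (T cp) (fun t w => Z t w - Z' t w) = 0%E]
}.

(* J(0, varphi; u) *)
Definition cost Y : Omega -> R := fun w => - Y 0 w.

Definition costs : set (Omega -> R) :=
  [set J | exists u X Y Z,
     [/\ admissible u, solution u X Y Z & J = cost Y]].

Definition phi_x (x x1 : R) : R := derive1 (phi cp ^~ x1) x.
Definition phi_x1 (x x1 : R) : R := derive1 (phi cp x) x1.

Definition hamiltonian (t : R) (w : Omega) (p1 p2 p3 q k1 k2 : R) : coef R :=
  fun x x1 x2 y z u =>
    p1 * b cp t x x1 x2 u
    + p2 * (x - lambda cp * x1 - expR (- lambda cp * delta cp) * x2)
    + k1 * sigma cp t x x1 x2 u
    - q * f cp t w x x1 x2 y z u.

Definition hamiltonian_at (p1 p2 p3 q k1 k2 : R -> Omega -> R) t w : coef R :=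
  hamiltonian t w (p1 t w) (p2 t w) (p3 t w) (q t w) (k1 t w) (k2 t w).

Record adjoint_solution X Y Z u (p1 p2 p3 q k1 k2 : R -> Omega -> R) : Prop := {
  adj_spaces :
    [/\ S2_process P W 0 (T cp) p1, S2_process P W 0 (T cp) p2,
        S2_process P W 0 (T cp) p3 & S2_process P W 0 (T cp) q];
  adj_k : L2_process P W (T cp) k1 /\ L2_process P W (T cp) k2;
  adj_p1 : ito_process P W (T cp) p1
    (fun t w => - along (fun t w =>
       partial_x (hamiltonian_at p1 p2 p3 q k1 k2 t w)) X Y Z u t w) k1;
  adj_p2 : ito_process P W (T cp) p2
    (fun t w => - along (fun t w =>
       partial_x1 (hamiltonian_at p1 p2 p3 q k1 k2 t w)) X Y Z u t w) k2;
  adj_p3 : ito_process P W (T cp) p3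
    (fun t w => - along (fun t w =>
       partial_x2 (hamiltonian_at p1 p2 p3 q k1 k2 t w)) X Y Z u t w)
    (fun _ _ => 0);
  adj_q : ito_process P W (T cp) q
    (fun t w => - along (fun t w =>
       partial_y (hamiltonian_at p1 p2 p3 q k1 k2 t w)) X Y Z u t w)
    (fun t w => - along (fun t w =>
       partial_z (hamiltonian_at p1 p2 p3 q k1 k2 t w)) X Y Z u t w);
  adj_q0 : {ae P, forall w, q 0 w = 1};
  adj_p1T : {ae P, forall w, p1 (T cp) w =
    - phi_x (X (T cp) w) (avg_delay X (T cp) w)
    * q (T cp) w};
  adj_p2T : {ae P, forall w, p2 (T cp) w =
    - phi_x1 (X (T cp) w) (avg_delay X (T cp) w)
    * q (T cp) w};
  adj_p3T : {ae P, forall w, p3 (T cp) w = 0}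
}.

Definition sq_integrable (G : R -> Omega -> coef R) X Y Z u :=
  (sqnorm P (T cp) (along G X Y Z u) < +oo)%E.

Record standing_assumptions : Prop := {
  sa_T : 0 < T cp;
  sa_delta : 0 <= delta cp;
  sa_U_nonempty : U cp !=set0;
  sa_U_convex : @convex_set R R^o (U cp);
  sa_varphi_continuous :
    forall w, {within `[- delta cp, 0], continuous (varphi cp ^~ w)};
  sa_varphi_measurable : forall t, t \in `[- delta cp, 0] ->
    filtration_measurable P W 0 (varphi cp t);
  sa_varphi_sq : (\int[P]_w ereal_sup
    [set ((varphi cp t w) ^+ 2)%:E | t in `[(- delta cp)%R, 0%R]] < +oo)%E;
  sa_b_continuous : {within [set v : R * R * R * R * R |
       v.1.1.1.1 \in `[0, T cp] /\ U cp v.2],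
     continuous (fun v => b cp v.1.1.1.1 v.1.1.1.2 v.1.1.2 v.1.2 v.2)};
  sa_sigma_continuous : {within [set v : R * R * R * R * R |
       v.1.1.1.1 \in `[0, T cp] /\ U cp v.2],
     continuous (fun v => sigma cp v.1.1.1.1 v.1.1.1.2 v.1.1.2 v.1.2 v.2)};
  sa_b_sigma_lipschitz : exists C, forall t u x x1 x2 x' x1' x2',
    t \in `[0, T cp] -> U cp u ->
    `|b cp t x x1 x2 u - b cp t x' x1' x2' u|
    + `|sigma cp t x x1 x2 u - sigma cp t x' x1' x2' u|
      <= C * (`|x - x'| + `|x1 - x1'| + `|x2 - x2'|);
  sa_b_sigma_growth : exists C, forall t u x x1 x2,
    t \in `[0, T cp] -> U cp u ->
    `|b cp t x x1 x2 u| + `|sigma cp t x x1 x2 u|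
      <= C * (1 + `|x| + `|x1| + `|x2|);
  sa_f_measurable : forall t x x1 x2 y z u, t \in `[0, T cp] -> U cp u ->
    filtration_measurable P W t (fun w => f cp t w x x1 x2 y z u);
  sa_f_continuous : forall w, {within [set v : R * (R * R * R * R * R * R) |
       v.1 \in `[0, T cp] /\ dom6 (U cp) v.2],
     continuous (fun v => uncurry6 (f cp v.1 w) v.2)};
  sa_phi_continuous : continuous (fun v : R * R => phi cp v.1 v.2);
  sa_f_lipschitz : exists C, forall t w u x x1 x2 y z x' x1' x2' y' z',
    t \in `[0, T cp] -> U cp u ->
    `|f cp t w x x1 x2 y z u - f cp t w x' x1' x2' y' z' u|
      <= C * (`|x - x'| + `|x1 - x1'| + `|x2 - x2'| + `|y - y'| + `|z - z'|);
  sa_phi_lipschitz : exists C, forall x x1 x' x1',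
    `|phi cp x x1 - phi cp x' x1'| <= C * (`|x - x'| + `|x1 - x1'|);
  sa_f_phi_growth : exists C, forall t w u x x1 x2,
    t \in `[0, T cp] -> U cp u ->
    `|f cp t w x x1 x2 0 0 u| + `|phi cp x x1|
      <= C * (1 + `|x| + `|x1| + `|x2|);
  sa_C1 : forall t w, t \in `[0, T cp] ->
    [/\ C1 (U cp) (b_coef t w), C1 (U cp) (sigma_coef t w) &
        C1 (U cp) (f cp t w)];
  sa_phi_C1 :
    [/\ forall x x1, derivable (phi cp ^~ x1) x 1,
        forall x x1, derivable (phi cp x) x1 1,
        continuous (fun v : R * R => phi_x v.1 v.2) &
        continuous (fun v : R * R => phi_x1 v.1 v.2)];
  sa_b_sigma_sq : forall G, G = b_coef \/ G = sigma_coef ->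
    forall u X Y Z, admissible u -> solution u X Y Z ->
    [/\ sq_integrable (fun t w => partial_x (G t w)) X Y Z u,
        sq_integrable (fun t w => partial_x1 (G t w)) X Y Z u,
        sq_integrable (fun t w => partial_x2 (G t w)) X Y Z u &
        sq_integrable (fun t w => partial_u (U cp) (G t w)) X Y Z u];
  sa_f_sq : forall u X Y Z, admissible u -> solution u X Y Z ->
    [/\ sq_integrable (fun t w => partial_x (f cp t w)) X Y Z u,
        sq_integrable (fun t w => partial_x1 (f cp t w)) X Y Z u &
        sq_integrable (fun t w => partial_x2 (f cp t w)) X Y Z u] /\
    [/\ sq_integrable (fun t w => partial_y (f cp t w)) X Y Z u,
        sq_integrable (fun t w => partial_z (f cp t w)) X Y Z u &
        sq_integrable (fun t w => partial_u (U cp) (f cp t w)) X Y Z u];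
  sa_phi_sq : forall u X Y Z, admissible u -> solution u X Y Z ->
    (\int[P]_w ((phi_x (X (T cp) w) (avg_delay X (T cp) w)) ^+ 2
      + (phi_x1 (X (T cp) w) (avg_delay X (T cp) w)) ^+ 2)%:E < +oo)%E
}.

End control_problem.

(* Main.v *)
Require Import Defs.
From HB Require Import structures.
From mathcomp Require Import all_boot all_order all_algebra.
From mathcomp Require Import all_classical all_reals all_analysis.
From mathcomp Require Import measurable_realfun.
From mathcomp Require Import ring lra.
Import Order.TTheory GRing.Theory Num.Theory.
Import numFieldNormedType.Exports.
Local Open Scope classical_set_scope.
Local Open Scope ring_scope.
Set Implicit Arguments.
Unset Strict Implicit.
Unset Printing Implicit Defensive.

(** Write the cost as [- Y 0]. Given another admissible control [u'] with solution
    [(X', Y', Z')], one must show [Y' 0 <= Y 0] almost surely. Both sides are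
    measurable for the filtration at time 0, whose events have probability 0 or
    1 ([F0_trivial]), so that it suffices to show that [Y' 0 - Y 0] has a
    nonpositive mean ([F0_le0_of_mean]).

    The delayed average [X1] has finite variation, with
    [dX1 = (X - lambda X1 - e^(- lambda delta) X2) dt] ([delay_average_ode]).
    Hence the product rule gives the drifts of [X p1], [X1 p2] and [Y q] for any
    controlled solution, and the adjoint equations make their sum the
    Hamiltonian at that solution minus its linear part at the candidate
    ([duality]). Subtracting the formulas for the two controls, the variation
    over [[0, T]] of the mean of
    [(X' - X) p1 + (X1' - X1) p2 + (Y' - Y) q] is the integral of
    [H' - H - H_x (X' - X) - H_x1 (X1' - X1) - H_y (Y' - Y) - H_z (Z' - Z)].
    Since [p3] vanishes, so does its drift [H_x2] ([ham_x2_orthogonal]), and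
    [H_x2 (X2' - X2)] may be subtracted as well. What is then integrated is the
    gap between a convex function and its tangent plane, up to the derivative
    in the control; it is nonnegative by [convex6_gradient] and the minimum
    condition ([gap_ge0]). At time [T] the bracket vanishes because [phi] is
    linear ([boundary_terminal]); at time 0 its mean is that of [Y' 0 - Y 0]
    ([boundary_initial]). So the mean of [Y' 0 - Y 0] is at most 0.

    Only expectations matter, so the product rule is proved in expectation
    ([product_rule]), for processes with square-integrable drift. It rests on
    the isometry and the martingale property of the Ito integral
    ([ito_isometry], [ito_integral_orth]), themselves obtained from those of
    simple processes and from the independence of the Brownian increments of
    the augmented filtration ([increment_indep]). All the terms are integrable
    because the coefficients have linear growth and, being Lipschitz, bounded
    derivatives ([growth_bound], [partial_bound]); their measurability along
    the solution is Caratheodory's ([measurable_caratheodory]).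

    Two points concern null sets. A solution starts from the initial path only
    almost surely, so it is killed on the exceptional set to remain adapted
    ([cut]). The minimum condition holds for each control value outside a null
    set depending on it; countably many values suffice ([ae_forall_sign]). *)

(** * Square-integrable functions *)

Section real_integrable.
Context (R : realType) (d : measure_display) (S : measurableType d)
  (nu : {measure set S -> \bar R}) (D : set S) (mD : measurable D).
Implicit Types f g : S -> R.

Definition intg f := nu.-integrable D (EFin \o f).

Lemma intgD f g : intg f -> intg g -> intg (fun x => f x + g x).
Proof. by move=> fi gi; have := integrableD mD fi gi; apply: eq_integrable. Qed.

Lemma intgZ k f : intg f -> intg (fun x => k * f x).
Proof. by move=> fi; have := integrableZl mD k fi; apply: eq_integrable. Qed.

Lemma intgN f : intg f -> intg (fun x => - f x).
Proof. by move=> /(@intgZ (-1)); under eq_fun do rewrite mulN1r. Qed.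

Lemma intgB f g : intg f -> intg g -> intg (fun x => f x - g x).
Proof. by move=> fi /intgN; exact: intgD. Qed.

End real_integrable.

Section square_integrable.
Context (R : realType) (d : measure_display) (S : measurableType d)
  (nu : {measure set S -> \bar R}) (D : set S) (mD : measurable D).
Implicit Types f g : S -> R.

Definition sq_int f :=
  measurable_fun D f /\ (\int[nu]_(x in D) (f x ^+ 2)%:E < +oo)%E.

(** The L2 scalar product; products of processes are handled through it, over
    the outcomes at a fixed time as well as over time and outcome. *)
Definition inner f g : R := \int[nu]_(x in D) (f x * g x).

Lemma sq_int_integrable f : sq_int f ->
  intg nu D (fun x => f x ^+ 2).
Proof.
move=> [mf foo]; apply/integrableP; split.
  exact/measurable_EFinP/measurable_funX.
rewrite (eq_integral (fun x => (f x ^+ 2)%:E))// => x _ /=.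
by rewrite ger0_norm// sqr_ge0.
Qed.

Lemma le_sq_int f g : measurable_fun D f -> sq_int g ->
  (forall x, D x -> `|f x| <= `|g x|) -> sq_int f.
Proof.
move=> mf [mg goo] fg; split => //; apply: le_lt_trans goo.
apply: ge0_le_integral => //.
- by move=> x _; rewrite lee_fin sqr_ge0.
- exact/measurable_EFinP/measurable_funX.
- exact/measurable_EFinP/measurable_funX.
- by move=> x Dx; rewrite lee_fin -[leLHS]real_normK ?num_real// -[leRHS]real_normK ?num_real// lerXn2r ?nnegrE// fg.
Qed.

Lemma sq_intM_integrable f g : sq_int f -> sq_int g ->
  intg nu D (fun x => f x * g x).
Proof.
move=> f2 g2.
apply: (@le_integrable _ _ _ nu D mD _
  (EFin \o (fun x => f x ^+ 2 + g x ^+ 2))).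
- apply/measurable_EFinP/measurable_funM; [exact: f2.1|exact: g2.1].
- move=> x _ /=; rewrite lee_fin [leRHS]ger0_norm ?addr_ge0 ?sqr_ge0//.
  by rewrite ler_norml; apply/andP; split; nra.
- by apply: intgD => //; exact: sq_int_integrable.
Qed.

Lemma sq_intZ k f : sq_int f -> sq_int (fun x => k * f x).
Proof.
move=> f2; split; first exact/measurable_funM/f2.1.
under eq_integral do rewrite exprMn EFinM.
rewrite integralZl//; last exact: sq_int_integrable.
rewrite lte_mul_pinfty ?lee_fin ?sqr_ge0//; exact: f2.2.
Qed.

Lemma sq_intD f g : sq_int f -> sq_int g -> sq_int (fun x => f x + g x).
Proof.
move=> f2 g2; split.
  by apply: measurable_funD; [exact: f2.1|exact: g2.1].
have i2 : intg nu D (fun x => 2 * f x ^+ 2 + 2 * g x ^+ 2).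
  by apply: intgD => //; apply: intgZ => //; exact: sq_int_integrable.
apply: le_lt_trans (integrable_lty mD i2).
apply: ge0_le_integral => //.
- by move=> x _; rewrite lee_fin sqr_ge0.
- apply/measurable_EFinP/measurable_funX/measurable_funD; [exact: f2.1|exact: g2.1].
- exact: measurable_int i2.
- by move=> x _ /=; rewrite lee_fin; have := sqr_ge0 (f x - g x); nra.
Qed.

Lemma sq_intN f : sq_int f -> sq_int (fun x => - f x).
Proof. by move=> /(@sq_intZ (-1)); under eq_fun do rewrite mulN1r. Qed.

Lemma sq_intB f g : sq_int f -> sq_int g -> sq_int (fun x => f x - g x).
Proof. by move=> f2 /sq_intN; exact: sq_intD. Qed.

Lemma sq_int0 : sq_int (fun=> 0).
Proof.
split; first exact: measurable_cst.
by under eq_integral do rewrite expr0n/=; rewrite integral0.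
Qed.

Lemma sq_int_sum (I : Type) (s : seq I) (f : I -> S -> R) :
  (forall i, sq_int (f i)) -> sq_int (fun x => \sum_(i <- s) f i x).
Proof.
move=> f2; elim: s => [|i s ih].
  by under eq_fun do rewrite big_nil; exact: sq_int0.
by under eq_fun do rewrite big_cons; exact: sq_intD.
Qed.

Lemma bounded_sq_int f C : (nu D < +oo)%E -> measurable_fun D f ->
  (forall x, D x -> `|f x| <= C) -> sq_int f.
Proof.
move=> Doo mf fC; split => //.
apply: (@le_lt_trans _ _ (\int[nu]_(x in D) (C ^+ 2)%:E)%E).
  apply: ge0_le_integral => //.
  - by move=> x _; rewrite lee_fin sqr_ge0.
  - exact/measurable_EFinP/measurable_funX.
  - move=> x Dx; rewrite lee_fin -[leLHS]real_normK ?num_real//.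
    have := fC x Dx; have := normr_ge0 (f x); nra.
rewrite integral_cst//= lte_mul_pinfty ?lee_fin ?sqr_ge0//.
Qed.

Lemma bounded_mul_sq_int (xi f : S -> R) C : measurable_fun D xi ->
  (forall x, D x -> `|xi x| <= C) -> sq_int f -> sq_int (fun x => xi x * f x).
Proof.
move=> mxi xiC f2; apply: (le_sq_int _ (sq_intZ C f2)).
  by apply: measurable_funM => //; exact: f2.1.
move=> x Dx; rewrite !normrM ler_wpM2r//.
exact: le_trans (xiC x Dx) (ler_norm _).
Qed.

Lemma sq_int_finite_integrable f : (nu D < +oo)%E -> sq_int f ->
  intg nu D f.
Proof.
move=> Doo f2.
have : sq_int (fun=> 1) by apply: (@bounded_sq_int _ 1) => // x _; rewrite normr1.
by move=> /(sq_intM_integrable f2); under eq_fun do rewrite mulr1.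
Qed.

Lemma innerC f g : inner f g = inner g f.
Proof. by apply: eq_Rintegral => x _; rewrite mulrC. Qed.

Lemma innerDl f g h : sq_int f -> sq_int g -> sq_int h ->
  inner (fun x => f x + g x) h = inner f h + inner g h.
Proof.
move=> f2 g2 h2; rewrite /inner -RintegralD//; last 2 first.
- exact: sq_intM_integrable.
- exact: sq_intM_integrable.
by apply: eq_Rintegral => x _; rewrite mulrDl.
Qed.

Lemma innerZl k f h : sq_int f -> sq_int h ->
  inner (fun x => k * f x) h = k * inner f h.
Proof.
move=> f2 h2; rewrite /inner -RintegralZl//; last exact: sq_intM_integrable.
by apply: eq_Rintegral => x _; rewrite mulrA.
Qed.

Lemma innerBl f g h : sq_int f -> sq_int g -> sq_int h ->
  inner (fun x => f x - g x) h = inner f h - inner g h.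
Proof.
move=> f2 g2 h2; rewrite /inner -RintegralB//; last 2 first.
- exact: sq_intM_integrable.
- exact: sq_intM_integrable.
by apply: eq_Rintegral => x _; rewrite mulrBl.
Qed.

Lemma innerDr f g h : sq_int f -> sq_int g -> sq_int h ->
  inner h (fun x => f x + g x) = inner h f + inner h g.
Proof. by move=> *; rewrite innerC innerDl// !(innerC h). Qed.

Lemma innerBr f g h : sq_int f -> sq_int g -> sq_int h ->
  inner h (fun x => f x - g x) = inner h f - inner h g.
Proof. by move=> *; rewrite innerC innerBl// !(innerC h). Qed.

Lemma innerDD f g h k : sq_int f -> sq_int g -> sq_int h -> sq_int k ->
  inner (fun x => f x + g x) (fun x => h x + k x) =
  inner f h + inner f k + (inner g h + inner g k).
Proof.
move=> f2 g2 h2 k2; rewrite innerDl//; last exact: sq_intD.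
by rewrite !innerDr.
Qed.

Lemma inner_suml (I : Type) (s : seq I) (f : I -> S -> R) h :
  (forall i, sq_int (f i)) -> sq_int h ->
  inner (fun x => \sum_(i <- s) f i x) h = \sum_(i <- s) inner (f i) h.
Proof.
move=> f2 h2; elim: s => [|i s ih].
  rewrite big_nil /inner; under eq_Rintegral do rewrite big_nil mul0r.
  by rewrite /Rintegral integral0.
rewrite big_cons -ih -innerDl//; last exact: sq_int_sum.
by apply: eq_Rintegral => x _; rewrite big_cons.
Qed.

Lemma inner_sumr (I : Type) (s : seq I) (f : I -> S -> R) h :
  (forall i, sq_int (f i)) -> sq_int h ->
  inner h (fun x => \sum_(i <- s) f i x) = \sum_(i <- s) inner h (f i).
Proof.
by move=> f2 h2; rewrite innerC inner_suml//; apply: eq_bigr => i _; exact: innerC.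
Qed.

Lemma inner_ge0 f : 0 <= inner f f.
Proof. by apply: Rintegral_ge0 => x _; rewrite -expr2 sqr_ge0. Qed.

Lemma EFin_inner f : sq_int f ->
  ((inner f f)%:E = \int[nu]_(x in D) (f x ^+ 2)%:E)%E.
Proof.
move=> f2; rewrite /inner /Rintegral fineK//.
exact/integrable_fin_num/(sq_intM_integrable f2 f2).
Qed.

Lemma inner_sqrD f g : sq_int f -> sq_int g ->
  inner (fun x => f x + g x) (fun x => f x + g x) =
  inner f f + 2 * inner f g + inner g g.
Proof.
move=> f2 g2; rewrite innerDl ?innerDr//; last exact: sq_intD.
by rewrite (innerC g f); ring.
Qed.

(** Nonnegativity of the square of [f + t g] and of [f - t g]. The weight [t]
    lets one factor be made small at the cost of the other. *)
Lemma inner_young t f g : 0 < t -> sq_int f -> sq_int g ->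
  2 * `|inner f g| <= t^-1 * inner f f + t * inner g g.
Proof.
move=> t0 f2 g2.
have h s : 0 <= inner f f + 2 * (s * inner f g) + s ^+ 2 * inner g g.
  have := inner_ge0 (fun x => f x + s * g x).
  rewrite inner_sqrD//; last exact: sq_intZ.
  have -> : inner f (fun x => s * g x) = s * inner f g.
    by rewrite innerC innerZl// innerC.
  have -> : inner (fun x => s * g x) (fun x => s * g x) = s ^+ 2 * inner g g.
    by rewrite innerZl ?(innerC g (fun x => _)) ?innerZl ?mulrA -?expr2//; exact: sq_intZ.
  by [].
have h1 : 0 <= t^-1 * (inner f f + 2 * (t * inner f g) + t ^+ 2 * inner g g).
  by apply: mulr_ge0 => //; rewrite invr_ge0 ltW.
have h2 : 0 <= t^-1 * (inner f f + 2 * (- t * inner f g) + (- t) ^+ 2 * inner g g).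
  by apply: mulr_ge0 => //; rewrite invr_ge0 ltW.
have tn0 : t != 0 by rewrite gt_eqF.
rewrite -[2]ger0_norm// -normrM ler_norml; apply/andP; split.
  rewrite -subr_ge0; apply: le_trans h1 _.
  by rewrite le_eqVlt; apply/orP; left; apply/eqP; field.
rewrite -subr_ge0; apply: le_trans h2 _.
by rewrite le_eqVlt; apply/orP; left; apply/eqP; field.
Qed.

Lemma inner_young1 f g : sq_int f -> sq_int g ->
  `|inner f g| <= inner f f + inner g g.
Proof.
move=> f2 g2; have := @inner_young 1 f g ltr01 f2 g2.
by rewrite invr1 !mul1r; have := normr_ge0 (inner f g); lra.
Qed.

Lemma inner_sqrD_le f g : sq_int f -> sq_int g ->
  inner (fun x => f x + g x) (fun x => f x + g x) <=
  2 * inner f f + 2 * inner g g.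
Proof.
move=> f2 g2; rewrite inner_sqrD//.
have := @inner_young 1 f g ltr01 f2 g2; rewrite invr1 !mul1r.
by have := ler_norm (inner f g); lra.
Qed.

(** Young's inequality bounds the cross terms by the squared distances, up to an
    arbitrarily small multiple of the squared norms of the limits. *)
Lemma inner_cvg (f_ g_ : nat -> S -> R) f g :
  (forall n, sq_int (f_ n)) -> (forall n, sq_int (g_ n)) ->
  sq_int f -> sq_int g ->
  inner (fun x => f_ n x - f x) (fun x => f_ n x - f x) @[n --> \oo] --> 0 ->
  inner (fun x => g_ n x - g x) (fun x => g_ n x - g x) @[n --> \oo] --> 0 ->
  inner (f_ n) (g_ n) @[n --> \oo] --> inner f g.
Proof.
move=> f_2 g_2 f2 g2 cf cg.
apply/cvgrPdist_le => e e0.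
pose M := inner f f + inner g g.
have M0 : 0 <= M by rewrite addr_ge0 ?inner_ge0.
(* Young's inequality is used with weight t on the fixed factors. *)
pose t := e / (M + 1).
have t0 : 0 < t by rewrite divr_gt0// ltr_wpDl.
pose r := Num.min (e / 8) (e / 8 * t).
have r0 : 0 < r.
  by rewrite lt_min; apply/andP; split; [|apply: mulr_gt0 => //]; rewrite divr_gt0.
move/cvgrPdist_le : cf => /(_ r r0) cf.
move/cvgrPdist_le : cg => /(_ r r0) cg.
near=> n.
set a := fun x => f_ n x - f x; set b := fun x => g_ n x - g x.
have a2 : sq_int a by exact: sq_intB.
have b2 : sq_int b by exact: sq_intB.
have ar : inner a a <= r.
  have : `|0 - inner a a| <= r by rewrite /a; near: n.
  by rewrite sub0r normrN ger0_norm// inner_ge0.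
have br : inner b b <= r.
  have : `|0 - inner b b| <= r by rewrite /b; near: n.
  by rewrite sub0r normrN ger0_norm// inner_ge0.
have -> : inner f g - inner (f_ n) (g_ n) =
    - (inner a b + inner a g + inner b f).
  rewrite /a /b innerBl// innerBr// innerBr// innerBl// innerBl//.
  by rewrite (innerC (g_ n)) (innerC g); ring.
rewrite normrN (le_trans (ler_normD _ _))//.
have h1 := inner_young1 a2 b2.
have h2 := inner_young t0 a2 g2.
have h3 := inner_young t0 b2 f2.
have h4 := ler_normD (inner a b) (inner a g).
have h5 : t^-1 * r <= e / 8.
  by rewrite mulrC ler_pdivrMr// ge_min lexx orbT.
have h6 : r <= e / 8 by rewrite ge_min lexx.
have h7 : t^-1 * inner a a <= e / 8.
  by rewrite (le_trans _ h5)// ler_wpM2l// invr_ge0 ltW.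
have h8 : t^-1 * inner b b <= e / 8.
  by rewrite (le_trans _ h5)// ler_wpM2l// invr_ge0 ltW.
have h9 : t * inner f f + t * inner g g <= e.
  rewrite -mulrDr -/M /t -mulrA ler_piMr ?(ltW e0)// ler_pdivrMl ?ltr_wpDl//.
  by rewrite mulr1; lra.
lra.
Unshelve. all: by end_near.
Qed.

Lemma sq_int_cvg (f_ : nat -> S -> R) f :
  (forall n, sq_int (f_ n)) -> measurable_fun D f ->
  (\int[nu]_(x in D) ((f_ n x - f x) ^+ 2)%:E)%E @[n --> \oo] --> 0%E ->
  sq_int f.
Proof.
move=> f_2 mf cf.
have [n hn] : exists n, (\int[nu]_(x in D) ((f_ n x - f x) ^+ 2)%:E < 1)%E.
  near \oo => n; exists n.
  near: n; move/fine_cvgP : cf => [cf1 /cvgrPdist_lt /(_ 1 ltr01) cf2].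
  near=> n; have fn : (\int[nu]_(x in D) ((f_ n x - f x) ^+ 2)%:E)%E \is a fin_num.
    by near: n.
  rewrite -(fineK fn) lte_fin.
  have : `|0 - fine (\int[nu]_(x in D) ((f_ n x - f x) ^+ 2)%:E)%E| < 1.
    by near: n.
  by rewrite sub0r normrN; apply: le_lt_trans; exact: ler_norm.
have d2 : sq_int (fun x => f_ n x - f x).
  split; first by apply: measurable_funB => //; exact: (f_2 n).1.
  by rewrite (lt_trans hn)// ltry.
have := sq_intB (f_2 n) d2.
by under eq_fun do rewrite subKr.
Unshelve. all: by end_near.
Qed.

Lemma inner_cvg0 (f_ : nat -> S -> R) f :
  (forall n, sq_int (f_ n)) -> sq_int f ->
  (\int[nu]_(x in D) ((f_ n x - f x) ^+ 2)%:E)%E @[n --> \oo] --> 0%E ->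
  inner (fun x => f_ n x - f x) (fun x => f_ n x - f x) @[n --> \oo] --> 0.
Proof.
move=> f_2 f2 cf; apply/fine_cvg; rewrite -[X in _ --> X]/(0%E).
apply: cvg_trans cf; apply: near_eq_cvg; near=> n.
rewrite -EFin_inner//; exact: sq_intB.
Unshelve. all: by end_near.
Qed.

End square_integrable.

(** * Moments of the centred normal law *)

Section normal_moments.
Context (R : realType).
Local Notation mu := (@lebesgue_measure R).
Variable s : R.
Hypothesis s0 : 0 < s.
Let sn0 : s != 0. Proof. by rewrite gt_eqF. Qed.
Local Notation g := (normal_pdf 0 s).

Lemma ge0_integral_normal_prob (f : R -> \bar R) :
  (forall x, (0 <= f x)%E) -> measurable_fun setT f ->
  (\int[normal_prob 0 s]_x f x = \int[mu]_x (f x * (g x)%:E))%E.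
Proof.
move=> f0 mf.
rewrite -(@Radon_Nikodym_SigmaFinite.change_of_variables _ _ _
  (normal_prob 0 s) mu)//; last exact: normal_prob_dominates.
have mg : measurable_fun setT (EFin \o g).
  by apply/measurable_EFinP; exact: measurable_normal_pdf.
have iRN : mu.-integrable setT
    (Radon_Nikodym_SigmaFinite.f (normal_prob 0 s) mu).
  by apply: Radon_Nikodym_SigmaFinite.f_integrable; exact: normal_prob_dominates.
apply: ae_eq_integral => //.
- by apply: emeasurable_funM => //; exact: measurable_int iRN.
- exact: emeasurable_funM.
- apply: ae_eqe_mul2l; apply: integral_ae_eq => // E _ mE.
  rewrite -Radon_Nikodym_SigmaFinite.f_integral//.
  exact: normal_prob_dominates.
Qed.

Lemma normal_pdf_val x :
  g x = normal_peak s * expR (- (x ^+ 2 / (s ^+ 2 *+ 2))).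
Proof. by rewrite normal_pdfE// /normal_fun subr0 mulNr. Qed.

Lemma normal_pdf_even x : g (- x) = g x.
Proof. by rewrite !normal_pdf_val sqrrN. Qed.

Lemma is_derive_normal_pdf (x : R) : is_derive x 1 g (- (x / s ^+ 2) * g x).
Proof.
rewrite [g](_ : _ = fun y => normal_peak s * expR (- (y ^+ 2 / (s ^+ 2 *+ 2)))).
  apply: is_derive_eq.
  rewrite /GRing.scale/= !(mulr1, expr1, mulr0, add0r, addr0).
  rewrite -mulr_natr; field => //.
by apply/funext => y; exact: normal_pdf_val.
Qed.

(** From [e^y >= 1 + y]: the exponential beats the linear factor. This kills the
    boundary term of the integration by parts below. *)
Lemma cvg_id_normal_pdf : n%:R * g n%:R @[n --> \oo] --> 0.
Proof.
apply: (@squeeze_cvgr _ _ _ _ (fun=> 0) (fun n => normal_peak s * (s ^+ 2 *+ 2) * n%:R^-1)).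
- near=> n.
  have n0 : 0 < n%:R :> R by rewrite ltr0n; near: n; exact: nbhs_infty_gt.
  rewrite mulr_ge0 ?normal_pdf_ge0 ?ler0n//=.
  have c0 : 0 < s ^+ 2 *+ 2 by rewrite pmulrn_lgt0// exprn_gt0.
  rewrite normal_pdf_val expRN.
  have e0 : 0 < n%:R ^+ 2 / (s ^+ 2 *+ 2) by rewrite divr_gt0// exprn_gt0.
  have := expR_ge1Dx (n%:R ^+ 2 / (s ^+ 2 *+ 2)) => h.
  have {}h : n%:R ^+ 2 / (s ^+ 2 *+ 2) <= expR (n%:R ^+ 2 / (s ^+ 2 *+ 2)) by lra.
  rewrite mulrCA -mulrA. rewrite ler_wpM2l ?normal_peak_ge0//.
  rewrite -lef_pV2 ?posrE ?expR_gt0// in h.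
  apply: le_trans (ler_wpM2l (ltW n0) h) _.
  rewrite le_eqVlt; apply/orP; left; apply/eqP.
  by field; rewrite gt_eqF//= gt_eqF.
- exact: cvg_cst.
- rewrite -(mulr0 (normal_peak s * (s ^+ 2 *+ 2))).
  apply: cvgM; first exact: cvg_cst.
  apply/gtr0_cvgV0; first by near=> n; rewrite ltr0n; near: n; exact: nbhs_infty_gt.
  exact: cvgr_idn.
Unshelve. all: by end_near.
Qed.

(** Integration by parts: [x g(x)] is the derivative of [- s ^+ 2 g(x)], which
    turns the integral of [x ^+ 2 g(x)] over [[0, n]] into that of
    [s ^+ 2 g(x)]; symmetry gives the negative half-line. *)
Lemma integral_sqr_normal_pdf :
  (\int[mu]_x (x ^+ 2 * g x)%:E = (s ^+ 2)%:E)%E.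
Proof.
have cg : continuous g by exact: continuous_normal_pdf.
have cx2 : continuous (fun x : R => x ^+ 2 * g x).
  by move=> x; apply: cvgM; [exact: sqr_continuous|exact: cg].
have half : (\int[mu]_(x in `[0%R, +oo[) (x ^+ 2 * g x)%:E =
    (s ^+ 2)%:E * \int[mu]_(x in `[0%R, +oo[) (g x)%:E)%E.
  have h1 := @ge0_cvgn_integral R mu (fun x : R => x ^+ 2 * g x).
  have h2 := @ge0_cvgn_integral R mu (fun x : R => s ^+ 2 * g x).
  transitivity (\int[mu]_(x in `[0%R, +oo[) (s ^+ 2 * g x)%:E)%E; last first.
    under eq_integral do rewrite EFinM.
    rewrite ge0_integralZl//=.
    - apply/measurable_EFinP/measurable_funTS; exact: measurable_normal_pdf.
    - by move=> x _; rewrite lee_fin normal_pdf_ge0.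
    - by rewrite lee_fin sqr_ge0.
  have {}h1 : (\int[mu]_(x in `[0%R, n%:R]) (x ^+ 2 * g x)%:E @[n --> \oo] -->
      \int[mu]_(x in `[0%R, +oo[) (x ^+ 2 * g x)%:E)%E.
    apply: h1 => [x|]; first by rewrite mulr_ge0 ?sqr_ge0 ?normal_pdf_ge0.
    exact: continuous_measurable_fun.
  have {}h2 : (\int[mu]_(x in `[0%R, n%:R]) (s ^+ 2 * g x)%:E @[n --> \oo] -->
      \int[mu]_(x in `[0%R, +oo[) (s ^+ 2 * g x)%:E)%E.
    apply: h2 => [x|]; first by rewrite mulr_ge0 ?sqr_ge0 ?normal_pdf_ge0.
    apply: measurable_funM => //; exact: measurable_normal_pdf.
  have h3 : ((- s ^+ 2 * (n%:R * g n%:R))%:E @[n --> \oo] --> 0%E)%E.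
    apply: cvg_EFin; first by apply: nearW.
    have : - s ^+ 2 * (n%:R * g n%:R) @[n --> \oo] --> - s ^+ 2 * 0.
      by apply: cvgMr; exact: cvg_id_normal_pdf.
    by rewrite mulr0.
  have {}h2 := cvgeD (@fin_num_adde_defl R _ 0%E isT) h2 h3; rewrite adde0 in h2.
  apply: (@cvg_unique _ (@ereal_hausdorff R) _ _ _ _ h1).
  apply: cvg_trans (h2 _).
  apply: near_eq_cvg; near=> n.
  have n0 : 0 < n%:R :> R by rewrite ltr0n; near: n; exact: nbhs_infty_gt.
  rewrite /=.
  have dG (x : R) : is_derive x 1 (fun x => - s ^+ 2 * g x) (x * g x).
    have := is_derive_normal_pdf x => ?; apply: is_derive_eq.
    by rewrite /GRing.scale/=; field.
  have cG : continuous (fun x : R => - s ^+ 2 * g x).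
    by move=> x; apply: cvgM; [exact: cvg_cst|exact: cg].
  have := @integration_by_parts R id (fun x => - s ^+ 2 * g x) (cst 1)
    (fun x => x * g x) 0 n%:R n0.
  rewrite mul0r subr0.
  under eq_integral do rewrite mulrA -expr2.
  move=> ->; last 6 first.
  - by apply: continuous_subspaceT => x; exact: cvg_cst.
  - by split => [x _||]; [exact: derivable_id|exact: cvg_at_right_filter|exact: cvg_at_left_filter].
  - by move=> x _; rewrite derive1E derive_id.
  - by apply: continuous_subspaceT => x; apply: cvgM; [exact: cvg_id|exact: cg].
  - split => [x _||]; first exact: (@ex_derive _ _ _ _ _ _ _ (dG x)).
    + apply: cvg_at_right_filter; exact: cG.
    + apply: cvg_at_left_filter; exact: cG.
  - by move=> x _; rewrite derive1E (@derive_val _ _ _ _ _ _ _ (dG x)).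
  rewrite mulrCA addeC; congr (_ + _)%E.
  under [in RHS]eq_integral do rewrite /= mul1r mulNr EFinN.
  rewrite integral_ge0N ?oppeK// => x _.
  by rewrite lee_fin mulr_ge0 ?sqr_ge0 ?normal_pdf_ge0.
rewrite ge0_symfun_integralT//; last 2 first.
- by move=> x; rewrite mulr_ge0 ?sqr_ge0 ?normal_pdf_ge0.
- by move=> x /=; rewrite sqrrN normal_pdf_even.
rewrite -set_itvcy half muleCA.
have := integral_normal_pdf 0 s.
rewrite ge0_symfun_integralT//; last 2 first.
- by move=> x; rewrite normal_pdf_ge0.
- by move=> x /=; rewrite normal_pdf_even.
by rewrite -set_itvcy => ->; rewrite mule1.
Unshelve. all: by end_near.
Qed.

Lemma normal_second_moment :
  (\int[normal_prob 0 s]_x (x ^+ 2)%:E = (s ^+ 2)%:E)%E.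
Proof.
rewrite ge0_integral_normal_prob.
- by under eq_integral do rewrite -EFinM; exact: integral_sqr_normal_pdf.
- by move=> x; rewrite lee_fin sqr_ge0.
- apply/measurable_EFinP; exact: exprn_measurable.
Qed.

Lemma normal_sq_int : sq_int (normal_prob 0 s) setT id.
Proof.
by split; [exact: measurable_id|rewrite normal_second_moment ltry].
Qed.

Lemma normal_prob_even (A : set (measurableTypeR R)) : measurable A ->
  normal_prob 0 s A = normal_prob 0 s (-%R @^-1` A).
Proof.
move=> mA; rewrite /normal_prob.
have mN : measurable_fun setT (-%R : measurableTypeR R -> measurableTypeR R).
  exact: oppr_measurable.
rewrite (@eq_measure_integral _ _ _ _
    (pushforward mu (-%R : measurableTypeR R -> measurableTypeR R)))/=; last first.
  by move=> B mB _; rewrite lebesgue_measureN.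
rewrite ge0_integral_pushforward//.
- by apply: eq_integral => x _ /=; rewrite normal_pdf_even.
- apply/measurable_EFinP; apply: measurable_funTS.
  exact: measurable_normal_pdf.
- by move=> x _; rewrite lee_fin normal_pdf_ge0.
Qed.

(** By symmetry of the law the mean is its own opposite; the second moment
    makes it finite. *)
Lemma normal_mean : \int[normal_prob 0 s]_x x = 0.
Proof.
have iid : (normal_prob 0 s).-integrable setT (EFin \o id).
  apply: (sq_int_finite_integrable measurableT _ normal_sq_int).
  apply: (@le_lt_trans _ _ 1%E); last exact: ltry.
  exact: (@probability_le1 _ _ _ (normal_prob 0 s) setT).
have mN : measurable_fun setT (-%R : measurableTypeR R -> measurableTypeR R).
  exact: oppr_measurable.
have : \int[normal_prob 0 s]_x x = \int[normal_prob 0 s]_x (-1 * x).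
  congr fine.
  rewrite [LHS](@eq_measure_integral _ _ _ _
    (pushforward (normal_prob 0 s) (-%R : measurableTypeR R -> measurableTypeR R)))/=; last first.
    by move=> A mA _; exact: normal_prob_even.
  rewrite integral_pushforward//=.
  - by apply: eq_integral => x _ /=; rewrite mulN1r.
  - by have := integrableN iid.
rewrite RintegralZl// mulN1r => /eqP.
by rewrite -subr_eq0 opprK -mulr2n mulrn_eq0 => /eqP.
Qed.

End normal_moments.

(** * Expectation of a product of independent variables *)

Section independence.
Context (R : realType) (d : measure_display) (Omega : measurableType d)
  (P : probability Omega R).

Lemma ae_iff_measure (A B : set Omega) : measurable A -> measurable B ->
  {ae P, forall w, A w <-> B w} -> P A = P B.
Proof.
move=> mA mB AB; rewrite -(setIT A) -(setIT B) -!integral_indic//.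
apply: ae_eq_integral => //.
- by apply/measurable_EFinP.
- by apply/measurable_EFinP.
apply: filterS AB => w ABw _; congr EFin; rewrite !indicE.
by congr (nat_of_bool _)%:R; apply/idP/idP; rewrite !inE; tauto.
Qed.

(** The joint law of independent variables is the product of their laws, so the
    expectation of the product is given by Fubini's theorem. *)
Lemma indep_expectationM (X Y : {RV P >-> R}) :
  (forall A B, measurable A -> measurable B ->
    P (X @^-1` A `&` Y @^-1` B) = (P (X @^-1` A) * P (Y @^-1` B))%E) ->
  P.-integrable setT (EFin \o X) -> P.-integrable setT (EFin \o Y) ->
  intg P setT (fun w => X w * Y w) ->
  \int[P]_w (X w * Y w) = (\int[P]_w X w) * (\int[P]_w Y w).
Proof.
move=> XY iX iY iXY.
pose f (w : Omega) := (X w, Y w).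
have mf : measurable_fun setT f.
  by apply/measurable_fun_pairP; split; [exact: (measurable_funPT X)|exact: (measurable_funPT Y)].
pose Z := @mfun_Sub _ _ _ _ f (mem_set mf).
pose m1 := distribution P X.
pose m2 := distribution P Y.
have lawE A : measurable A -> (m1 \x m2)%E A = distribution P Z A.
  by apply: product_measure_unique => B C mB mC; exact: XY.
pose F (z : R * R) : \bar R := (z.1 * z.2)%:E.
have mF : measurable_fun setT F.
  apply/measurable_EFinP/measurable_funM; [exact: measurable_fst|exact: measurable_snd].
have iF : (m1 \x m2)%E.-integrable setT F.
  apply/integrableP; split => //.
  rewrite (@eq_measure_integral _ _ _ _ (distribution P Z)); last first.
    by move=> A mA _; exact: lawE.
  rewrite ge0_integral_distribution//; last exact: measurableT_comp.
  by move/integrableP : iXY => [].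
have eXY : (\int[P]_w (X w * Y w)%:E = \int[m1]_x \int[m2]_y F (x, y))%E.
  rewrite (integral12_prod_meas1 iF).
  rewrite (@eq_measure_integral _ _ _ _ (distribution P Z)); last first.
    by move=> A mA _; exact: lawE.
  by rewrite integral_distribution.
have eX : (\int[m1]_x x%:E = \int[P]_w (X w)%:E)%E.
  by rewrite integral_distribution.
have eY : (\int[m2]_x x%:E = \int[P]_w (Y w)%:E)%E.
  by rewrite integral_distribution.
have i1 : m1.-integrable setT (EFin \o id).
  apply/integrableP; split; first by apply/measurable_EFinP.
  rewrite /m1 ge0_integral_distribution//; last first.
    by apply: measurableT_comp => //; apply/measurable_EFinP.
  by move/integrableP : iX => [].
have i2 : m2.-integrable setT (EFin \o id).
  apply/integrableP; split; first by apply/measurable_EFinP.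
  rewrite /m2 ge0_integral_distribution//; last first.
    by apply: measurableT_comp => //; apply/measurable_EFinP.
  by move/integrableP : iY => [].
rewrite /Rintegral eXY.
have eF x : (\int[m2]_y F (x, y) = x%:E * \int[P]_w (Y w)%:E)%E.
  by rewrite /F/=; under eq_integral do rewrite EFinM; rewrite integralZl// eY.
rewrite (@eq_integral _ _ _ m1 setT (fun x => x%:E * \int[P]_w (Y w)%:E)%E); last first.
  by move=> x _; exact: eF.
rewrite -(fineK (integrable_fin_num measurableT iY)).
by rewrite integralZr// eX fineM// ?integrable_fin_num.
Qed.

End independence.

(** * The augmented Brownian filtration *)

Section filtration.
Context (R : realType) (d : measure_display) (Omega : measurableType d)
  (P : probability Omega R) (W : R -> Omega -> R)
  (hW : brownian_motion P W).
Local Notation Fm := (filtration_measurable P W).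
Local Notation FW t := <<s filtration_events P W t >>.

Lemma filtration_events_measurable t A : FW t A -> measurable A.
Proof.
apply: smallest_sub; first exact: sigma_algebra_measurable.
move=> B [[s + [C mC ->]]|[]//].
rewrite in_itv/= => /andP[s0 _].
by rewrite -[_ @^-1` _]setTI; exact: (bm_measurable hW s0).
Qed.

Lemma filtration_events_mono s t A : s <= t -> FW s A -> FW t A.
Proof.
move=> st; apply: sub_smallest2r; first exact: smallest_sigma_algebra.
move=> B [[r + [C mC ->]]|N0]; last by right.
rewrite in_itv/= => /andP[r0 rs]; left; exists r; last by exists C.
by rewrite in_itv/= r0 (le_trans rs).
Qed.

Lemma Fm_preimage t xi B : Fm t xi -> measurable B -> FW t (xi @^-1` B).
Proof.
move=> /(_ measurableT) h mB; have := h B mB.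
by rewrite setTI.
Qed.

Lemma Fm_intro t (xi : Omega -> R) :
  (forall B : set R, measurable B -> FW t (xi @^-1` B)) -> Fm t xi.
Proof. by move=> h _ B mB; rewrite setTI; exact: h. Qed.

Lemma Fm_measurable t xi : Fm t xi -> measurable_fun setT xi.
Proof.
move=> h _ B mB; rewrite setTI; apply: (@filtration_events_measurable t).
exact: Fm_preimage.
Qed.

Lemma Fm_mono s t xi : s <= t -> Fm s xi -> Fm t xi.
Proof.
move=> st h; apply: Fm_intro => B mB.
by apply: filtration_events_mono st _; exact: Fm_preimage.
Qed.

Lemma FmM t xi eta : Fm t xi -> Fm t eta -> Fm t (fun w => xi w * eta w).
Proof. exact: measurable_funM. Qed.

Lemma FmB t xi eta : Fm t xi -> Fm t eta -> Fm t (fun w => xi w - eta w).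
Proof. exact: measurable_funB. Qed.

Lemma Fm_W s t : 0 <= s -> s <= t -> Fm t (W s).
Proof.
move=> s0 st; apply: Fm_intro => B mB; apply: sub_gen_smallest.
by left; exists s; [rewrite in_itv/= s0|exists B].
Qed.

Lemma Fm_increment r s t : 0 <= r -> r <= s -> s <= t -> Fm t (increment W r s).
Proof.
move=> r0 rs st; apply: FmB; apply: Fm_W => //; first exact: le_trans rs.
exact: le_trans st.
Qed.

(** The events that differ by a null set from an event of the past of the path
    form a sigma-algebra containing the generators of the augmented filtration;
    hence the independence of increments survives the augmentation. *)
Lemma increment_indep s t A (B : set R) : 0 <= s -> s < t -> FW s A ->
  measurable B ->
  P (A `&` increment W s t @^-1` B) = (P A * P (increment W s t @^-1` B))%E.
Proof.
move=> s0 st FA mB.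
have pastm (C : set Omega) : <<s past_events W s >> C -> measurable C.
  move=> hC; apply: (@filtration_events_measurable s).
  apply: sub_smallest2r hC; first exact: smallest_sigma_algebra.
  by move=> ? ?; left.
have [mA [A' [FA' AA']]] : (measurable `&`
    [set C : set Omega | exists C', <<s past_events W s >> C' /\
       {ae P, forall w, C w <-> C' w}]) A.
  apply: FA; split; last first.
    move=> C [hC|[mC C0]].
      split; first by apply: pastm; exact: sub_gen_smallest.
      exists C; split; first exact: sub_gen_smallest.
      by apply: nearW.
    split => //; exists set0; split.
      exact: (@measurable0 _ (g_sigma_algebraType (past_events W s))).
    exists C; split => // w /=; apply: contra_notP => nC; split => //.
  split.
  - split => //; exists set0; split.
      exact: (@measurable0 _ (g_sigma_algebraType (past_events W s))).
    by apply: nearW.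
  - move=> C [mC [C' [FC' CC']]]; rewrite setTD; split; first exact: measurableC.
    exists (~` C'); split.
      exact: (@measurableC _ (g_sigma_algebraType (past_events W s))).
    by apply: filterS CC' => w CC' /=; tauto.
  - move=> C hC; split; first by apply: bigcup_measurable => k _; exact: (hC k).1.
    have [C' hC'] := choice (fun k => (hC k).2).
    exists (\bigcup_k C' k); split.
      apply: (@bigcup_measurable _ (g_sigma_algebraType (past_events W s))) => k _.
      exact: (hC' k).1.
    have : {ae P, forall w, forall k, C k w <-> C' k w}.
      by apply: ae_foralln => k; exact: (hC' k).2.
    apply: filterS => w CC'; split => -[k _ Ck]; exists k => //; exact/CC'.
have mE : measurable (increment W s t @^-1` B).
  rewrite -[_ @^-1` _]setTI.
  by apply: (@Fm_measurable t) => //; exact: Fm_increment (ltW st) _.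
have mA' := pastm _ FA'.
rewrite (ae_iff_measure mA mA' AA').
rewrite -(bm_independent hW)//.
apply: ae_iff_measure; [exact: measurableI|exact: measurableI|].
by apply: filterS AA' => w h /=; tauto.
Qed.

(** The path starts almost surely at 0, so each generator has probability 0 or
    1, a property inherited by complements and countable unions. *)
Lemma F0_trivial A : FW 0 A -> P A = 0%E \/ P A = 1%E.
Proof.
move=> FA.
have [_ h] : (measurable `&` [set C : set Omega | P C = 0%E \/ P C = 1%E]) A.
  apply: FA; split; last first.
    move=> C [[s + [B mB ->]]|[mC C0]]; last by split => //; left.
    rewrite in_itv/= -eq_le => /eqP <-.
    have mWB : measurable (W 0 @^-1` B).
      by rewrite -[_ @^-1` _]setTI; exact: (bm_measurable hW (lexx 0)).
    split => //.
    have [B0|B0] := pselect (B 0); [right|left].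
      rewrite -(probability_setT P); apply: ae_iff_measure => //.
      by apply: filterS (bm_start hW) => w /= ->.
    rewrite -(measure0 P); apply: ae_iff_measure => //.
    by apply: filterS (bm_start hW) => w /= ->.
  split.
  - by split => //; left; exact: measure0.
  - move=> C [mC hC]; rewrite setTD; split; first exact: measurableC.
    rewrite /= probability_setC//; case: hC => ->; [right|left].
      by rewrite sube0.
    by rewrite subee.
  - move=> C hC; have mU : measurable (\bigcup_k C k).
      by apply: bigcup_measurable => k _; exact: (hC k).1.
    split => //; have [[k Ck]|nC] := pselect (exists k, P (C k) = 1%E).
      right; apply/eqP; rewrite eq_le probability_le1//= -Ck.
      apply: le_measure; rewrite ?inE//; first exact: (hC k).1.
      exact: bigcup_sup.
    left; apply: measure_negligible => //; apply: negligible_bigcup => k.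
    apply/negligibleP; first exact: (hC k).1.
    by case: (hC k).2 => // Ck; exfalso; apply: nC; exists k.
by [].
Qed.

End filtration.

(** * Increments of Brownian motion *)

Section brownian_increments.
Context (R : realType) (d : measure_display) (Omega : measurableType d)
  (P : probability Omega R) (W : R -> Omega -> R)
  (hW : brownian_motion P W).
Local Notation Fm := (filtration_measurable P W).
Local Notation FW t := <<s filtration_events P W t >>.
Local Notation inc := (increment W).
Local Notation E f := (Rintegral P setT f).
Implicit Types xi eta : Omega -> R.

Lemma prob_fin : (P setT < +oo)%E.
Proof. by rewrite probability_setT ltry. Qed.

Lemma inc_measurable s t : 0 <= s -> s <= t -> measurable_fun setT (inc s t).
Proof. by move=> s0 st; apply: (@Fm_measurable _ _ _ P W hW t); exact: Fm_increment. Qed.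

Lemma ge0_integral_increment s t (f : R -> \bar R) : 0 <= s -> s < t ->
  (forall x, (0 <= f x)%E) -> measurable_fun setT f ->
  (\int[P]_w f (inc s t w) = \int[normal_prob 0 (Num.sqrt (t - s))]_x f x)%E.
Proof.
move=> s0 st f0 mf.
have mD : measurable_fun setT (inc s t : Omega -> measurableTypeR R).
  exact: inc_measurable s0 (ltW st).
rewrite (@eq_measure_integral _ _ _ _ (pushforward P (inc s t : Omega -> measurableTypeR R)))/=; last first.
  by move=> A mA _; rewrite -(bm_gaussian hW).
by rewrite ge0_integral_pushforward.
Qed.

Lemma inc_second_moment s t : 0 <= s -> s <= t ->
  (\int[P]_w (inc s t w ^+ 2)%:E = (t - s)%:E)%E.
Proof.
move=> s0; rewrite le_eqVlt => /predU1P[<-|st].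
  rewrite subrr; under eq_integral do rewrite /increment subrr expr0n/=.
  by rewrite integral0.
rewrite (ge0_integral_increment (f := fun x => (x ^+ 2)%:E))//.
- by rewrite normal_second_moment ?sqr_sqrtr ?subr_ge0 ?(ltW st)// sqrtr_gt0 subr_gt0.
- by move=> x; rewrite lee_fin sqr_ge0.
- by apply/measurable_EFinP; exact: exprn_measurable.
Qed.

Lemma inc_sq_int s t : 0 <= s -> s <= t -> sq_int P setT (inc s t).
Proof.
move=> s0 st; split; first exact: inc_measurable.
by rewrite inc_second_moment// ltry.
Qed.

Lemma inc_mean s t : 0 <= s -> s <= t -> E (inc s t) = 0.
Proof.
move=> s0; rewrite le_eqVlt => /predU1P[<-|st].
  under eq_Rintegral do rewrite /increment subrr.
  by rewrite /Rintegral integral0.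
have mD : measurable_fun setT (inc s t : Omega -> measurableTypeR R).
  exact: inc_measurable s0 (ltW st).
have sq0 : 0 < Num.sqrt (t - s) by rewrite sqrtr_gt0 subr_gt0.
rewrite -(normal_mean sq0); congr fine.
rewrite [RHS](@eq_measure_integral _ _ _ _ (pushforward P (inc s t : Omega -> measurableTypeR R)))/=; last first.
  by move=> A mA _; rewrite -(bm_gaussian hW).
rewrite integral_pushforward//.
exact: (sq_int_finite_integrable measurableT prob_fin (inc_sq_int s0 (ltW st))).
Qed.

Lemma inc_indep_expectation s t eta (g : R -> R) : 0 <= s -> s < t ->
  Fm s eta -> measurable_fun setT g ->
  intg P setT eta -> intg P setT (g \o inc s t) ->
  intg P setT (fun w => eta w * g (inc s t w)) ->
  E (fun w => eta w * g (inc s t w)) = E eta * E (g \o inc s t).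
Proof.
move=> s0 st Fe mg ie ig ieg.
have me : measurable_fun setT eta by exact: Fm_measurable Fe.
have mD := inc_measurable s0 (ltW st).
have mgD : measurable_fun setT (g \o inc s t) by exact: measurableT_comp.
apply: (@indep_expectationM _ _ _ P (mfun_Sub (mem_set me)) (mfun_Sub (mem_set mgD))) => //.
move=> A B mA mB /=.
have mgB : measurable (g @^-1` B) by rewrite -[_ @^-1` _]setTI; exact: mg.
have := increment_indep hW s0 st (Fm_preimage Fe mA) mgB.
by [].
Qed.

Lemma inner_inc s t eta : 0 <= s -> s <= t -> Fm s eta -> sq_int P setT eta ->
  inner P setT eta (inc s t) = 0.
Proof.
move=> s0; rewrite le_eqVlt => /predU1P[<-|st] Fe e2.
  rewrite /inner; under eq_Rintegral do rewrite /increment subrr mulr0.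
  by rewrite /Rintegral integral0.
have D2 := inc_sq_int s0 (ltW st).
rewrite /inner (@inc_indep_expectation s t eta id)//.
- by rewrite inc_mean ?mulr0// ltW.
- exact: sq_int_finite_integrable prob_fin e2.
- exact: sq_int_finite_integrable prob_fin D2.
- exact: sq_intM_integrable.
Qed.

Lemma integral_mul_inc_sqr s t xi C : 0 <= s -> s <= t -> Fm s xi ->
  (forall w, `|xi w| <= C) ->
  inner P setT (fun w => xi w * inc s t w) (inc s t) = (t - s) * E xi.
Proof.
move=> s0; rewrite le_eqVlt => /predU1P[<-|st] Fx xC.
  rewrite /inner subrr mul0r; under eq_Rintegral do rewrite /increment subrr mulr0.
  by rewrite /Rintegral integral0.
have D2 := inc_sq_int s0 (ltW st).
have mx : measurable_fun setT xi by exact: Fm_measurable Fx.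
have x2 : sq_int P setT xi by apply: (bounded_sq_int measurableT prob_fin mx).
have xD2 := bounded_mul_sq_int measurableT mx (fun w _ => xC w) D2.
rewrite /inner.
transitivity (E (fun w => xi w * (fun x => x ^+ 2) (inc s t w))).
  by apply: eq_Rintegral => w _ /=; rewrite expr2 mulrA.
rewrite (@inc_indep_expectation s t xi (fun x => x ^+ 2))//.
- rewrite mulrC; congr (_ * _).
  by rewrite /Rintegral/= inc_second_moment ?(ltW st).
- exact: sq_int_finite_integrable prob_fin x2.
- exact: sq_int_integrable D2.
- have := sq_intM_integrable measurableT xD2 D2.
  by apply: eq_integrable => // w _ /=; rewrite expr2 mulrA.
Qed.

(** Length of the intersection of two intervals. *)
Definition overlap (r r' v v' : R) : R := Num.max 0 (Num.min r' v' - Num.max r v).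

(** Cutting both increments at the ends of the common part of the intervals
    leaves products of a variable with an increment in its future, which have
    mean zero, and one square of the increment over the common part. *)
Lemma inner_inc_inc_le r r' v v' xi eta C : 0 <= r -> r <= r' -> r <= v ->
  v <= v' -> measurable_fun setT xi -> measurable_fun setT eta ->
  (r < r' -> Fm r xi) -> (v < v' -> Fm v eta) ->
  (forall w, `|xi w| <= C) -> (forall w, `|eta w| <= C) ->
  inner P setT (fun w => xi w * inc r r' w) (fun w => eta w * inc v v' w) =
  E (fun w => xi w * eta w) * overlap r r' v v'.
Proof.
move=> r0 rr' rv vv' mxi meta Fxi Feta xiC etaC.
have v0 : 0 <= v := le_trans r0 rv.
have zero (f g : Omega -> R) : (forall w, f w * g w = 0) -> inner P setT f g = 0.
  move=> fg; rewrite /inner; under eq_Rintegral do rewrite fg.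
  by rewrite /Rintegral integral0.
have [rr'e|rr'n] := eqVneq r r'.
  rewrite /overlap -rr'e (max_idPr rv) (min_idPl (le_trans rv vv')).
  rewrite (max_idPl _) ?subr_le0// mulr0; apply: zero => w.
  by rewrite /increment subrr mulr0 mul0r.
have [vv'e|vv'n] := eqVneq v v'.
  rewrite /overlap -vv'e (max_idPr rv) (max_idPl _) ?mulr0; last first.
    by rewrite subr_le0 ge_min lexx orbT.
  by apply: zero => w; rewrite /increment subrr !mulr0.
have {rr'n}rr'l : r < r' by rewrite lt_neqAle rr'n.
have {vv'n}vv'l : v < v' by rewrite lt_neqAle vv'n.
pose z w := xi w * eta w.
have Fz : Fm v z by apply: FmM; [exact: Fm_mono rv (Fxi _)|exact: Feta].
have mz : measurable_fun setT z by exact: measurable_funM.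
have zC w : `|z w| <= C * C by rewrite normrM ler_pM.
have zinc a b : 0 <= a -> a <= b -> sq_int P setT (fun w => z w * inc a b w).
  move=> a0 ab.
  exact: (bounded_mul_sq_int measurableT mz (fun w _ => zC w) (inc_sq_int a0 ab)).
have Fzinc a b c : 0 <= a -> a <= b -> v <= c -> b <= c ->
    Fm c (fun w => z w * inc a b w).
  move=> a0 ab vc bc; apply: FmM; first exact: Fm_mono vc Fz.
  exact: Fm_increment.
have -> : inner P setT (fun w => xi w * inc r r' w) (fun w => eta w * inc v v' w) =
    inner P setT (fun w => z w * inc r r' w) (inc v v').
  by apply: eq_Rintegral => w _; rewrite /z; ring.
rewrite /overlap (max_idPr rv).
have [r'v|vr'] := leP r' v.
  rewrite (min_idPl (le_trans r'v vv')) (max_idPl _) ?subr_le0// mulr0.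
  by apply: inner_inc => //; [exact: Fzinc|exact: zinc].
set m := Num.min r' v'.
have vm : v <= m by rewrite le_min (ltW vr') vv'.
have mr' : m <= r' by rewrite ge_min lexx.
have mv' : m <= v' by rewrite ge_min lexx orbT.
have m0 : 0 <= m := le_trans v0 vm.
rewrite (max_idPr _) ?subr_ge0//.
have -> : inner P setT (fun w => z w * inc r r' w) (inc v v') =
  inner P setT (fun w => z w * inc r v w + z w * inc v m w + z w * inc m r' w)
    (inc v v').
  by apply: eq_Rintegral => w _; rewrite /increment; ring.
rewrite innerDl//; last 3 first.
- by apply: sq_intD => //; exact: zinc.
- exact: zinc.
- exact: inc_sq_int.
rewrite innerDl//; last 3 first.
- exact: zinc.
- exact: zinc.
- exact: inc_sq_int.
rewrite inner_inc//; last 2 first.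
- exact: Fzinc.
- exact: zinc.
have vE (f : Omega -> R) : inner P setT f (inc v v') =
    inner P setT f (fun w => inc v m w + inc m v' w).
  by apply: eq_Rintegral => w _; rewrite /increment; ring.
rewrite vE innerDr//; [|exact: inc_sq_int|exact: inc_sq_int|exact: zinc].
rewrite (integral_mul_inc_sqr _ _ _ zC)// inner_inc//; [|exact: Fzinc|exact: zinc].
rewrite vE innerDr//; [|exact: inc_sq_int|exact: inc_sq_int|exact: zinc].
have -> : inner P setT (fun w => z w * inc m r' w) (inc v m) =
    inner P setT (fun w => z w * inc v m w) (inc m r').
  by apply: eq_Rintegral => w _; ring.
rewrite inner_inc//; [|exact: Fzinc|exact: zinc].
have -> : inner P setT (fun w => z w * inc m r' w) (inc m v') = 0.
  by apply: zero => w; rewrite /m /increment; case: (leP r' v') => _; ring.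
by rewrite !(add0r, addr0) mulrC.
Qed.

Lemma overlapC r r' v v' : overlap r r' v v' = overlap v v' r r'.
Proof. by rewrite /overlap minC (maxC r). Qed.

Lemma inner_inc_inc r r' v v' xi eta C : 0 <= r -> r <= r' -> 0 <= v ->
  v <= v' -> measurable_fun setT xi -> measurable_fun setT eta ->
  (r < r' -> Fm r xi) -> (v < v' -> Fm v eta) ->
  (forall w, `|xi w| <= C) -> (forall w, `|eta w| <= C) ->
  inner P setT (fun w => xi w * inc r r' w) (fun w => eta w * inc v v' w) =
  E (fun w => xi w * eta w) * overlap r r' v v'.
Proof.
move=> r0 rr' v0 vv' mxi meta Fxi Feta xiC etaC.
have [rv|vr] := leP r v; first exact: (inner_inc_inc_le (C := C)).
rewrite innerC (@inner_inc_inc_le v v' r r' eta xi C)// ?(ltW vr)//.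
by rewrite overlapC; congr (_ * _); apply: eq_Rintegral => w _; rewrite mulrC.
Qed.

End brownian_increments.

(** * Integration over time and outcome *)

Section cylinder.
Context (R : realType) (d : measure_display) (Omega : measurableType d)
  (P : probability Omega R).
Local Notation mu := (@lebesgue_measure R).
Local Notation TO := (measurableTypeR R * Omega)%type.
Local Notation m := (mu \x P)%E.

(** Cylinders over a set of times, on which processes become functions of the
    single variable (time, outcome). *)
Definition cyl (J : set R) : set TO := J `*` setT.

Lemma measurable_cyl (J : set (measurableTypeR R)) : measurable J -> measurable (cyl J).
Proof. by move=> mJ; exact: measurableX. Qed.

Lemma cyl_measure (J : set (measurableTypeR R)) : measurable J -> m (cyl J) = mu J.
Proof.
move=> mJ; rewrite /cyl product_measure1E//.
by rewrite -[RHS]mule1; congr (_ * _)%E; exact: probability_setT.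
Qed.

Lemma patch_cyl (J : set R) (f : TO -> \bar R) s w :
  (f \_ (cyl J)) (s, w) = ((fun s => f (s, w)) \_ J) s.
Proof.
rewrite !patchE; suff -> : ((s, w) \in cyl J) = (s \in J) by [].
by apply/idP/idP; rewrite !inE; [case|split].
Qed.

Lemma measurable_cylP (J : set (measurableTypeR R)) (f : TO -> \bar R) :
  measurable J -> measurable_fun (cyl J) f -> measurable_fun setT (f \_ (cyl J)).
Proof.
by move=> mJ mf; apply/(measurable_restrictT _ _).1 => //; exact: measurable_cyl.
Qed.

Lemma tonelli_cyl (J : set (measurableTypeR R)) (f : TO -> \bar R) :
  measurable J -> measurable_fun (cyl J) f -> (forall z, (0 <= f z)%E) ->
  (\int[m]_(z in cyl J) f z = \int[mu]_(s in J) \int[P]_w f (s, w))%E.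
Proof.
move=> mJ mf f0; rewrite integral_mkcond fubini_tonelli1//; last 2 first.
- exact: measurable_cylP.
- by move=> z; rewrite patchE; case: ifP.
rewrite [RHS]integral_mkcond; apply: eq_integral => s _.
rewrite /fubini_F; under eq_integral do rewrite patch_cyl.
rewrite [RHS]patchE; case: ifPn => sJ.
  by apply: eq_integral => w _; rewrite patchE sJ.
by under eq_integral do rewrite patchE (negbTE sJ); rewrite integral0.
Qed.

Lemma tonelli_cyl' (J : set (measurableTypeR R)) (f : TO -> \bar R) :
  measurable J -> measurable_fun (cyl J) f -> (forall z, (0 <= f z)%E) ->
  (\int[m]_(z in cyl J) f z = \int[P]_w \int[mu]_(s in J) f (s, w))%E.
Proof.
move=> mJ mf f0; rewrite integral_mkcond fubini_tonelli2//; last 2 first.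
- exact: measurable_cylP.
- by move=> z; rewrite patchE; case: ifP.
apply: eq_integral => w _; rewrite [RHS]integral_mkcond /fubini_G.
by apply: eq_integral => s _; rewrite patch_cyl.
Qed.

Lemma fubini_cyl (J : set (measurableTypeR R)) (f : TO -> \bar R) :
  measurable J -> m.-integrable (cyl J) f ->
  (\int[m]_(z in cyl J) f z = \int[mu]_(s in J) \int[P]_w f (s, w))%E.
Proof.
move=> mJ intf; rewrite integral_mkcond -integral12_prod_meas1; last first.
  by apply/(integrable_mkcond _ _).1 => //; exact: measurable_cyl.
rewrite [RHS]integral_mkcond; apply: eq_integral => s _.
rewrite /fubini_F; under eq_integral do rewrite patch_cyl.
rewrite [RHS]patchE; case: ifPn => sJ.
  by apply: eq_integral => w _; rewrite patchE sJ.
by under eq_integral do rewrite patchE (negbTE sJ); rewrite integral0.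
Qed.

Lemma fubini_cyl' (J : set (measurableTypeR R)) (f : TO -> \bar R) :
  measurable J -> m.-integrable (cyl J) f ->
  (\int[m]_(z in cyl J) f z = \int[P]_w \int[mu]_(s in J) f (s, w))%E.
Proof.
move=> mJ intf; rewrite integral_mkcond -integral21_prod_meas1; last first.
  by apply/(integrable_mkcond _ _).1 => //; exact: measurable_cyl.
apply: eq_integral => w _; rewrite [RHS]integral_mkcond /fubini_G.
by apply: eq_integral => s _; rewrite patch_cyl.
Qed.

Lemma measurable_slice (J : set (measurableTypeR R)) (f : TO -> \bar R) s :
  measurable J -> J s -> measurable_fun (cyl J) f ->
  measurable_fun setT (fun w => f (s, w)).
Proof.
move=> mJ Js mf; have := measurable_cylP mJ mf.
move=> h.
have h2 : measurable_fun setT ((f \_ (cyl J)) \o (fun w : Omega => (s, w))).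
  exact: measurableT_comp h (pair1_measurable s).
by apply: eq_measurable_fun h2 => w _ /=; rewrite patchE mem_set.
Qed.

Lemma measurable_slice' (J : set (measurableTypeR R)) (f : TO -> \bar R) w :
  measurable J -> measurable_fun (cyl J) f ->
  measurable_fun J (fun s => f (s, w)).
Proof.
move=> mJ mf; have := measurable_cylP mJ mf => h.
have h2 : measurable_fun setT ((f \_ (cyl J)) \o (fun s : measurableTypeR R => (s, w))).
  exact: measurableT_comp h (pair2_measurable w).
apply/(measurable_restrictT _ _) => //.
apply: eq_measurable_fun h2 => s _ /=.
exact: patch_cyl.
Qed.

Definition lift (f : R -> Omega -> R) (z : TO) : R := f z.1 z.2.

Lemma sq_int_lift T (X : R -> Omega -> R) W :
  L2_process P W T X -> sq_int m (cyl `[0, T]) (lift X).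
Proof.
move=> [[mX _] X2]; split => //.
rewrite tonelli_cyl'//.
  apply/measurable_EFinP/measurable_funX; exact: mX.
by move=> z; rewrite lee_fin sqr_ge0.
Qed.

End cylinder.

(** * Integrals of simple processes *)

Section ito_calculus.
Context (R : realType) (d : measure_display) (Omega : measurableType d)
  (P : probability Omega R) (W : R -> Omega -> R)
  (hW : brownian_motion P W).
Local Notation Fm := (filtration_measurable P W).
Local Notation inc := (increment W).
Local Notation E f := (Rintegral P setT f).
Local Notation mu := (@lebesgue_measure R).
Local Notation m := (mu \x P)%E.
Local Notation TO := (measurableTypeR R * Omega)%type.

(** Nearest point of [[t, t']]: the increment over [[t, t']] of the integral of a
    step process is again a sum over its steps, with clamped times. *)
Definition clamp (t t' x : R) : R := Num.min (Num.max x t) t'.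

Lemma clamp_mono t t' x y : x <= y -> clamp t t' x <= clamp t t' y.
Proof. by move=> xy; rewrite /clamp le_min2 ?le_max2. Qed.

Lemma clamp_ge t t' x : t <= t' -> t <= clamp t t' x.
Proof. by move=> tt'; rewrite /clamp le_min tt' le_max lexx orbT. Qed.

Lemma clamp_ltW t t' a b : t <= t' -> a <= b -> clamp t t' a < clamp t t' b ->
  a <= clamp t t' a.
Proof.
move=> tt' ab; rewrite /clamp le_min le_max lexx/= => h.
rewrite leNgt; apply/negP => t'a; move: h.
rewrite (min_idPr _) ?le_max ?(ltW t'a)//.
by rewrite (min_idPr _) ?ltxx// le_max (le_trans (ltW t'a)).
Qed.

Lemma clamp_overlap t t' a b a' b' :
  mu (`]t, t'] `&` (`]a, b] `&` `]a', b'])) =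
  (overlap (clamp t t' a) (clamp t t' b) (clamp t t' a') (clamp t t' b'))%:E.
Proof.
have -> : `]t, t'] `&` (`]a, b] `&` `]a', b']) =
    `]Num.max (clamp t t' a) (clamp t t' a'),
      Num.min (clamp t t' b) (clamp t t' b')]%classic.
  apply/seteqP; split => x /=; rewrite !in_itv/=; rewrite /clamp.
    move=> [/andP[tx xt'] [/andP[ax xb] /andP[a'x xb']]].
    by rewrite gt_max !gt_min !gt_max !le_min !le_max ax a'x tx xb xb' xt'.
  rewrite gt_max !gt_min !gt_max !le_min !le_max.
  move=> /andP[/andP[h1 h2] /andP[/andP[h3 h4] /andP[h5 _]]].
  move: h1 h2 h3 h5; rewrite h4 !(ltNge t') h4/= !orbF.
  by move=> /andP[-> tx] /andP[-> _]; rewrite (leNgt x t) tx/= !orbF => -> ->.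
rewrite lebesgue_measure_itv/= lte_fin /overlap.
set x := Num.max _ _; set y := Num.min _ _.
case: (ltP x y) => xy; congr EFin; symmetry.
  by apply/max_idPr; rewrite subr_ge0 ltW.
by apply/max_idPl; rewrite subr_le0.
Qed.

Section one_step.
Variables (T : R) (S : step_process R Omega).
Hypothesis sS : simple P W T S.

Lemma step_time_mono i j : (i <= j)%N -> (j <= step_size S)%N ->
  step_time S i <= step_time S j.
Proof.
case: sS => _ h _ _; elim: j => [|j ih]; first by rewrite leqn0 => /eqP ->.
rewrite leq_eqVlt => /predU1P[->//|]; rewrite ltnS => ij jn.
exact: le_trans (ih ij (ltnW jn)) (h _ jn).
Qed.

Lemma step_time_ge0 i : (i <= step_size S)%N -> 0 <= step_time S i.
Proof. by case: (sS) => -[<- _] _ _ _ => ?; exact: step_time_mono. Qed.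

Lemma step_value_Fm (i : 'I_(step_size S)) :
  Fm (step_time S i) (step_value S i).
Proof. by case: sS => _ _ + _; apply. Qed.

Lemma step_value_measurable (i : 'I_(step_size S)) :
  measurable_fun setT (step_value S i).
Proof. exact: (Fm_measurable hW (@step_value_Fm i)). Qed.

Lemma step_incE t t' w : t <= t' ->
  step_integral W S t' w - step_integral W S t w =
  \sum_(i < step_size S) step_value S i w *
    inc (clamp t t' (step_time S i)) (clamp t t' (step_time S i.+1)) w.
Proof.
move=> tt'; rewrite /step_integral -sumrB; apply: eq_bigr => i _.
rewrite -mulrBr; congr (_ * _); rewrite /increment.
have h x : W (Num.min x t') w - W (Num.min x t) w = W (clamp t t' x) w - W t w.
  rewrite /clamp; have [xt|tx] := leP x t; last by [].
  by rewrite (min_idPl (le_trans xt tt')) (min_idPl tt') !subrr.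
rewrite [LHS](_ : _ = (W (Num.min (step_time S i.+1) t') w - W (Num.min (step_time S i.+1) t) w) -
  (W (Num.min (step_time S i) t') w - W (Num.min (step_time S i) t) w)); last by ring.
by rewrite !h; ring.
Qed.

Lemma step_term_sq_int (i : 'I_(step_size S)) a b : 0 <= a -> a <= b ->
  sq_int P setT (fun w => step_value S i w * inc a b w).
Proof.
move=> a0 ab; case: (sS) => _ _ _ [C hC].
apply: (@bounded_mul_sq_int _ _ _ P setT measurableT _ _ C).
- exact: step_value_measurable.
- by move=> w _; exact: hC.
- exact: (inc_sq_int hW).
Qed.

Lemma step_integral_sq_int t : 0 <= t -> sq_int P setT (step_integral W S t).
Proof.
move=> t0; rewrite /step_integral; apply: sq_int_sum => // i.
apply: step_term_sq_int.
  by rewrite le_min t0 step_time_ge0// ltnW.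
by rewrite le_min2// step_time_mono.
Qed.

(** Each clamped step lies in the future of time [t], and of its own value. *)
Lemma step_inc_orth t t' eta : 0 <= t -> t <= t' -> Fm t eta ->
  sq_int P setT eta ->
  inner P setT eta (fun w => step_integral W S t' w - step_integral W S t w) = 0.
Proof.
move=> t0 tt' Fe e2.
under [X in inner _ _ _ X]eq_fun do rewrite (step_incE _ tt').
case: (sS) => _ _ _ [C hC].
set r := clamp t t'.
have r0 i : 0 <= r (step_time S i) by exact: le_trans t0 (clamp_ge _ _).
have rr (i : 'I_(step_size S)) : r (step_time S i) <= r (step_time S i.+1).
  by apply: clamp_mono; exact: step_time_mono.
rewrite inner_sumr//; last by move=> i; exact: step_term_sq_int.
apply: big1 => i _.
have mi := step_value_measurable i.
have eC : sq_int P setT (fun w => step_value S i w * eta w).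
  by apply: (@bounded_mul_sq_int _ _ _ P setT measurableT _ _ C) => // w _; exact: hC.
have [ri|ri] := eqVneq (r (step_time S i)) (r (step_time S i.+1)).
  rewrite -ri /inner; under eq_Rintegral do rewrite /increment subrr !mulr0.
  by rewrite /Rintegral integral0.
rewrite (_ : inner _ _ _ _ = inner P setT (fun w => step_value S i w * eta w)
    (inc (r (step_time S i)) (r (step_time S i.+1)))); last first.
  by apply: eq_Rintegral => w _; ring.
apply: (inner_inc hW) => //; apply: FmM.
  apply: Fm_mono (@step_value_Fm i); apply: (clamp_ltW tt' (b := step_time S i.+1)).
    exact: step_time_mono.
  by rewrite lt_neqAle ri rr.
by apply: Fm_mono Fe; exact: clamp_ge.
Qed.

Lemma step_fun_term_sq_int (i : 'I_(step_size S)) (J : set (measurableTypeR R)) :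
  measurable J -> (mu J < +oo)%E ->
  sq_int m (cyl J)
    (fun z : TO => step_value S i z.2 *
       \1_(`]step_time S i, step_time S i.+1]) z.1).
Proof.
move=> mJ Joo; case: (sS) => _ _ _ [C hC].
apply: (@bounded_sq_int _ _ _ m (cyl J) (measurable_cyl mJ) _ C).
- by move: Joo; rewrite -(cyl_measure P mJ).
- apply: measurable_funTS; apply: measurable_funM.
    exact: measurableT_comp (step_value_measurable i) measurable_snd.
  have h : measurable_fun setT
      (\1_(`]step_time S i, step_time S i.+1]) : measurableTypeR R -> R).
    by apply: measurable_indic; exact: measurable_itv.
  exact: measurableT_comp h measurable_fst.
- move=> z _; rewrite normrM indicE.
  case: (_ \in _); rewrite ?normr1 ?normr0 ?mulr1 ?mulr0 ?hC//.
  by rewrite (le_trans (normr_ge0 _) (hC i z.2 _)).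
Qed.

Lemma step_fun_sq_int (J : set (measurableTypeR R)) :
  measurable J -> (mu J < +oo)%E -> sq_int m (cyl J) (lift (step_fun S)).
Proof.
move=> mJ Joo; apply: sq_int_sum; first exact: measurable_cyl.
by move=> i; exact: step_fun_term_sq_int.
Qed.

End one_step.

(** Expanding both sums reduces the identity to single increments, where the
    overlap of two clamped steps is the measure of the times at which both
    steps are active. The two partitions need not be related. *)
Lemma step_isometry T (S S' : step_process R Omega) t t' :
  simple P W T S -> simple P W T S' -> 0 <= t -> t <= t' ->
  inner P setT (fun w => step_integral W S t' w - step_integral W S t w)
    (fun w => step_integral W S' t' w - step_integral W S' t w) =
  inner m (cyl `]t, t']) (lift (step_fun S)) (lift (step_fun S')).
Proof.
move=> sS sS' t0 tt'.
under [X in inner _ _ X _]eq_fun do rewrite (step_incE _ _ tt').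
under [X in inner _ _ _ X]eq_fun do rewrite (step_incE _ _ tt').
case: (sS) => _ _ _ [C hC]; case: (sS') => _ _ _ [C' hC'].
pose B := Num.max C C'.
have hB i w : (i < step_size S)%N -> `|step_value S i w| <= B.
  by move=> /hC h; rewrite (le_trans (h w))// le_max lexx.
have hB' i w : (i < step_size S')%N -> `|step_value S' i w| <= B.
  by move=> /hC' h; rewrite (le_trans (h w))// le_max lexx orbT.
set r := clamp t t'.
have r0 x : 0 <= r x by exact: le_trans t0 (clamp_ge _ _).
have rr (i : 'I_(step_size S)) : r (step_time S i) <= r (step_time S i.+1).
  by apply: clamp_mono; exact: (step_time_mono sS).
have rr' (i : 'I_(step_size S')) : r (step_time S' i) <= r (step_time S' i.+1).
  by apply: clamp_mono; exact: (step_time_mono sS').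
have mJ : measurable (`]t, t'] : set (measurableTypeR R)) by exact: measurable_itv.
have Joo : (mu `]t, t'] < +oo)%E.
  by rewrite lebesgue_measure_itv/=; case: ifP => _; rewrite ?ltry// -EFinD ltry.
have mcyl := @measurable_cyl _ _ Omega _ mJ.
transitivity (\sum_(i < step_size S) \sum_(j < step_size S')
  E (fun w => step_value S i w * step_value S' j w) *
  overlap (r (step_time S i)) (r (step_time S i.+1))
    (r (step_time S' j)) (r (step_time S' j.+1))).
  rewrite inner_suml//; last 2 first.
  - by move=> i; exact: (step_term_sq_int sS).
  - by apply: sq_int_sum => // j; exact: (step_term_sq_int sS').
  apply: eq_bigr => i _; rewrite inner_sumr//; last 2 first.
  - by move=> j; exact: (step_term_sq_int sS').
  - exact: (step_term_sq_int sS).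
  apply: eq_bigr => j _.
  apply: (inner_inc_inc hW (C := B)) => //.
  - exact: (step_value_measurable sS).
  - exact: (step_value_measurable sS').
  - move=> h; apply: Fm_mono (step_value_Fm sS (i:=i)).
    by apply: clamp_ltW h => //; exact: (step_time_mono sS).
  - move=> h; apply: Fm_mono (step_value_Fm sS' (i:=j)).
    by apply: clamp_ltW h => //; exact: (step_time_mono sS').
  - by move=> w; exact: hB.
  - by move=> w; exact: hB'.
symmetry.
rewrite /lift /step_fun inner_suml//; last 2 first.
- by move=> i; exact: (step_fun_term_sq_int sS).
- by apply: sq_int_sum => // j; exact: (step_fun_term_sq_int sS').
apply: eq_bigr => i _; rewrite inner_sumr//; last 2 first.
- by move=> j; exact: (step_fun_term_sq_int sS').
- exact: (step_fun_term_sq_int sS).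
apply: eq_bigr => j _.
have ti := step_fun_term_sq_int sS i mJ Joo.
have tj := step_fun_term_sq_int sS' j mJ Joo.
have imul := sq_intM_integrable mcyl ti tj.
have i2 : sq_int P setT (step_value S i).
  apply: (@bounded_sq_int _ _ _ P setT _ _ B) => //; first exact: prob_fin.
    exact: (step_value_measurable sS).
  by move=> w _; exact: hB.
have j2 : sq_int P setT (step_value S' j).
  apply: (@bounded_sq_int _ _ _ P setT _ _ B) => //; first exact: prob_fin.
    exact: (step_value_measurable sS').
  by move=> w _; exact: hB'.
have ij := sq_intM_integrable measurableT i2 j2.
rewrite /inner /Rintegral fubini_cyl//.
set I := `]step_time S i, step_time S i.+1].
set I' := `]step_time S' j, step_time S' j.+1].
have eint s : (\int[P]_w (step_value S i w * \1_[set` I] s *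
    (step_value S' j w * \1_[set` I'] s))%:E =
  (\1_([set` I] `&` [set` I']) s)%:E * (E (fun w => step_value S i w * step_value S' j w))%:E)%E.
  rewrite /Rintegral fineK ?integrable_fin_num//.
  rewrite -integralZl//; apply: eq_integral => w _.
  by rewrite -EFinM indicI/=; congr EFin; ring.
rewrite (@eq_integral _ _ _ mu _ (fun s => (\1_([set` I] `&` [set` I']) s)%:E * (E (fun w => step_value S i w * step_value S' j w))%:E)%E); last first.
  by move=> s _; exact: eint.
have mII : measurable ([set` I] `&` [set` I'] : set (measurableTypeR R)).
  by apply: measurableI; exact: measurable_itv.
rewrite integralZr//; last first.
  apply: (@sq_int_finite_integrable _ _ _ mu _ mJ (\1_([set` I] `&` [set` I'])) Joo).
  apply: (@bounded_sq_int _ _ _ mu _ mJ _ 1 Joo).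
    by apply: measurable_funTS; exact: measurable_indic.
  by move=> x _; rewrite indicE; case: (_ \in _); rewrite ?normr1 ?normr0 ?ler01.
rewrite integral_indic//.
transitivity (fine ((overlap (r (step_time S i)) (r (step_time S i.+1))
    (r (step_time S' j)) (r (step_time S' j.+1)))%:E *
  (E (fun w => step_value S i w * step_value S' j w))%:E)%E).
  congr (fine (_ * _)%E); rewrite -clamp_overlap.
  by congr (mu _); exact: setIC.
by rewrite -EFinM/= mulrC.
Qed.

End ito_calculus.

(** * Isometry and martingale property of the Ito integral *)

Section inner_subset.
Context (R : realType) (d : measure_display) (S : measurableType d)
  (nu : {measure set S -> \bar R}).

Lemma sq_int_subset (D D' : set S) (f : S -> R) : measurable D ->
  measurable D' -> D' `<=` D -> sq_int nu D f -> sq_int nu D' f.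
Proof.
move=> mD mD' D'D [mf foo]; split; first exact: measurable_funS mf.
apply: le_lt_trans foo; apply: ge0_subset_integral => //.
  exact/measurable_EFinP/measurable_funX.
by move=> x _; rewrite lee_fin sqr_ge0.
Qed.

Lemma inner_subset_le (D D' : set S) (f : S -> R) : measurable D ->
  measurable D' -> D' `<=` D -> sq_int nu D f ->
  inner nu D' f f <= inner nu D f f.
Proof.
move=> mD mD' D'D f2; rewrite -lee_fin !EFin_inner//; last first.
  exact: sq_int_subset f2.
apply: ge0_subset_integral => //.
  apply/measurable_EFinP/measurable_funX; exact: f2.1.
by move=> x _; rewrite lee_fin sqr_ge0.
Qed.

End inner_subset.

Section ito_integrals.
Context (R : realType) (d : measure_display) (Omega : measurableType d)
  (P : probability Omega R) (W : R -> Omega -> R)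
  (hW : brownian_motion P W) (T : R).
Local Notation Fm := (filtration_measurable P W).
Local Notation mu := (@lebesgue_measure R).
Local Notation m := (mu \x P)%E.

Lemma itv_fin (a b : R) : (mu (`]a, b]%classic) < +oo)%E.
Proof. by rewrite lebesgue_measure_itv/=; case: ifP => _; rewrite ?ltry// -EFinD ltry. Qed.

Lemma itvcc_fin (a b : R) : (mu (`[a, b]%classic) < +oo)%E.
Proof. by rewrite lebesgue_measure_itv/=; case: ifP => _; rewrite ?ltry// -EFinD ltry. Qed.

Lemma cyl_subset t t' : 0 <= t -> t' <= T ->
  cyl `]t, t'] `<=` (cyl `[0, T] : set (_ * Omega)).
Proof.
move=> t0 t'T z [/=]; rewrite !in_itv/= => /andP[tz zt'] _; split => //=.
by rewrite in_itv/= (le_trans t0 (ltW tz)) (le_trans zt').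
Qed.

Lemma ito_integral_sq_int H I t : ito_integral P W T H I -> t \in `[0, T] ->
  sq_int P setT (I t).
Proof.
move=> [_ mI [S [sS _ cS]]] tT.
apply: (@sq_int_cvg _ _ _ P setT measurableT (fun n => step_integral W (S n) t)).
- move=> n; apply: (step_integral_sq_int hW (sS n)).
  by move: tT; rewrite in_itv/= => /andP[].
- exact: mI.
- exact: cS.
Qed.

Lemma ito_integral_inc_sq_int H I t t' : ito_integral P W T H I ->
  t \in `[0, T] -> t' \in `[0, T] -> sq_int P setT (fun w => I t' w - I t w).
Proof.
by move=> hI tT t'T; apply: sq_intB => //; exact: ito_integral_sq_int hI _.
Qed.

(** The increments converge in L2 because the values at both ends do. *)
Lemma step_inc_cvg I (S : nat -> step_process R Omega) t t' :
  (forall n, simple P W T (S n)) ->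
  (forall t, t \in `[0, T] -> sq_int P setT (I t)) ->
  (forall t, t \in `[0, T] ->
     (\int[P]_w ((step_integral W (S n) t w - I t w) ^+ 2)%:E)%E
       @[n --> \oo] --> 0%E) ->
  t \in `[0, T] -> t' \in `[0, T] ->
  let D n w := (step_integral W (S n) t' w - step_integral W (S n) t w) -
    (I t' w - I t w) in
  inner P setT (D n) (D n) @[n --> \oo] --> 0.
Proof.
move=> sS I2 cS tT t'T D.
have ge0 s : s \in `[0, T] -> 0 <= s by rewrite in_itv/= => /andP[].
pose D1 s n w := step_integral W (S n) s w - I s w.
have S2 s n : s \in `[0, T] -> sq_int P setT (step_integral W (S n) s).
  by move=> sT; apply: (step_integral_sq_int hW (sS n)); exact: ge0.
have D12 s n : s \in `[0, T] -> sq_int P setT (D1 s n).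
  by move=> sT; apply: sq_intB => //; [exact: S2|exact: I2].
have c s : s \in `[0, T] -> inner P setT (D1 s n) (D1 s n) @[n --> \oo] --> 0.
  move=> sT; apply: inner_cvg0 => //; [by move=> n; exact: S2|exact: I2|exact: cS].
apply: (@squeeze_cvgr _ _ _ _ (fun=> 0)
  (fun n => 2 * inner P setT (D1 t' n) (D1 t' n) + 2 * inner P setT (D1 t n) (D1 t n))).
- apply: nearW => n; rewrite inner_ge0/=.
  have := inner_sqrD_le measurableT (D12 t' n t'T) (sq_intN measurableT (D12 t n tT)).
  have -> : inner P setT (fun x => - D1 t n x) (fun x => - D1 t n x) =
      inner P setT (D1 t n) (D1 t n).
    by apply: eq_Rintegral => w _; rewrite mulrNN.
  apply: le_trans; rewrite le_eqVlt; apply/orP; left; apply/eqP.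
  by apply: eq_Rintegral => w _; rewrite /D /D1; ring.
- exact: cvg_cst.
- rewrite [X in _ --> X](_ : 0 = 2 * 0 + 2 * 0); last by rewrite mulr0 addr0.
  by apply: cvgD; apply: cvgMr; exact: c.
Qed.

(** The martingale property: orthogonality to the past passes to the L2-limit of
    the step integrals. *)
Lemma ito_integral_orth H I t t' eta : ito_integral P W T H I ->
  0 <= t -> t <= t' -> t' <= T -> Fm t eta -> sq_int P setT eta ->
  inner P setT eta (fun w => I t' w - I t w) = 0.
Proof.
move=> hI t0 tt' t'T Fe e2.
have tT : t \in `[0, T] by rewrite in_itv/= t0 (le_trans tt').
have t'T' : t' \in `[0, T] by rewrite in_itv/= t'T (le_trans t0).
have I2 s : s \in `[0, T] -> sq_int P setT (I s).
  by move=> sT; exact: ito_integral_sq_int hI _.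
case: (hI) => _ _ [S [sS _ cS]].
have := @inner_cvg _ _ _ P setT measurableT (fun=> eta)
  (fun n w => step_integral W (S n) t' w - step_integral W (S n) t w)
  eta (fun w => I t' w - I t w).
have S2 s n : s \in `[0, T] -> sq_int P setT (step_integral W (S n) s).
  move=> sT; apply: (step_integral_sq_int hW (sS n)).
  by move: sT; rewrite in_itv/= => /andP[].
move=> /(_ (fun=> e2) _ e2).
have c0 : inner P setT (fun x => eta x - eta x) (fun x => eta x - eta x) @[_ --> \oo] --> 0.
  rewrite (_ : inner _ _ _ _ = 0); first exact: cvg_cst.
  by rewrite /inner; under eq_Rintegral do rewrite subrr mul0r; rewrite /Rintegral integral0.
move=> /(_ _ _ c0 (step_inc_cvg sS I2 cS tT t'T')) h.
have {}h : inner P setT eta (fun w => step_integral W (S n) t' w - step_integral W (S n) t w)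
    @[n --> \oo] --> inner P setT eta (fun w => I t' w - I t w).
  apply: h; last by apply: sq_intB => //; exact: I2.
  by move=> n; apply: sq_intB => //; exact: S2.
apply: (cvg_unique _ h) => //.
rewrite [X in X @ \oo](_ : _ = fun=> 0); first exact: cvg_cst.
by apply/funext => n; exact: (step_inc_orth hW (sS n)).
Qed.

(** Both sides are continuous for the L2 convergence of the approximating step
    processes, for which the identity is known. *)
Lemma ito_isometry H I H' I' t t' : ito_integral P W T H I ->
  ito_integral P W T H' I' -> 0 <= t -> t <= t' -> t' <= T ->
  inner P setT (fun w => I t' w - I t w) (fun w => I' t' w - I' t w) =
  inner m (cyl `]t, t']) (lift H) (lift H').
Proof.
move=> hI hI' t0 tt' t'T.
have tT : t \in `[0, T] by rewrite in_itv/= t0 (le_trans tt').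
have t'T' : t' \in `[0, T] by rewrite in_itv/= t'T (le_trans t0).
have I2 s : s \in `[0, T] -> sq_int P setT (I s).
  by move=> sT; exact: ito_integral_sq_int hI _.
have I'2 s : s \in `[0, T] -> sq_int P setT (I' s).
  by move=> sT; exact: ito_integral_sq_int hI' _.
case: (hI) => LH _ [S [sS nS cS]]; case: (hI') => LH' _ [S' [sS' nS' cS']].
have S2 (Q : nat -> step_process R Omega) s n : (forall n, simple P W T (Q n)) ->
    s \in `[0, T] -> sq_int P setT (step_integral W (Q n) s).
  move=> sQ sT; apply: (step_integral_sq_int hW (sQ n)).
  by move: sT; rewrite in_itv/= => /andP[].
have c1 := @inner_cvg _ _ _ P setT measurableT
  (fun n w => step_integral W (S n) t' w - step_integral W (S n) t w)
  (fun n w => step_integral W (S' n) t' w - step_integral W (S' n) t w)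
  (fun w => I t' w - I t w) (fun w => I' t' w - I' t w)
  (fun n => sq_intB measurableT (S2 _ _ n sS t'T') (S2 _ _ n sS tT))
  (fun n => sq_intB measurableT (S2 _ _ n sS' t'T') (S2 _ _ n sS' tT))
  (sq_intB measurableT (I2 _ t'T') (I2 _ tT))
  (sq_intB measurableT (I'2 _ t'T') (I'2 _ tT))
  (step_inc_cvg sS I2 cS tT t'T') (step_inc_cvg sS' I'2 cS' tT t'T').
have mJ : measurable (`]t, t'] : set (measurableTypeR R)) by exact: measurable_itv.
have mT : measurable (`[0, T] : set (measurableTypeR R)) by exact: measurable_itv.
have mcJ := @measurable_cyl _ _ Omega _ mJ.
have mcT := @measurable_cyl _ _ Omega _ mT.
have sub := cyl_subset t0 t'T.
have aux K (Q : nat -> step_process R Omega) : L2_process P W T K ->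
    (forall n, simple P W T (Q n)) ->
    sqnorm P T (fun t w => step_fun (Q n) t w - K t w) @[n --> \oo] --> 0%E ->
    inner m (cyl `]t, t']) (fun z => lift (step_fun (Q n)) z - lift K z)
     (fun z => lift (step_fun (Q n)) z - lift K z) @[n --> \oo] --> 0.
  move=> LK sQ nQ.
  have K2 := sq_int_lift LK.
  have Q2 n : sq_int m (cyl `[0, T]) (lift (step_fun (Q n))).
    by apply: (step_fun_sq_int hW (sQ n)) => //; exact: itvcc_fin.
  have c : inner m (cyl `[0, T]) (fun z => lift (step_fun (Q n)) z - lift K z)
     (fun z => lift (step_fun (Q n)) z - lift K z) @[n --> \oo] --> 0.
    apply: inner_cvg0 => //.
    apply: cvg_trans nQ; apply: near_eq_cvg; apply: nearW => n.
    rewrite /sqnorm tonelli_cyl'//.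
    - apply/measurable_EFinP/measurable_funX/measurable_funB; [exact: (Q2 n).1|exact: K2.1].
    - by move=> z; rewrite lee_fin sqr_ge0.
  apply: (squeeze_cvgr _ (@cvg_cst _ _ _ _ _) c).
  apply: nearW => n; rewrite inner_ge0/=.
  by apply: inner_subset_le => //; exact: sq_intB.
have H2 := sq_int_subset mcT mcJ sub (sq_int_lift LH).
have H'2 := sq_int_subset mcT mcJ sub (sq_int_lift LH').
have c2 := @inner_cvg _ _ _ m (cyl `]t, t']) mcJ
  (fun n => lift (step_fun (S n))) (fun n => lift (step_fun (S' n)))
  (lift H) (lift H')
  (fun n => step_fun_sq_int hW (sS n) mJ (itv_fin _ _))
  (fun n => step_fun_sq_int hW (sS' n) mJ (itv_fin _ _)) H2 H'2
  (aux _ _ LH sS nS) (aux _ _ LH' sS' nS').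
apply: (cvg_unique _ c1) => //.
apply: cvg_trans c2; apply: near_eq_cvg; apply: nearW => n.
by rewrite -(step_isometry hW (sS n) (sS' n) t0 tt').
Qed.

Lemma ito_integral_inc_norm H I t t' : ito_integral P W T H I ->
  0 <= t -> t <= t' -> t' <= T ->
  inner P setT (fun w => I t' w - I t w) (fun w => I t' w - I t w) =
  inner m (cyl `]t, t']) (lift H) (lift H).
Proof. by move=> hI; exact: ito_isometry. Qed.

End ito_integrals.

(** * The product rule in expectation *)

Section small_increments.
Context (R : realType).

(** With steps of length at most [th ^+ 2] the right-hand sides telescope to
    [C * th * (g T - g 0)], and [th] is arbitrary. *)
Lemma small_increments_const (psi g : R -> R) (T C : R) : 0 <= T -> 0 <= C ->
  (forall th t t', 0 < th -> th <= 1 -> 0 <= t -> t <= t' -> t' <= T ->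
     t' - t <= th ^+ 2 -> `|psi t' - psi t| <= C * th * (g t' - g t)) ->
  psi T = psi 0.
Proof.
move=> T0 C0 h.
have key th : 0 < th -> th <= 1 -> `|psi T - psi 0| <= C * th * (g T - g 0).
  move=> th0 th1.
  have [n hn] : exists n : nat, T / n.+1%:R <= th ^+ 2.
    exists (Num.truncn (T / th ^+ 2)); rewrite ler_pdivrMr//.
    rewrite mulrC -ler_pdivrMr ?exprn_gt0//.
    exact/ltW/truncnS_gt.
  pose s (i : nat) := T / n.+1%:R * i%:R.
  have s0 : s 0%N = 0 by rewrite /s mulr0.
  have sT : s n.+1 = T by rewrite /s divfK.
  have T0n : 0 <= T / n.+1%:R by rewrite divr_ge0.
  have sS i : s i.+1 - s i = T / n.+1%:R by rewrite /s -mulrBr -natrB// subSnn mulr1.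
  have smono i j : (i <= j)%N -> s i <= s j by move=> ij; rewrite ler_wpM2l// ler_nat.
  rewrite -[in psi 0]s0 -[in g 0]s0 -{1 2}sT.
  rewrite -(telescope_sumr (fun i => psi (s i)))// -(telescope_sumr (fun i => g (s i)))//.
  rewrite mulr_sumr (le_trans (ler_norm_sum _ _ _))//.
  rewrite !big_nat; apply: ler_sum => i /andP[_ iN].
  apply: h => //.
  - by rewrite -s0 smono.
  - by rewrite smono.
  - by rewrite -sT smono.
  - by rewrite sS.
apply/eqP; rewrite -subr_eq0 -normr_le0; apply/ler_addgt0Pl => e e0; rewrite addr0.
pose K := C * `|g T - g 0| + 1.
have K0 : 0 < K by rewrite ltr_wpDl// mulr_ge0.
(* the 1 in [K] keeps it positive *)
pose th := Num.min 1 (e / K).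
have th0 : 0 < th by rewrite lt_min ltr01 divr_gt0.
have th1 : th <= 1 by rewrite ge_min lexx.
have thK : th * K <= e by rewrite -ler_pdivlMr// ge_min lexx orbT.
apply: le_trans (key th th0 th1) _; apply: le_trans thK.
rewrite mulrAC mulrC ler_pM2l//.
apply: (@le_trans _ _ (C * `|g T - g 0|)); last by rewrite lerDl.
by rewrite ler_wpM2l// ler_norm.
Qed.

End small_increments.

Section sq_ito_processes.
Context (R : realType) (d : measure_display) (Omega : measurableType d)
  (P : probability Omega R) (W : R -> Omega -> R)
  (hW : brownian_motion P W) (T : R).
Local Notation Fm := (filtration_measurable P W).
Local Notation mu := (@lebesgue_measure R).
Local Notation m := (mu \x P)%E.
Local Notation E f := (Rintegral P setT f).
Local Notation TO := (measurableTypeR R * Omega)%type.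
Implicit Types (x a c : R -> Omega -> R).

(** Ito processes whose drift is square-integrable over time and outcome, the
    setting in which every term of the product rule is finite. *)
Record sq_ito x a c : Prop := {
  sq_ito_measurable : measurable_fun (cyl `[0, T]) (lift x);
  sq_ito_Fm : forall t, t \in `[0, T] -> Fm t (x t);
  sq_ito_bound : exists M : R, forall t, t \in `[0, T] ->
    (\int[P]_w ((x t w) ^+ 2)%:E <= M%:E)%E;
  sq_ito_drift : sq_int m (cyl `[0, T]) (lift a);
  sq_ito_eq : exists2 I, ito_integral P W T c I &
    forall t, t \in `[0, T] -> {ae P, forall w,
      x t w = x 0 w + \int[mu]_(s in `[0, t]) a s w + I t w}
}.

Let mT : measurable (`[0, T]%classic : set (measurableTypeR R)).
Proof. exact: measurable_itv. Qed.
Let mJ (t t' : R) : measurable (`]t, t']%classic : set (measurableTypeR R)).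
Proof. exact: measurable_itv. Qed.
Let mcT : measurable (cyl `[0, T] : set TO).
Proof. exact: measurable_cyl. Qed.
Let mcJ (t t' : R) : measurable (cyl `]t, t'] : set TO).
Proof. exact: measurable_cyl. Qed.

Lemma cyl_fin (J : set (measurableTypeR R)) : measurable J -> (mu J < +oo)%E ->
  (m (cyl J) < +oo)%E.
Proof. by move=> mJ' Joo; move: Joo; rewrite -(cyl_measure P mJ'). Qed.

Lemma sq_ito_sq_int x a c t : sq_ito x a c -> t \in `[0, T] ->
  sq_int P setT (x t).
Proof.
move=> h tT; split; first exact: (Fm_measurable hW (sq_ito_Fm h tT)).
have [M hM] := sq_ito_bound h.
by apply: le_lt_trans (hM _ tT) _; rewrite ltry.
Qed.

Lemma bounded_sq_int_lift x (M : R) : measurable_fun (cyl `[0, T]) (lift x) ->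
  (forall t, t \in `[0, T] -> (\int[P]_w ((x t w) ^+ 2)%:E <= M%:E)%E) ->
  sq_int m (cyl `[0, T]) (lift x).
Proof.
move=> mx hM; split => //.
have mx2 : measurable_fun (cyl `[0, T]) (fun z => (lift x z ^+ 2)%:E).
  exact/measurable_EFinP/measurable_funX.
have hf z : (0 <= (lift x z ^+ 2)%:E)%E by rewrite lee_fin sqr_ge0.
rewrite tonelli_cyl//.
apply: (@le_lt_trans _ _ (\int[mu]_(s in `[0%R, T]) (`|M|%R)%:E)%E); last first.
  by rewrite integral_cst//= lte_mul_pinfty ?lee_fin// itvcc_fin.
apply: ge0_le_integral => //.
- by move=> s _; apply: integral_ge0 => w _; exact: hf.
- have := measurable_cylP mT mx2 => h.
  have := @measurable_fun_fubini_tonelli_F _ _ _ _ _ P _ h.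
  have h0 z : (0 <= ((fun z => (lift x z ^+ 2)%:E) \_ (cyl `[0%R, T])) z)%E.
    by rewrite patchE; case: ifP.
  move=> /(_ h0) h1.
  apply: (eq_measurable_fun (fubini_F P ((fun z => (lift x z ^+ 2)%:E) \_ (cyl `[0, T])))); last exact: measurable_funTS.
  move=> s sT; apply: eq_integral => w _.
  by rewrite patch_cyl patchE sT.
- move=> s sT; apply: le_trans (hM s _) _; first by [].
  by rewrite lee_fin ler_norm.
Qed.

Lemma sq_ito_lift x a c : sq_ito x a c -> sq_int m (cyl `[0, T]) (lift x).
Proof.
move=> h; have [M hM] := sq_ito_bound h.
exact: bounded_sq_int_lift (sq_ito_measurable h) hM.
Qed.

Lemma sq_int_J t t' (f : TO -> R) : 0 <= t -> t' <= T ->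
  sq_int m (cyl `[0, T]) f -> sq_int m (cyl `]t, t']) f.
Proof. by move=> t0 t'T; apply: sq_int_subset => //; exact: cyl_subset. Qed.

(** A random variable seen as a process that is constant in time. *)
Lemma sq_int_snd (J : set (measurableTypeR R)) (eta : Omega -> R) :
  measurable J -> (mu J < +oo)%E -> sq_int P setT eta ->
  sq_int m (cyl J) (fun z => eta z.2) /\
  inner m (cyl J) (fun z => eta z.2) (fun z => eta z.2) =
  fine (mu J) * inner P setT eta eta.
Proof.
move=> mJ' Joo e2.
have me : measurable_fun (cyl J) (fun z : TO => eta z.2).
  apply: measurable_funTS; exact: measurableT_comp e2.1 measurable_snd.
have eq : (\int[m]_(z in cyl J) (eta z.2 ^+ 2)%:E =
   mu J * \int[P]_w (eta w ^+ 2)%:E)%E.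
  rewrite tonelli_cyl//.
  - by rewrite /= integral_cst// muleC.
  - exact/measurable_EFinP/measurable_funX.
  - by move=> z; rewrite lee_fin sqr_ge0.
have se : sq_int m (cyl J) (fun z => eta z.2).
  split => //; rewrite eq -(fineK (_ : mu J \is a fin_num)) ?ge0_fin_numE//.
  rewrite lte_mul_pinfty//; last exact: e2.2.
  by rewrite lee_fin fine_ge0.
split => //; apply: EFin_inj; rewrite EFin_inner//; last exact: measurable_cyl.
by rewrite eq EFinM EFin_inner// fineK// ge0_fin_numE.
Qed.

Lemma ae_slice_integrable (J : set (measurableTypeR R)) (f : TO -> R) :
  measurable J -> intg m (cyl J) f ->
  {ae P, forall w, mu.-integrable J (fun s => (f (s, w))%:E)}.
Proof.
move=> mJ' fi.
have : m.-integrable setT ((EFin \o f) \_ (cyl J)).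
  by apply/(integrable_mkcond _ _).1 => //; exact: measurable_cyl.
move=> /ae_integrable2; apply: filterS => w h.
apply/(integrable_mkcond _ _).2 => //.
by apply: eq_integrable h => // s _; exact: patch_cyl.
Qed.

End sq_ito_processes.

Section ito_increments.
Context (R : realType) (d : measure_display) (Omega : measurableType d)
  (P : probability Omega R) (W : R -> Omega -> R)
  (hW : brownian_motion P W) (T : R).
Local Notation Fm := (filtration_measurable P W).
Local Notation mu := (@lebesgue_measure R).
Local Notation m := (mu \x P)%E.
Local Notation E f := (Rintegral P setT f).
Local Notation TO := (measurableTypeR R * Omega)%type.
Implicit Types (x a c : R -> Omega -> R).

Let mT : measurable (`[0, T]%classic : set (measurableTypeR R)).
Proof. exact: measurable_itv. Qed.
Let mJ (t t' : R) : measurable (`]t, t']%classic : set (measurableTypeR R)).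
Proof. exact: measurable_itv. Qed.
Let mcT : measurable (cyl `[0, T] : set TO).
Proof. exact: measurable_cyl. Qed.
Let mcJ (t t' : R) : measurable (cyl `]t, t'] : set TO).
Proof. exact: measurable_cyl. Qed.

Lemma measurable_fubini_cyl (J : set (measurableTypeR R)) (f : TO -> R) :
  measurable J -> intg m (cyl J) f ->
  measurable_fun setT (fun w => \int[mu]_(s in J) (f (s, w))%:E)%E.
Proof.
move=> mJ' fi.
have : m.-integrable setT ((EFin \o f) \_ (cyl J)).
  by apply/(integrable_mkcond _ _).1 => //; exact: measurable_cyl.
move=> /measurable_fubini_G; apply: eq_measurable_fun => w _.
rewrite [RHS]integral_mkcond /fubini_G.
by apply: eq_integral => s _; exact: patch_cyl.
Qed.

(** Fubini's theorem: pairing a variable with the time integral of a drift is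
    pairing it with the drift over time and outcome. *)
Lemma inner_drift a t t' (eta alpha : Omega -> R) : 0 <= t -> t' <= T ->
  sq_int m (cyl `[0, T]) (lift a) -> sq_int P setT eta ->
  measurable_fun setT alpha ->
  {ae P, forall w, alpha w = \int[mu]_(s in `]t, t']) a s w} ->
  inner P setT eta alpha = inner m (cyl `]t, t']) (fun z => eta z.2) (lift a).
Proof.
move=> t0 t'T a2 e2 ma aE.
have a2J := sq_int_J t0 t'T a2.
have [e2J _] := sq_int_snd (mJ t t') (itv_fin t t') e2.
have ea := sq_intM_integrable (mcJ t t') e2J a2J.
rewrite /inner /Rintegral fubini_cyl'//; congr fine.
apply: ae_eq_integral => //.
- apply/measurable_EFinP/measurable_funM => //; exact: e2.1.
- exact: (measurable_fubini_cyl (f := fun z => eta z.2 * lift a z) (mJ t t') ea).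
have ai := sq_int_finite_integrable (mcJ t t') (cyl_fin P (mJ t t') (itv_fin t t')) a2J.
have := ae_slice_integrable (mJ t t') ai.
apply: filterS2 aE => w -> iw _.
rewrite /lift/=; under [RHS]eq_integral do rewrite EFinM.
rewrite integralZl// EFinM; congr (_ * _)%E.
by rewrite /Rintegral fineK// integrable_fin_num.
Qed.

(** Cauchy-Schwarz in time, obtained from Young's inequality with the length of
    the interval as weight. *)
Lemma drift_norm a t t' (alpha : Omega -> R) : 0 <= t -> t <= t' -> t' <= T ->
  sq_int m (cyl `[0, T]) (lift a) -> sq_int P setT alpha ->
  {ae P, forall w, alpha w = \int[mu]_(s in `]t, t']) a s w} ->
  inner P setT alpha alpha <=
    (t' - t) * inner m (cyl `]t, t']) (lift a) (lift a).
Proof.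
move=> t0 tt' t'T a2 al2 alE.
have a2J := sq_int_J t0 t'T a2.
have [al2J al2E] := sq_int_snd (mJ t t') (itv_fin t t') al2.
have e := inner_drift t0 t'T a2 al2 al2.1 alE.
move: tt'; rewrite le_eqVlt => /predU1P[tt'|tt'].
  move: alE; rewrite -tt' set_itvoc0 => alE.
  rewrite subrr mul0r /inner /Rintegral.
  rewrite (@ae_eq_integral _ _ _ P setT (cst 0%E))//.
  - by rewrite integral0.
  - by apply/measurable_EFinP/measurable_funM; exact: al2.1.
  - by apply: filterS alE => w -> _; rewrite Rintegral_set0 mulr0.
have h0 : 0 < t' - t by rewrite subr_gt0.
have := inner_young (mcJ t t') h0 al2J a2J.
rewrite al2E -e lebesgue_measure_itv/= lte_fin tt' -EFinD/= mulKf ?gt_eqF//.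
have := ler_norm (inner P setT alpha alpha); lra.
Qed.

Section one_process.
Variables (x a c I : R -> Omega -> R).
Hypotheses (hx : sq_ito P W T x a c) (hI : ito_integral P W T c I).
Hypothesis xE : forall t, t \in `[0, T] -> {ae P, forall w,
  x t w = x 0 w + \int[mu]_(s in `[0, t]) a s w + I t w}.

Definition drift_inc t t' w := (x t' w - x t w) - (I t' w - I t w).
(** This controls the squared increments of the process and is additive in the
    interval, as [small_increments_const] requires. *)
Definition energy t t' : R := inner m (cyl `]t, t']) (lift a) (lift a) +
   inner m (cyl `]t, t']) (lift c) (lift c).

Lemma drift_incE t t' : 0 <= t -> t <= t' -> t' <= T ->
  {ae P, forall w, drift_inc t t' w = \int[mu]_(s in `]t, t']) a s w}.
Proof.
move=> t0 tt' t'T.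
have tT : t \in `[0, T] by rewrite in_itv/= t0 (le_trans tt').
have t'T' : t' \in `[0, T] by rewrite in_itv/= t'T (le_trans t0).
have ai := sq_int_finite_integrable mcT (cyl_fin P mT (itvcc_fin 0 T)) (sq_ito_drift hx).
have := ae_slice_integrable mT ai.
apply: filterS3 (xE tT) (xE t'T') => w e e' iw.
rewrite /drift_inc e e'.
have iw' : mu.-integrable `[0, t'] (fun s => (a s w)%:E).
  apply: integrableS iw => //.
  by apply: subset_itvl; rewrite bnd_simp.
rewrite -(@Rintegral_itvB _ (fun s => a s w) (BLeft 0) (BRight t') t)//; first by ring.
Qed.

Lemma drift_inc_sq_int t t' : t \in `[0, T] -> t' \in `[0, T] ->
  sq_int P setT (drift_inc t t').
Proof.
move=> tT t'T; apply: sq_intB => //.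
  by apply: sq_intB => //; exact: (sq_ito_sq_int hW hx).
exact: (ito_integral_inc_sq_int hW hI).
Qed.

Lemma energy_ge0 t t' : 0 <= energy t t'.
Proof. by apply: addr_ge0; exact: inner_ge0. Qed.

Lemma energy_mono t s t' : 0 <= t -> s <= t' -> t' <= T ->
  energy t s <= energy t t'.
Proof.
move=> t0 st' t'T.
have sub : cyl `]t, s] `<=` (cyl `]t, t'] : set TO).
  move=> z [/=]; rewrite !in_itv/= => /andP[tz zs] _; split => //=.
  by rewrite in_itv/= tz (le_trans zs).
have a2 := sq_int_J t0 t'T (sq_ito_drift hx).
have c2 : sq_int m (cyl `]t, t']) (lift c).
  by apply: (sq_int_J t0 t'T); apply: (@sq_int_lift _ _ _ _ _ _ W); case: hI.
rewrite /energy; apply: lerD.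
  exact: (inner_subset_le (mcJ t t') (mcJ t s) sub a2).
exact: (inner_subset_le (mcJ t t') (mcJ t s) sub c2).
Qed.

Lemma process_inc_norm t t' : 0 <= t -> t <= t' -> t' <= T ->
  inner P setT (fun w => x t' w - x t w) (fun w => x t' w - x t w) <=
  2 * (t' - t + 1) * energy t t'.
Proof.
move=> t0 tt' t'T.
have tT : t \in `[0, T] by rewrite in_itv/= t0 (le_trans tt').
have t'T' : t' \in `[0, T] by rewrite in_itv/= t'T (le_trans t0).
have h := inner_sqrD_le measurableT (drift_inc_sq_int tT t'T')
  (ito_integral_inc_sq_int hW hI tT t'T').
rewrite (ito_integral_inc_norm hW hI t0 tt' t'T) in h.
have h1 := drift_norm t0 tt' t'T (sq_ito_drift hx) (drift_inc_sq_int tT t'T')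
  (drift_incE t0 tt' t'T).
rewrite (_ : inner _ _ _ _ = inner P setT
   (fun w => drift_inc t t' w + (I t' w - I t w))
   (fun w => drift_inc t t' w + (I t' w - I t w))); last first.
  by apply: eq_Rintegral => w _; rewrite /drift_inc; ring.
apply: le_trans h _; rewrite /energy.
have := inner_ge0 m (cyl `]t, t']) (lift a).
have := inner_ge0 m (cyl `]t, t']) (lift c).
have h0 : 0 <= t' - t by rewrite subr_ge0.
nra.
Qed.

(** Cost of replacing the process by its value at the left end of the interval. *)
Lemma frozen_norm t t' : 0 <= t -> t <= t' -> t' <= T ->
  let D := fun z : TO => x t z.2 - lift x z in
  sq_int m (cyl `]t, t']) D /\
  inner m (cyl `]t, t']) D D <= (t' - t) * (2 * (t' - t + 1) * energy t t').
Proof.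
move=> t0 tt' t'T D.
have tT : t \in `[0, T] by rewrite in_itv/= t0 (le_trans tt').
have D2 : sq_int m (cyl `]t, t']) D.
  apply: sq_intB => //; last exact: (sq_int_J t0 t'T (sq_ito_lift hx)).
  by have [] := sq_int_snd (mJ t t') (itv_fin t t') (sq_ito_sq_int hW hx tT).
split => //; rewrite -lee_fin EFin_inner//.
have mD2 : measurable_fun (cyl `]t, t']) (fun z => (D z ^+ 2)%:E).
  apply/measurable_EFinP/measurable_funX; exact: D2.1.
have D0 z : (0 <= (D z ^+ 2)%:E)%E by rewrite lee_fin sqr_ge0.
rewrite tonelli_cyl//.
set K := 2 * (t' - t + 1) * energy t t'.
have h0 : 0 <= t' - t by rewrite subr_ge0.
have K0 : 0 <= K.
  by apply: mulr_ge0; [apply: mulr_ge0 => //; exact: addr_ge0|exact: energy_ge0].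
apply: (@le_trans _ _ (\int[mu]_(s in `]t, t']) K%:E)%E); last first.
  rewrite integral_cst//= lebesgue_measure_itv/= lte_fin.
  case: ltP => h; first by rewrite -EFinD -EFinM lee_fin mulrC.
  by rewrite mule0 lee_fin mulr_ge0.
apply: ge0_le_integral => //.
- by move=> s _; apply: integral_ge0 => w _; exact: D0.
- have := measurable_cylP (mJ t t') mD2 => h.
  have hD z : (0 <= ((fun z => (D z ^+ 2)%:E) \_ (cyl `]t, t'])) z)%E.
    by rewrite patchE; case: ifP.
  have := @measurable_fun_fubini_tonelli_F _ _ _ _ _ P _ h hD => h1.
  apply: (eq_measurable_fun (fubini_F P ((fun z => (D z ^+ 2)%:E) \_ (cyl `]t, t'])))); last exact: measurable_funTS.
  move=> s sT; apply: eq_integral => w _.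
  by rewrite patch_cyl patchE sT.
- move=> s; rewrite /= in_itv/= => /andP[ts st'].
  have sT : s <= T := le_trans st' t'T.
  have sT' : s \in `[0, T] by rewrite in_itv/= sT (le_trans t0 (ltW ts)).
  have Ds2 : sq_int P setT (fun w => x s w - x t w).
    by apply: sq_intB => //; exact: (sq_ito_sq_int hW hx).
  rewrite (eq_integral (fun w => ((x s w - x t w) ^+ 2)%:E)); last first.
    by move=> w _; rewrite /D /lift/= -sqrrN opprB.
  rewrite -EFin_inner// lee_fin.
  apply: le_trans (process_inc_norm t0 (ltW ts) sT) _.
  rewrite /K; apply: ler_pM.
  + by rewrite mulr_ge0// addr_ge0// subr_ge0 ltW.
  + exact: energy_ge0.
  + by rewrite ler_wpM2l// lerD2r lerD2r.
  + exact: energy_mono.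
Qed.

End one_process.

End ito_increments.

Section product_rule_expectation.
Context (R : realType) (d : measure_display) (Omega : measurableType d)
  (P : probability Omega R) (W : R -> Omega -> R)
  (hW : brownian_motion P W) (T : R).
Local Notation Fm := (filtration_measurable P W).
Local Notation mu := (@lebesgue_measure R).
Local Notation m := (mu \x P)%E.
Local Notation TO := (measurableTypeR R * Omega)%type.
Implicit Types (x a c : R -> Omega -> R).

Let mcT : measurable (cyl `[0, T] : set TO).
Proof. by apply: measurable_cyl; exact: measurable_itv. Qed.
Let mcJ (t t' : R) : measurable (cyl `]t, t'] : set TO).
Proof. by apply: measurable_cyl; exact: measurable_itv. Qed.

Lemma inner_cylB (f g : TO -> R) t t' : 0 <= t -> t <= t' -> t' <= T ->
  sq_int m (cyl `[0, T]) f -> sq_int m (cyl `[0, T]) g ->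
  inner m (cyl `]0, t']) f g - inner m (cyl `]0, t]) f g =
  inner m (cyl `]t, t']) f g.
Proof.
move=> t0 tt' t'T f2 g2.
have e : cyl `]0, t'] = (cyl `]0, t] `|` cyl `]t, t'] : set TO).
  apply/seteqP; split => -[s w] /=; rewrite /cyl/= !in_itv/=.
    by move=> [/andP[s0 st'] _]; case: (leP s t) => st; [left|right]; rewrite ?s0 ?st' ?st.
  move=> [] [/andP[h1 h2] _]; split => //; first by rewrite h1 (le_trans h2).
  by rewrite h2 (le_lt_trans t0 h1).
rewrite e /inner Rintegral_setU//; first by ring.
- by rewrite -e; exact: (sq_intM_integrable (mcJ 0 t') (sq_int_J (lexx 0) t'T f2) (sq_int_J (lexx 0) t'T g2)).
- apply/disj_set2P/seteqP; split => // -[s w] [[/= h1 _] [/= h2 _]].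
  move: h1 h2; rewrite !in_itv/= => /andP[_ st] /andP[ts _].
  by have := lt_le_trans ts st; rewrite ltxx.
Qed.

(** Adds up the five error terms of the product rule. Here [A] and [B] stand for
    the energies of the two processes over a short interval, times the square
    root of its length; the [i] and [j] are the weighted squared norms of the
    factors in Young's inequality. *)
Lemma defect_bound (q1 q2 q3 q4 q5 i1 i2 i3 i4 j1 j2 j3 j4 A B n3 m3 : R) :
  2 * `|q1| <= i1 + j1 -> 2 * `|q2| <= i2 + j2 -> `|q3| <= n3 + m3 ->
  2 * `|q4| <= i3 + j3 -> 2 * `|q5| <= i4 + j4 ->
  i1 <= 4 * A -> i2 <= 4 * B -> i3 <= A -> i4 <= B ->
  j1 <= B -> j2 <= A -> j3 <= B -> j4 <= A -> n3 <= A -> m3 <= B ->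
  0 <= A -> 0 <= B ->
  `|q1 + q2 + q3 + q4 + q5| <= 10 * (A + B).
Proof.
move=> h1 h2 h3 h4 h5 *.
apply: (@le_trans _ _ (`|q1| + `|q2| + `|q3| + `|q4| + `|q5|)); last lra.
do 4 (apply: le_trans (ler_normD _ _) _; apply: lerD => //).
Qed.

(** Over a short interval the increment of [x p] is expanded at the left end.
    The martingale parts are orthogonal to the values there and their product
    is given by the isometry. What remains comes from freezing each process
    against the drift of the other and from products involving a drift
    increment; it is of the order of the square root of the length times the
    energies, hence sums to zero over fine partitions. *)
Lemma product_rule x a c p b k : 0 <= T -> sq_ito P W T x a c ->
  sq_ito P W T p b k ->
  inner P setT (x T) (p T) - inner P setT (x 0) (p 0) =
  inner m (cyl `]0, T]) (lift x) (lift b) +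
  inner m (cyl `]0, T]) (lift p) (lift a) +
  inner m (cyl `]0, T]) (lift c) (lift k).
Proof.
move=> T0 hx hp.
have [I hI xE] := sq_ito_eq hx.
have [K hK pE] := sq_ito_eq hp.
have x2 := sq_ito_lift hx; have p2 := sq_ito_lift hp.
have a2 := sq_ito_drift hx; have b2 := sq_ito_drift hp.
have c2 : sq_int m (cyl `[0, T]) (lift c) by apply: (@sq_int_lift _ _ _ _ _ _ W); case: hI.
have k2 : sq_int m (cyl `[0, T]) (lift k) by apply: (@sq_int_lift _ _ _ _ _ _ W); case: hK.
pose G f g t := inner m (cyl `]0, t]) f g : R.
(* [psi] is the defect of the formula up to time t, [gam] the energy of the
   two processes up to then *)
pose psi t := inner P setT (x t) (p t) -
  (G (lift x) (lift b) t + G (lift p) (lift a) t + G (lift c) (lift k) t).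
pose gam t := G (lift a) (lift a) t + G (lift c) (lift c) t +
  (G (lift b) (lift b) t + G (lift k) (lift k) t).
have G0 f g : G f g 0 = 0.
  rewrite /G (_ : cyl `]0, 0] = set0) ?/inner ?Rintegral_set0//.
  by rewrite set_itvoc0 /cyl set0X.
suff : psi T = psi 0.
  rewrite /psi !G0 !addr0 subr0 => <-; rewrite /G; ring.
apply: (@small_increments_const _ psi gam T 10) => // th t t' th0 th1 t0 tt' t'T tt'th.
have tT : t \in `[0, T] by rewrite in_itv/= t0 (le_trans tt').
have t'T' : t' \in `[0, T] by rewrite in_itv/= t'T (le_trans t0).
set h := t' - t in tt'th.
have h0 : 0 <= h by rewrite subr_ge0.
have hth : h <= th by apply: le_trans tt'th _; rewrite expr2 ler_piMr// ltW.
have h1 : h <= 1 by exact: le_trans th1.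
pose ga := energy P a c t t'; pose gp := energy P b k t t'.
have gE : gam t' - gam t = ga + gp.
  rewrite /gam /G /ga /gp /energy.
  rewrite -(inner_cylB t0 tt' t'T a2 a2) -(inner_cylB t0 tt' t'T b2 b2).
  by rewrite -(inner_cylB t0 tt' t'T c2 c2) -(inner_cylB t0 tt' t'T k2 k2); ring.
have ga0 : 0 <= ga by exact: energy_ge0.
have gp0 : 0 <= gp by exact: energy_ge0.
have J2 f : sq_int m (cyl `[0, T]) f -> sq_int m (cyl `]t, t']) f.
  exact: (sq_int_J t0 t'T).
have xt := sq_ito_sq_int hW hx tT; have xt' := sq_ito_sq_int hW hx t'T'.
have pt := sq_ito_sq_int hW hp tT; have pt' := sq_ito_sq_int hW hp t'T'.
pose al := drift_inc x I t t'; pose be := drift_inc p K t t'.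
pose io w := I t' w - I t w; pose ka w := K t' w - K t w.
have al2 : sq_int P setT al := drift_inc_sq_int hW hx hI tT t'T'.
have be2 : sq_int P setT be := drift_inc_sq_int hW hp hK tT t'T'.
have io2 : sq_int P setT io := ito_integral_inc_sq_int hW hI tT t'T'.
have ka2 : sq_int P setT ka := ito_integral_inc_sq_int hW hK tT t'T'.
have alE := drift_incE hx xE t0 tt' t'T.
have beE := drift_incE hp pE t0 tt' t'T.
have aln : inner P setT al al <= h * ga.
  apply: le_trans (drift_norm t0 tt' t'T a2 al2 alE) _.
  by rewrite ler_wpM2l// lerDl inner_ge0.
have ben : inner P setT be be <= h * gp.
  apply: le_trans (drift_norm t0 tt' t'T b2 be2 beE) _.
  by rewrite ler_wpM2l// lerDl inner_ge0.
have ion : inner P setT io io <= ga.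
  by rewrite (ito_integral_inc_norm hW hI)// lerDr inner_ge0.
have kan : inner P setT ka ka <= gp.
  by rewrite (ito_integral_inc_norm hW hK)// lerDr inner_ge0.
have [Dx2 Dxn] := frozen_norm hW hx hI xE t0 tt' t'T.
have [Dp2 Dpn] := frozen_norm hW hp hK pE t0 tt' t'T.
set Dx := fun z : TO => x t z.2 - lift x z in Dx2 Dxn.
set Dp := fun z : TO => p t z.2 - lift p z in Dp2 Dpn.
have psiE : psi t' - psi t =
    inner m (cyl `]t, t']) Dx (lift b) + inner m (cyl `]t, t']) Dp (lift a) +
    inner P setT al be + inner P setT al ka + inner P setT be io.
  have mJ := measurable_itv (`]t, t'] : interval R).
  have [xt2 _] := sq_int_snd mJ (itv_fin t t') xt.
  have [pt2 _] := sq_int_snd mJ (itv_fin t t') pt.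
  rewrite /Dx innerBl//; [|exact: J2|exact: J2].
  rewrite /Dp innerBl//; [|exact: J2|exact: J2].
  rewrite -(inner_drift t0 t'T b2 xt be2.1 beE) -(inner_drift t0 t'T a2 pt al2.1 alE).
  have xka : inner P setT (x t) ka = 0.
    by apply: (ito_integral_orth hW hK t0 tt' t'T) => //; exact: (sq_ito_Fm hx).
  have pio : inner P setT (p t) io = 0.
    by apply: (ito_integral_orth hW hI t0 tt' t'T) => //; exact: (sq_ito_Fm hp).
  have ioka := ito_isometry hW hI hK t0 tt' t'T.
  rewrite -(inner_cylB t0 tt' t'T x2 b2) -(inner_cylB t0 tt' t'T p2 a2).
  rewrite -(inner_cylB t0 tt' t'T c2 k2) in ioka.
  have e : inner P setT (x t') (p t') = inner P setT (x t) (p t) +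
      inner P setT (x t) be + inner P setT (p t) al +
      inner P setT al be + inner P setT al ka + inner P setT io be +
      inner P setT io ka.
    have -> : inner P setT (x t') (p t') =
      inner P setT (fun w => x t w + (al w + io w)) (fun w => p t w + (be w + ka w)).
      by apply: eq_Rintegral => w _; rewrite /al /be /io /ka /drift_inc; ring.
    have alio2 := sq_intD measurableT al2 io2.
    have beka2 := sq_intD measurableT be2 ka2.
    rewrite (innerDD measurableT xt alio2 pt beka2) (innerDr measurableT be2 ka2 xt).
    rewrite (innerDD measurableT al2 io2 be2 ka2) (innerDl measurableT al2 io2 pt).
    by rewrite xka (innerC _ _ io) pio (innerC _ _ al (p t)); ring.
  by rewrite /psi e ioka (innerC _ _ be) /G; ring.
rewrite psiE gE.
have div u v : u <= h * v -> 0 <= v -> th^-1 * u <= th * v.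
  move=> uv v0; rewrite ler_pdivrMl//; apply: le_trans uv _.
  by rewrite mulrA -expr2 ler_wpM2r.
have h4 : 2 * (h + 1) <= 4.
  by rewrite (_ : 4 = 2 * (1 + 1)); [rewrite ler_wpM2l// lerD2r|ring].
rewrite -mulrA mulrDr; apply: (defect_bound
  (inner_young (mcJ t t') th0 Dx2 (J2 _ b2)) (inner_young (mcJ t t') th0 Dp2 (J2 _ a2))
  (inner_young1 measurableT al2 be2) (inner_young measurableT th0 al2 ka2)
  (inner_young measurableT th0 be2 io2)).
- rewrite mulrCA; apply: div; last by rewrite mulr_ge0.
  by apply: le_trans Dxn _; rewrite ler_wpM2l// ler_wpM2r.
- rewrite mulrCA; apply: div; last by rewrite mulr_ge0.
  by apply: le_trans Dpn _; rewrite ler_wpM2l// ler_wpM2r.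
- exact: div aln ga0.
- exact: div ben gp0.
- by rewrite ler_wpM2l ?(ltW th0)// lerDl inner_ge0.
- by rewrite ler_wpM2l ?(ltW th0)// lerDl inner_ge0.
- by rewrite ler_wpM2l ?(ltW th0).
- by rewrite ler_wpM2l ?(ltW th0).
- by apply: le_trans aln _; rewrite ler_wpM2r.
- by apply: le_trans ben _; rewrite ler_wpM2r.
- by rewrite mulr_ge0// ltW.
- by rewrite mulr_ge0// ltW.
Qed.

End product_rule_expectation.

(** * Joint measurability *)

Section caratheodory.
Context (R : realType) (d : measure_display) (X : measurableType d).

(** A function measurable in one variable and continuous in the other is
    jointly measurable: [h] is the limit of functions with countably many
    values, namely a point of [S] chosen in each cell of a fine grid. *)
Lemma measurable_caratheodory (D : set X) (S : set R) (G : X -> R -> R)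
    (h : X -> R) : measurable D ->
  (forall r, S r -> measurable_fun D (G ^~ r)) ->
  (forall x, D x -> {within S, continuous (G x)}) ->
  measurable_fun D h -> (forall x, D x -> S (h x)) ->
  measurable_fun D (fun x => G x (h x)).
Proof.
move=> mD mG cG mh hS.
pose cell n (k : int) : set R :=
  S `&` [set v | k%:~R <= n.+1%:R * v < (k + 1)%:~R].
(* 0 is a junk value: only cells that meet [S] matter *)
pose c n k : R := xget 0 (cell n k).
pose k_ n x : int := Num.floor (n.+1%:R * h x).
have hcell n x : D x -> cell n (k_ n x) (h x).
  by move=> Dx; split; [exact: hS|exact: floor_itv].
have cP n x : D x -> cell n (k_ n x) (c n (k_ n x)).
  move=> Dx; rewrite /c; case: xgetP => [y -> //|/(_ (h x))].
  by move=> /(_ (hcell n x Dx)).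
apply: (@measurable_fun_cvg _ _ _ _ (fun n x => G x (c n (k_ n x)))).
- move=> n; have : forall k, measurable (D `&` [set x | k_ n x = k]).
    move=> k.
    have -> : D `&` [set x | k_ n x = k] =
        D `&` (fun x => n.+1%:R * h x) @^-1` `[k%:~R, (k + 1)%:~R[.
      apply/seteqP; split => x /= [Dx]; rewrite in_itv/=.
        by move=> <-; split => //; exact: floor_itv.
      by move=> kx; split => //; exact: floor_def.
    apply: (measurable_funM (measurable_cst _) mh) => //.
  move=> mk _ B mB.
  have -> : D `&` (fun x => G x (c n (k_ n x))) @^-1` B =
      \bigcup_(k in [set k | S (c n k)])
        ((D `&` [set x | k_ n x = k]) `&` (D `&` (G ^~ (c n k)) @^-1` B)).
    apply/seteqP; split => [x [Dx /= Bx]|x [k /= _ [[Dx <-] [_ Bx]]]] //.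
    by exists (k_ n x) => //; have [] := cP n x Dx.
  rewrite bigcup_mkcond; apply: countable_bigcupT_measurable => [//|k].
  case: ifPn => // /set_mem Sk.
  by apply: measurableI => //; exact: mG.
- move=> x Dx.
  have cx : c n (k_ n x) @[n --> \oo] --> h x.
    apply/cvgrPdist_lt => e e0; near=> n.
    have [_ /andP[a1 a2]] := cP n x Dx; have [_ /andP[b1 b2]] := hcell n x Dx.
    have n0 : 0 < n.+1%:R :> R by [].
    have : `|n.+1%:R * (h x - c n (k_ n x))| < 1.
      by rewrite mulrBr ltr_norml; move: a2 b2; rewrite intrD; lra.
    rewrite normrM ger0_norm// mulrC -ltr_pdivlMr// div1r => /lt_trans; apply.
    near: n; exact: near_infty_natSinv_lt (PosNum e0).
  have := cG x Dx => /subspace_continuousP /(_ _ (hS x Dx)).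
  apply: (cvg_comp (fun n => c n (k_ n x))) => A hA.
  have An : \forall n \near \oo, S (c n (k_ n x)) -> A (c n (k_ n x)) := cx _ hA.
  have : \forall n \near \oo, A (c n (k_ n x)).
    by apply: filterS An => n; apply; have [] := cP n x Dx.
  by [].
Unshelve. all: by end_near.
Qed.

End caratheodory.

(** * Averages over a sliding window *)

Lemma continuous_within_comp (A B C : topologicalType) (S : set A) (S' : set B)
    (g : A -> B) (f : B -> C) : {within S', continuous f} -> continuous g ->
  (forall x, S x -> S' (g x)) -> {within S, continuous (f \o g)}.
Proof.
move=> /subspace_continuousP cf cg gS; apply/subspace_continuousP => x Sx.
apply: (cvg_comp g) (cf _ (gS _ Sx)) => D hD.
have : \forall y \near x, S' (g y) -> D (g y) := cg x _ hD.
by apply: filterS => y h Sy; apply: h; exact: gS.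
Qed.

Section delay_average.
Context (R : realType).
Local Notation mu := (@lebesgue_measure R).
Variables (g : R -> R) (del T lam : R).
Hypotheses (del0 : 0 <= del) (T0 : 0 <= T)
  (cg : {within `[- del, T], continuous g}).

Definition delay_average (f : R -> R) t : R :=
  \int[mu]_(tau in `[- del, 0]) (expR (lam * tau) * f (t + tau)).

(** The path frozen outside its interval of definition, so that it is continuous
    everywhere and the derivatives at the ends of [[0, T]] are two-sided. *)
Let gt s := g (Num.max (- del) (Num.min s T)).

Let cgt : continuous gt.
Proof.
have cclamp : continuous (fun s : R => Num.max (- del) (Num.min s T)).
  move=> x; apply: (@continuous_max _ _ (cst (- del)) (id \min cst T)).
    exact: cvg_cst.
  by apply: continuous_min; [exact: cvg_id|exact: cvg_cst].
have : {within setT, continuous gt}.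
  apply: (continuous_within_comp cg cclamp) => x _.
  rewrite /= in_itv/= le_max lexx/= ge_max ge_min lexx orbT andbT.
  by rewrite (le_trans _ T0)// oppr_le0.
move=> /subspace_continuousP h x; have := h x I.
move=> {}h D hD; have : \forall y \near x, setT y -> D (gt y) := h D hD.
by apply: filterS => y; exact.
Qed.

Let gtE s : - del <= s -> s <= T -> gt s = g s.
Proof. by move=> ds sT; rewrite /gt (min_idPl sT) (max_idPr ds). Qed.

Let k s := expR (lam * s) * gt s.

Let ck : continuous k.
Proof.
move=> x; apply: cvgM; last exact: cgt.
apply: continuous_comp; last exact: continuous_expR.
by apply: cvgMr; exact: cvg_id.
Qed.

Let a := - del - 1.
Let H x := \int[mu]_(s in `[a, x]) k s.

Let dH x : a < x -> is_derive x 1 H (k x).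
Proof.
move=> ax; have xx1 : x < x + 1 by rewrite ltrDl.
have ik : mu.-integrable `[a, x + 1] (EFin \o k).
  apply: continuous_compact_integrable; first exact: segment_compact.
  exact: continuous_subspaceT.
have [d1 d2] := continuous_FTC1_closed xx1 ik ax (@ck x).
by split; [exact: d1|rewrite -derive1E; exact: d2].
Qed.

Let v := delay_average gt.

(** The substitution [s = t + tau] moves the time variable out of the integrand,
    to the bounds of integration and an exponential factor. *)
Let vE t : -1 < t -> v t = expR (- (lam * t)) * (H t - H (t - del)).
Proof.
move=> t1; rewrite /v /delay_average.
have [d0|dn0] := eqVneq del 0.
  by rewrite d0 oppr0 set_itv1 Rintegral_set1 addr0 subrr mulr0.
have {dn0} dp : - del < 0 by rewrite oppr_lt0 lt_neqAle eq_sym dn0.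
pose F tau := expR (- (lam * t)) * H (t + tau).
have dF tau : - del <= tau -> is_derive tau 1 F (expR (lam * tau) * gt (t + tau)).
  move=> dtau; have : a < t + tau by rewrite /a addrC ltr_leD.
  move=> /dH h.
  have h2 : is_derive tau 1 (fun tau : R => t + tau) 1.
    by apply: is_derive_eq; rewrite ?(mulr1, add0r, addr0).
  have h3 : is_derive tau 1 (H \o (fun tau : R => t + tau)) (k (t + tau) * 1).
    exact: is_derive1_comp.
  have h4 := is_deriveZ (expR (- (lam * t))) h3.
  rewrite /F; apply: is_derive_eq h4 _.
  rewrite /GRing.scale/= mulr1 /k mulrA -expRD; congr (expR _ * _); ring.
have dFo tau : - del <= tau -> F tau' @[tau' --> tau] --> F tau.
  move=> dtau; apply: differentiable_continuous; apply/derivable1_diffP.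
  by have [] := dF _ dtau.
have := @continuous_FTC2 R (fun tau => expR (lam * tau) * gt (t + tau)) F _ _ dp.
rewrite /Rintegral => ->/=.
- by rewrite /F addr0 -mulrBr.
- apply: continuous_subspaceT => x; apply: cvgM.
    apply: continuous_comp; last exact: continuous_expR.
    by apply: cvgMr; exact: cvg_id.
  apply: continuous_comp; last exact: cgt.
  by apply: cvgD; [exact: cvg_cst|exact: cvg_id].
- split.
  + move=> x; rewrite in_itv/= => /andP[/ltW /dF[]//].
  + by apply: cvg_at_right_filter; exact: dFo.
  + by apply: cvg_at_left_filter; apply: dFo; exact: ltW.
- move=> x; rewrite in_itv/= => /andP[/ltW /dF[d1 d2] _].
  by rewrite derive1E.
Qed.

Let dv (t : R) : -1 < t ->
  is_derive t 1 v (gt t - lam * v t - expR (- (lam * del)) * gt (t - del)).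
Proof.
move=> t1; have at1 : a < t.
  by rewrite /a (le_lt_trans _ t1)// gerDr oppr_le0.
have atd : a < t - del by rewrite /a addrC ltr_leD.
have h1 := dH at1.
have h2 : is_derive t 1 (H \o (fun s : R => s - del)) (k (t - del) * 1).
  apply: is_derive1_comp; first exact: dH.
  by apply: is_derive_eq; rewrite ?(mulr1, add0r, addr0, subr0, oppr0).
have h3 : is_derive t 1 (expR \o (fun s : R => - (lam * s))) (expR (- (lam * t)) * - lam).
  apply: is_derive1_comp; apply: is_derive_eq.
  by rewrite /GRing.scale/= mulr1.
have h4 : is_derive t 1 ((expR \o (fun s : R => - (lam * s))) *
    (H - (H \o (fun s : R => s - del)))) 
   (gt t - lam * v t - expR (- (lam * del)) * gt (t - del)).
  apply: is_derive_eq.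
  rewrite /GRing.scale/= vE// /k.
  have e : expR (- (lam * t)) * expR (lam * t) = 1 by rewrite -expRD addNr expR0.
  have e' : expR (- (lam * t)) * expR (lam * (t - del)) = expR (- (lam * del)).
    by rewrite -expRD; congr expR; ring.
  rewrite mulr1 -e' !fctE/= -[gt t in RHS]mul1r -e; ring.
apply: near_eq_is_derive h4; near=> s; rewrite vE//; near: s.
exact: lt_nbhsr.
Unshelve. all: by end_near.
Qed.

Let cv (t : R) : -1 < t -> {for t, continuous v}.
Proof.
move=> t1; apply: differentiable_continuous; apply/derivable1_diffP.
by have [] := dv t1.
Qed.

Let vg t : 0 <= t -> t <= T -> v t = delay_average g t.
Proof.
move=> t0 tT; apply: eq_Rintegral => tau; rewrite inE/= in_itv/= => /andP[dtau tau0].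
rewrite gtE// ?(le_trans dtau) ?lerDr//.
by rewrite (le_trans _ tT)// gerDl.
Qed.

(** The average over a sliding window is absolutely continuous even though the
    path is not: the path enters through the values at the ends of the window. *)
Lemma delay_average_ode t : 0 <= t -> t <= T ->
  delay_average g t = delay_average g 0 +
    \int[mu]_(s in `[0, t])
      (g s - lam * delay_average g s - expR (- (lam * del)) * g (s - del)).
Proof.
move=> t0 tT.
transitivity (delay_average g 0 + \int[mu]_(s in `[0, t])
    (gt s - lam * v s - expR (- (lam * del)) * gt (s - del))); last first.
  congr (_ + _); apply: eq_Rintegral.
  move=> s; rewrite inE/= in_itv/= => /andP[s0 st].
  have sT := le_trans st tT.
  rewrite -(vg s0 sT) !gtE//.
  - by rewrite lerBrDr addNr.
  - by rewrite (le_trans _ sT)// gerBl.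
  - by rewrite (le_trans _ s0)// oppr_le0.
rewrite -vg// -vg//.
move: t0; rewrite le_eqVlt => /predU1P[<-|t0].
  by rewrite set_itv1 Rintegral_set1 addr0.
have tm1 (s : R) : 0 <= s -> -1 < s by move=> s0; rewrite (lt_le_trans _ s0)// ltrN10.
have cF : {within `[0, t], continuous
    (fun s : R => gt s - lam * v s - expR (- (lam * del)) * gt (s - del))}.
  apply/subspace_continuousP => s; rewrite /= in_itv/= => /andP[s0 _].
  apply: cvg_within_filter; apply: cvgB.
    by apply: cvgB; [exact: cgt|apply: cvgMr; exact: (cv (tm1 _ s0))].
  apply: cvgMr; apply: (cvg_comp (fun s : R => s - del)); last exact: cgt.
  by apply: cvgB; [exact: cvg_id|exact: cvg_cst].
rewrite /Rintegral (@continuous_FTC2 R _ v)//=; first by rewrite addrCA subrr addr0.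
- split.
  + by move=> s; rewrite in_itv/= => /andP[/ltW s0 _]; have [] := dv (tm1 _ s0).
  + by apply: cvg_at_right_filter; exact: (cv (tm1 _ (lexx 0))).
  + by apply: cvg_at_left_filter; exact: (cv (tm1 _ (ltW t0))).
- move=> s; rewrite in_itv/= => /andP[/ltW s0 _]; have [d1 d2] := dv (tm1 _ s0).
  by rewrite derive1E.
Qed.

Lemma delay_average_continuous : {within `[0, T], continuous (delay_average g)}.
Proof.
apply: (@subspace_eq_continuous _ _ _ v).
  by move=> s; rewrite inE/= in_itv/= => /andP[]; exact: vg.
apply/subspace_continuousP => s; rewrite /= in_itv/= => /andP[s0 _].
by apply: cvg_within_filter; apply: cv; rewrite (lt_le_trans _ s0)// ltrN10.
Qed.

End delay_average.

(** * Functions with vanishing primitive *)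

Section zero_primitive.
Context (R : realType).
Local Notation mu := (@lebesgue_measure R).

(** Lebesgue's differentiation theorem: an integrable function is almost
    everywhere the derivative of its primitive. *)
Lemma ae_eq0_of_primitive (h : R -> R) (T : R) :
  mu.-integrable `[0, T] (EFin \o h) ->
  (forall t, t \in `[0, T] -> \int[mu]_(s in `[0, t]) h s = 0) ->
  {ae mu, forall s, s \in `[0, T] -> h s = 0}.
Proof.
move=> ih h0.
have ihT : mu.-integrable setT (EFin \o (h \_ `[0, T])).
  rewrite -restrict_EFin.
  by have [hi _] := @integrable_mkcond _ _ _ mu `[0, T]%classic (EFin \o h) (measurable_itv _); exact: hi.
have iS (A : set (measurableTypeR R)) : measurable A -> mu.-integrable A (EFin \o (h \_ `[0, T])).
  by move=> mA; apply: integrableS ihT.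
have F0 (y : R) : \int[mu]_(t in [set` `]-oo, y]]) (h \_ `[0, T]) t = 0.
  rewrite -Rintegral_mkcondr.
  have [y0|y0] := ltP y 0.
    rewrite (_ : _ `&` _ = set0) ?Rintegral_set0//.
    apply/seteqP; split => // x [/=]; rewrite !in_itv/= => xy /andP[x0 _].
    by have := le_lt_trans xy y0; rewrite ltNge x0.
  have [T0|T0] := ltP T 0.
    rewrite (_ : _ `&` _ = set0) ?Rintegral_set0//.
    apply/seteqP; split => // x [/=]; rewrite !in_itv/= => xy /andP[x0 xT].
    by have := le_lt_trans xT T0; rewrite ltNge x0.
  rewrite (_ : _ `&` _ = `[0, Num.min y T]%classic); last first.
    apply/seteqP; split => x /=; rewrite !in_itv/= le_min.
      by move=> [-> /andP[-> ->]].
    by move=> /andP[-> /andP[-> ->]].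
  by apply: h0; rewrite in_itv/= le_min y0 T0 ge_min lexx orbT.
have loc : locally_integrable setT (h \_ `[0, T]).
  by apply: integrable_locally => //; exact: measurable_itv.
have := @FTC1Ny R _ (fun y => iS _ (measurable_itv `]-oo, y])) loc.
apply: filterS; first exact: (ae_filter_ringOfSetsType mu).
move=> s [_ hs] sT.
have := hs; rewrite patchE mem_set// => <-.
by rewrite (_ : (fun x : R => _) = cst 0) ?derive1_cst//; apply/funext => y; exact: F0.
Qed.

End zero_primitive.

(** * Processes with continuous paths *)

Section parametric_integral.
Context (R : realType) (d : measure_display) (Omega : measurableType d).
Local Notation mu := (@lebesgue_measure R).
Local Notation TO := (measurableTypeR R * Omega)%type.

Lemma measurable_process (K : R -> Omega -> R) (a b : R) :
  (forall t, t \in `[a, b] -> measurable_fun setT (K t)) ->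
  (forall w, {within `[a, b], continuous (K ^~ w)}) ->
  measurable_fun (cyl `[a, b]) (lift K).
Proof.
move=> mK cK.
apply: (@measurable_caratheodory R _ TO (cyl `[a, b]) `[a, b]%classic
   (fun z r => K r z.2) (fun z => z.1)).
- by apply: measurable_cyl; exact: measurable_itv.
- move=> r rab; apply: measurable_funTS.
  exact: measurableT_comp (mK r rab) measurable_snd.
- by move=> z _; exact: cK.
- by apply: measurable_funTS; exact: measurable_fst.
- by move=> z [].
Qed.

Lemma measurable_param_integral (K : R -> Omega -> R) (a b : R) :
  (forall t, t \in `[a, b] -> measurable_fun setT (K t)) ->
  (forall w, {within `[a, b], continuous (K ^~ w)}) ->
  measurable_fun setT (fun w => \int[mu]_(t in `[a, b]) K t w).
Proof.
move=> mK cK; have mJ := measurable_itv (`[a, b] : interval R).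
have mf : measurable_fun (cyl `[a, b]) (EFin \o lift K).
  by apply/measurable_EFinP; exact: measurable_process.
have h (f : TO -> \bar R) : measurable_fun (cyl `[a, b]) f -> (forall z, 0%R <= f z)%E ->
    measurable_fun setT (fun w => \int[mu]_(t in `[a, b]%classic) f (t, w))%E.
  move=> {}mf f0; have := measurable_cylP mJ mf => h.
  have hD z : (0 <= (f \_ (cyl `[a, b])) z)%E by rewrite patchE; case: ifP.
  have := @measurable_fun_fubini_tonelli_G _ _ _ _ _ mu _ h hD.
  apply: eq_measurable_fun => w _; rewrite [RHS]integral_mkcond.
  by apply: eq_integral => s _; exact: patch_cyl.
apply: (measurableT_comp (f := fine)); first exact: fine_measurable.
rewrite (_ : (fun w => _) = (fun w => (\int[mu]_(t in `[a, b]%classic) (EFin \o lift K)^\+ (t, w) -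
    \int[mu]_(t in `[a, b]%classic) (EFin \o lift K)^\- (t, w))%E)); last first.
  apply/funext => w; rewrite [LHS]integralE.
  by congr (_ - _)%E; apply: eq_integral => t _; rewrite ?funeposE ?funenegE.
apply: emeasurable_funB.
  by apply: h; [exact: measurable_funepos|exact: funepos_ge0].
by apply: h; [exact: measurable_funeneg|exact: funeneg_ge0].
Qed.

End parametric_integral.

Section sup_bounds.
Context (R : realType) (d : measure_display) (Omega : measurableType d)
  (P : probability Omega R) (W : R -> Omega -> R).

(** The pathwise supremum of a process need not be measurable, so its integral is
    only a supremum of integrals of simple functions below it; that is still
    monotone. *)
Lemma le_lower_integral (f g : Omega -> \bar R) :
  (forall w, 0 <= f w)%E -> (forall w, f w <= g w)%E ->
  (\int[P]_w f w <= \int[P]_w g w)%E.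
Proof.
move=> f0 fg.
have g0 w : (0 <= g w)%E by exact: le_trans (f0 w) (fg w).
rewrite (@ge0_integralE _ _ _ P setT f)//.
rewrite (@ge0_integralE _ _ _ P setT g)//.
apply: le_ereal_sup => _ [h /= hf <-]; exists h => // x.
apply: le_trans (hf x) _; rewrite !patch_setT; exact: fg.
Qed.

(** The bound [M] is the integral of the squared supremum; [f] is any variable
    dominated by the path, with [K] the constant of the domination. *)
Lemma S2_process_bound (a T : R) X : a <= T -> S2_process P W a T X ->
  exists M : R, forall (K : R) (f : Omega -> R), measurable_fun setT f -> 0 < K ->
  (forall w s, (forall t, t \in `[a, T] -> X t w ^+ 2 <= s) -> f w ^+ 2 <= K * s) ->
  (\int[P]_w (f w ^+ 2)%:E <= (K * M)%:E)%E.
Proof.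
move=> aT [_ _]; set S := fun w => ereal_sup _ => Soo.
have S0 w : (0 <= S w)%E.
  apply: (@le_trans _ _ (X a w ^+ 2)%:E); first by rewrite lee_fin sqr_ge0.
  by apply: ereal_sup_ubound; exists a => //=; rewrite /= in_itv/= lexx.
have Sfin : (\int[P]_w S w)%E \is a fin_num.
  by rewrite ge0_fin_numE//; exact: integral_ge0.
exists (fine (\int[P]_w S w)%E) => K f mf K0 hf.
have mf2 : measurable_fun setT (fun w => (f w ^+ 2)%:E).
  exact/measurable_EFinP/measurable_funX.
rewrite EFinM fineK// -lee_pdivrMl//.
rewrite -ge0_integralZl//; last 2 first.
- by move=> w _; rewrite lee_fin sqr_ge0.
- by rewrite lee_fin invr_ge0 ltW.
apply: le_lower_integral.
  by move=> w; rewrite -EFinM lee_fin mulr_ge0 ?sqr_ge0// invr_ge0 ltW.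
move=> w; have := S0 w; case E : (S w) => [s| |] // _; last by rewrite leey.
rewrite -EFinM lee_fin ler_pdivrMl//; apply: hf => t tT.
by rewrite -lee_fin -E; apply: ereal_sup_ubound; exists t.
Qed.

Lemma S2_process_second_moment (a T : R) X : brownian_motion P W -> a <= 0 ->
  0 <= T -> S2_process P W a T X -> exists M : R, forall t, t \in `[0, T] ->
  (\int[P]_w (X t w ^+ 2)%:E <= M%:E)%E.
Proof.
move=> hW a0 T0 hX; have [M hM] := S2_process_bound (le_trans a0 T0) hX.
case: hX => -[mX FX] _ _; exists (1 * M) => t tT.
apply: hM => //; first exact: (Fm_measurable hW (FX t tT)).
move=> w r hr; rewrite mul1r; apply: hr; move: tT; rewrite !in_itv/= => /andP[t0 ->].
by rewrite (le_trans a0).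
Qed.

End sup_bounds.

(** * Delayed processes *)

Section delayed_processes.
Context (R : realType) (d : measure_display) (Omega : measurableType d)
  (P : probability Omega R) (W : R -> Omega -> R)
  (hW : brownian_motion P W).
Local Notation Fm := (filtration_measurable P W).
Local Notation FW t := <<s filtration_events P W t >>.
Local Notation mu := (@lebesgue_measure R).
Local Notation m := (mu \x P)%E.
Local Notation TO := (measurableTypeR R * Omega)%type.
Variables (T del lam : R) (X phi : R -> Omega -> R) (A : set Omega).
Hypotheses (T0 : 0 <= T) (del0 : 0 <= del)
  (hX : S2_process P W (- del) T X)
  (mA : measurable A) (PA : P (~` A) = 0%E)
  (XA : forall w, A w -> forall t, t \in `[- del, 0] -> X t w = phi t w)
  (Fphi : forall t, t \in `[- del, 0] -> Fm 0 (phi t)).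

(** On the past window the process is only almost surely the initial path;
    killing it outside a set [A] of full measure on which it is makes it adapted
    to the filtration at time 0 there too. *)
Definition cut s w : R := \1_A w * X s w.
Definition cut_delay t w : R := cut (t - del) w.
Definition cut_avg t w : R := delay_average del lam (cut ^~ w) t.

Let mdT : - del <= T. Proof. by rewrite (le_trans _ T0)// oppr_le0. Qed.

Lemma cutE w s : A w -> cut s w = X s w.
Proof. by move=> Aw; rewrite /cut indicE mem_set// mul1r. Qed.

Lemma Fm_indic t : Fm t (\1_A : Omega -> R).
Proof.
apply: (@measurable_indic _ (g_sigma_algebraType (filtration_events P W t)) R setT A).
rewrite -(setCK A).
apply: (@measurableC _ (g_sigma_algebraType (filtration_events P W t))).
apply: sub_gen_smallest; right; split => //; exact: measurableC.
Qed.

Lemma cut_Fm s t : - del <= s -> 0 <= t -> s <= t -> t <= T -> Fm t (cut s).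
Proof.
move=> ds t0 st tT; have [s0|s0] := leP s 0.
  have -> : cut s = fun w => \1_A w * phi s w.
    apply/funext => w; rewrite /cut indicE; case: (boolP (w \in A)) => [/set_mem Aw|_].
      by rewrite XA// in_itv/= ds.
    by rewrite !mul0r.
  apply: FmM; first exact: Fm_indic.
  by apply: (Fm_mono t0); apply: Fphi; rewrite in_itv/= ds.
apply: FmM; first exact: Fm_indic.
apply: (Fm_mono st); case: hX => -[_ aX] _ _; apply: aX.
by rewrite in_itv/= ltW//= (le_trans st).
Qed.

Lemma cut_measurable s : - del <= s -> s <= T -> measurable_fun setT (cut s).
Proof.
move=> ds sT; have [s0|/ltW s0] := leP s 0.
  by apply: (Fm_measurable hW (t := 0)); exact: cut_Fm.
by apply: (Fm_measurable hW (t := s)); exact: cut_Fm.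
Qed.

Lemma cut_continuous w : {within `[- del, T], continuous (cut ^~ w)}.
Proof.
case: hX => _ cX _; apply/subspace_continuousP => s sT.
by apply: cvgMr; move/subspace_continuousP : (cX w); exact.
Qed.

Lemma cut_delay_measurable : measurable_fun (cyl `[0, T]) (lift cut_delay).
Proof.
apply: (@measurable_caratheodory R _ TO (cyl `[0, T]) `[- del, T]%classic
   (fun z r => cut r z.2) (fun z => z.1 - del)).
- by apply: measurable_cyl; exact: measurable_itv.
- move=> r; rewrite /= in_itv/= => /andP[dr rT]; apply: measurable_funTS.
  exact: measurableT_comp (cut_measurable dr rT) measurable_snd.
- by move=> z _; exact: cut_continuous.
- apply: measurable_funTS; apply: measurable_funB => //; exact: measurable_fst.
- move=> z [/=]; rewrite !in_itv/= => /andP[z0 zT] _.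
  by rewrite lerBrDr addNr z0/= (le_trans _ zT)// gerBl.
Qed.

Let window_continuous w t : 0 <= t -> t <= T ->
  {within `[- del, 0], continuous (fun tau => expR (lam * tau) * cut (t + tau) w)}.
Proof.
move=> t0 tT; apply/subspace_continuousP => s sd.
have cs : {within `[- del, 0], continuous ((cut ^~ w) \o (fun tau : R => t + tau))}.
  apply: continuous_within_comp (cut_continuous (w := w)) _ _.
    by move=> x; apply: cvgD; [exact: cvg_cst|exact: cvg_id].
  move=> x; rewrite /= !in_itv/= => /andP[dx x0].
  by rewrite (le_trans dx) ?lerDr//= (le_trans _ tT)// gerDl.
apply: cvgM; last by move/subspace_continuousP : cs; exact.
apply: cvg_within_filter; apply: continuous_comp; last exact: continuous_expR.
by apply: cvgMr; exact: cvg_id.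
Qed.

Lemma cut_avg_Fm t : 0 <= t -> t <= T -> Fm t (cut_avg t).
Proof.
move=> t0 tT.
apply: (@measurable_param_integral R _ (g_sigma_algebraType (filtration_events P W t))
  (fun tau w => expR (lam * tau) * cut (t + tau) w)).
- move=> tau; rewrite in_itv/= => /andP[dtau tau0].
  apply: measurable_funM; first exact: measurable_cst.
  apply: cut_Fm => //; last by rewrite gerDl.
  by rewrite (le_trans dtau)// lerDr.
- by move=> w; exact: window_continuous.
Qed.

Lemma cut_avg_continuous w : {within `[0, T], continuous (cut_avg ^~ w)}.
Proof. by apply: delay_average_continuous => //; exact: cut_continuous. Qed.

Lemma cut_avg_measurable : measurable_fun (cyl `[0, T]) (lift cut_avg).
Proof.
apply: measurable_process => [t|w]; last exact: cut_avg_continuous.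
rewrite in_itv/= => /andP[t0 tT].
by apply: (Fm_measurable hW (t := t)); exact: cut_avg_Fm.
Qed.

(** The average over the window is at most the supremum of the path times [e del],
    a bound of the total weight; the 1 in [K] makes it positive. *)
Lemma cut_bound : exists M : R,
  (forall s, - del <= s -> s <= T -> (\int[P]_w (cut s w ^+ 2)%:E <= M%:E)%E) /\
  (forall t, t \in `[0, T] -> (\int[P]_w (cut_avg t w ^+ 2)%:E <= M%:E)%E).
Proof.
have [M hM] := S2_process_bound mdT hX.
pose e := expR (`|lam| * del).
pose K := (e * del) ^+ 2 + 1.
have K0 : 0 < K by rewrite ltr_wpDl// sqr_ge0.
have cutX s w r : - del <= s -> s <= T ->
    (forall t, t \in `[- del, T] -> X t w ^+ 2 <= r) -> cut s w ^+ 2 <= r.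
  move=> ds sT hr; rewrite /cut indicE; case: (_ \in _).
    by rewrite mul1r; apply: hr; rewrite in_itv/= ds.
  rewrite mul0r expr0n/=; apply: le_trans (sqr_ge0 (X s w)) (hr _ _).
  by rewrite in_itv/= ds.
exists (Num.max (1 * M) (K * M)); split.
- move=> s ds sT; apply: (@le_trans _ _ (1 * M)%:E); last by rewrite lee_fin le_max lexx.
  apply: hM => //; first exact: cut_measurable.
  by move=> w r; rewrite mul1r; exact: cutX.
- move=> t; rewrite in_itv/= => /andP[t0 tT].
  apply: (@le_trans _ _ (K * M)%:E); last by rewrite lee_fin le_max lexx orbT.
  apply: hM => //.
    by apply: (Fm_measurable hW (t := t)); exact: cut_avg_Fm.
  move=> w r hr.
  have r0 : 0 <= r.
    apply: le_trans (sqr_ge0 (X 0 w)) (hr 0 _).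
    by rewrite in_itv/= oppr_le0 del0.
  have cS s : - del <= s -> s <= T -> `|cut s w| <= Num.sqrt r.
    move=> ds sT; rewrite -(@ler_pXn2r _ 2)// ?nnegrE ?sqrtr_ge0//.
    by rewrite sqr_sqrtr// real_normK ?num_real//; exact: cutX.
  have ic : mu.-integrable `[- del, 0] (EFin \o (fun tau => expR (lam * tau) * cut (t + tau) w)).
    apply: continuous_compact_integrable; first exact: segment_compact.
    exact: window_continuous.
  have h : `|cut_avg t w| <= e * Num.sqrt r * del.
    rewrite /cut_avg /delay_average.
    apply: le_trans; first by apply: le_normr_Rintegral ic.
    apply: (@le_trans _ _ (\int[mu]_(x in `[- del, 0]) (e * Num.sqrt r))); last first.
      rewrite Rintegral_cst//= lebesgue_measure_itv/= lte_fin.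
      case: ltP => _; last by rewrite mulr0 mulr_ge0// mulr_ge0// ?sqrtr_ge0// expR_ge0.
      by rewrite -EFinD/= opprK add0r.
    apply: le_Rintegral => //.
    + exact: integrable_norm.
    + apply: continuous_compact_integrable; first exact: segment_compact.
      by apply: continuous_subspaceT => ?; exact: cvg_cst.
    + move=> tau; rewrite /= in_itv/= => /andP[dtau tau0].
      rewrite normrM ger0_norm ?expR_ge0//; apply: ler_pM => //.
        rewrite ler_expR (le_trans (ler_norm _))// normrM ler_wpM2l//.
        by rewrite ler0_norm// lerNl.
      apply: cS; first by rewrite (le_trans dtau)// lerDr.
      by rewrite (le_trans _ tT)// gerDl.
  have h2 : cut_avg t w ^+ 2 <= (e * Num.sqrt r * del) ^+ 2.
    rewrite -[leLHS]real_normK ?num_real// lerXn2r// nnegrE.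
    by rewrite mulr_ge0// mulr_ge0 ?sqrtr_ge0// expR_ge0.
  apply: le_trans h2 _; rewrite mulrAC exprMn sqr_sqrtr// ler_wpM2r//.
  by rewrite /K lerDl.
Qed.

End delayed_processes.

Section square_integrable_ito_processes.
Context (R : realType) (d : measure_display) (Omega : measurableType d)
  (P : probability Omega R) (W : R -> Omega -> R)
  (hW : brownian_motion P W).
Local Notation Fm := (filtration_measurable P W).
Local Notation mu := (@lebesgue_measure R).
Local Notation m := (mu \x P)%E.
Local Notation TO := (measurableTypeR R * Omega)%type.

Lemma ae_of_full (A : set Omega) (Q : Omega -> Prop) : measurable A ->
  P (~` A) = 0%E -> (forall w, A w -> Q w) -> {ae P, forall w, Q w}.
Proof.
move=> mA PA AQ; exists (~` A); split => //; first exact: measurableC.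
by move=> w /= nQ Aw; apply: nQ; exact: AQ.
Qed.

Lemma Fm_cst t (r : R) : Fm t (fun _ : Omega => r).
Proof. exact: measurable_cst. Qed.

(** The step process with the single value 0 is an exact approximation. *)
Lemma ito_integral0 (T : R) : 0 <= T ->
  ito_integral P W T (fun _ _ => 0) (fun _ _ => 0).
Proof.
move=> T0; pose S := StepProcess 1 (fun i => if i is 0%N then 0 else T)
  (fun _ (_ : Omega) => 0 : R).
have S0 t w : step_fun S t w = 0.
  by rewrite /step_fun; apply: big1 => i _; rewrite mul0r.
split.
- split; first by split => [|t _]; [exact: measurable_cst|exact: Fm_cst].
  rewrite /sqnorm (eq_integral (cst 0%E)) ?integral0 ?ltry// => w _.
  by rewrite (eq_integral (cst 0%E)) ?integral0// => s _; rewrite expr0n.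
- by move=> t _; exact: measurable_cst.
exists (fun=> S); split.
- move=> n; split => //=; first by case.
  + by move=> i _; exact: Fm_cst.
  + by exists 0 => i w _; rewrite normr0.
- rewrite [X in X @ _ --> _](_ : _ = fun=> 0%E); first exact: cvg_cst.
  apply/funext => n; rewrite /sqnorm (eq_integral (cst 0%E)) ?integral0// => w _.
  by rewrite (eq_integral (cst 0%E)) ?integral0// => s _; rewrite S0 subrr expr0n.
- move=> t _; rewrite [X in X @ _ --> _](_ : _ = fun=> 0%E); first exact: cvg_cst.
  apply/funext => n; rewrite (eq_integral (cst 0%E)) ?integral0// => w _.
  by rewrite /step_integral big1 ?subrr ?expr0n// => i _; rewrite mul0r.
Qed.

(** The drift may be replaced by one that agrees with it on a set of full
    measure and is known to be square-integrable. *)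
Lemma sq_ito_of_process (T a0 : R) (A : set Omega) X a a' c :
  a0 <= 0 -> 0 <= T -> measurable A -> P (~` A) = 0%E ->
  S2_process P W a0 T X -> ito_process P W T X a' c ->
  sq_int m (cyl `[0, T]) (lift a) ->
  (forall w, A w -> forall s, s \in `[0, T] -> a s w = a' s w) ->
  sq_ito P W T X a c.
Proof.
move=> a00 T0 mA PA hX [_ [I hI hE]] a2 aa'.
have hM := S2_process_second_moment hW a00 T0 hX.
case: hX => -[mX FX] cX _; split => //.
- exists I => // t tT.
  have := @ae_of_full A (fun w => A w) mA PA (fun _ h => h).
  apply: filterS2 (hE t tT) => w -> Aw; congr (_ + _ + _).
  apply: eq_Rintegral => s; rewrite inE/= in_itv/= => /andP[s0 st].
  by rewrite aa'// in_itv/= s0 (le_trans st)//; move: tT; rewrite in_itv/= => /andP[].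
Qed.

Section delay.
Variables (T del lam : R) (X phi : R -> Omega -> R) (A : set Omega).
Hypotheses (T0 : 0 <= T) (del0 : 0 <= del)
  (hX : S2_process P W (- del) T X)
  (mA : measurable A) (PA : P (~` A) = 0%E)
  (XA : forall w, A w -> forall t, t \in `[- del, 0] -> X t w = phi t w)
  (Fphi : forall t, t \in `[- del, 0] -> Fm 0 (phi t)).

Lemma cut_avg_sq_int : sq_int m (cyl `[0, T]) (lift (cut_avg del lam X A)).
Proof.
have [M [_ hM]] := cut_bound hW lam T0 del0 hX mA PA XA Fphi.
exact: bounded_sq_int_lift (cut_avg_measurable hW lam T0 del0 hX mA PA XA Fphi) hM.
Qed.

Lemma cut_delay_sq_int : sq_int m (cyl `[0, T]) (lift (cut_delay del X A)).
Proof.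
have [M [hM _]] := cut_bound hW lam T0 del0 hX mA PA XA Fphi.
apply: (bounded_sq_int_lift (M := M)) (cut_delay_measurable hW T0 del0 hX mA PA XA Fphi) _.
move=> t; rewrite in_itv/= => /andP[t0 tT]; apply: hM.
  by rewrite lerBrDr addNr.
by rewrite (le_trans _ tT)// gerBl.
Qed.

Lemma cut_sq_int : sq_int m (cyl `[0, T]) (lift (cut X A)).
Proof.
have [M [hM _]] := cut_bound hW lam T0 del0 hX mA PA XA Fphi.
apply: (bounded_sq_int_lift (M := M)).
  apply: measurable_process => [t|w].
    rewrite in_itv/= => /andP[t0 tT].
    apply: (cut_measurable hW T0 hX mA PA XA Fphi) => //.
    by rewrite (le_trans _ t0)// oppr_le0.
  have := @cut_continuous _ _ _ _ _ _ _ _ A hX w.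
  apply: continuous_subspaceW => t; rewrite /= !in_itv/= => /andP[t0 ->].
  by rewrite (le_trans _ t0)// oppr_le0.
move=> t; rewrite in_itv/= => /andP[t0 tT]; apply: hM => //.
by rewrite (le_trans _ t0)// oppr_le0.
Qed.

Lemma cut_avg_sq_ito : sq_ito P W T (cut_avg del lam X A)
  (fun s w => cut X A s w - lam * cut_avg del lam X A s w
    - expR (- (lam * del)) * cut_delay del X A s w) (fun _ _ => 0).
Proof.
have [M [_ hM]] := cut_bound hW lam T0 del0 hX mA PA XA Fphi.
have mcT : measurable (cyl `[0, T] : set TO).
  by apply: measurable_cyl; exact: measurable_itv.
split.
- exact: (cut_avg_measurable hW lam T0 del0 hX mA PA XA Fphi).
- move=> t; rewrite in_itv/= => /andP[t0 tT].
  exact: (cut_avg_Fm lam hX mA PA XA Fphi).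
- by exists M.
- apply: sq_intB => //; last by apply: sq_intZ => //; exact: cut_delay_sq_int.
  by apply: sq_intB => //; [exact: cut_sq_int|apply: sq_intZ => //; exact: cut_avg_sq_int].
- exists (fun _ _ => 0); first exact: ito_integral0.
  move=> t; rewrite in_itv/= => /andP[t0 tT].
  apply: nearW => w; rewrite addr0.
  exact: (delay_average_ode lam del0 T0 (@cut_continuous _ _ _ _ _ _ _ _ A hX w)).
Qed.

End delay.

End square_integrable_ito_processes.

(** * Regular coefficients and their partial derivatives *)

Lemma continuous_pair_fun (A B C : topologicalType) (f : A -> B) (g : A -> C) :
  continuous f -> continuous g -> continuous (fun x => (f x, g x)).
Proof. by move=> cf cg x; exact: (cvg_pair (cf x) (cg x)). Qed.

Lemma continuous_cst_fun (A B : topologicalType) (c : B) :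
  continuous (fun _ : A => c).
Proof. by move=> x; exact: cvg_cst. Qed.

Lemma continuous_id_fun (A : topologicalType) : continuous (fun x : A => x).
Proof. by move=> x; exact: cvg_id. Qed.

(** Multiplying the difference quotients by [k] allows the direction [k = 0]. *)
Lemma cvg_quotient (R : realType) (f : R -> R) x k : derivable f x 1 ->
  n.+1%:R * (f (x + k / n.+1%:R) - f x) @[n --> \oo] --> k * derive1 f x.
Proof.
move=> df; rewrite derive1E; have [->|k0] := eqVneq k 0.
  rewrite mul0r [X in X @ _ --> _](_ : _ = fun=> 0); first exact: cvg_cst.
  by apply/funext => n; rewrite mul0r addr0 subrr mulr0.
have h : (k / n.+1%:R : R) @[n --> \oo] --> (0 : R)^'.
  move=> A hA; have : \forall n \near \oo, k / n.+1%:R != 0 :> R -> A (k / n.+1%:R).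
    have : (k / n.+1%:R : R) @[n --> \oo] --> k * 0.
      by apply: cvgMr; exact: cvg_harmonic.
    by rewrite mulr0 => /(_ _ hA).
  by apply: filterS => n; apply; rewrite mulf_neq0.
rewrite [X in X @ _ --> _](_ : _ = (fun n => k *
    ((k / n.+1%:R)^-1 *: (f (k / n.+1%:R *: 1 + x) - f x)))).
  by apply: cvgMr; exact: (cvg_comp _ _ h df).
apply/funext => n; rewrite /GRing.scale/= mulr1 (addrC x).
have : n.+1%:R != 0 :> R by rewrite pnatr_eq0.
by move: (n.+1%:R : R) => N N0; field; rewrite k0 N0.
Qed.

Section difference_quotients.
Context (R : realType).

Lemma derive1_cvg_quotient (f : R -> R) x : derivable f x 1 ->
  n.+1%:R * (f (x + n.+1%:R^-1) - f x) @[n --> \oo] --> derive1 f x.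
Proof.
move=> /(@cvg_quotient _ _ _ 1); rewrite mul1r.
by under eq_fun do rewrite div1r.
Qed.

Lemma derive1_lipschitz (f : R -> R) (C : R) x : derivable f x 1 ->
  (forall v v', `|f v - f v'| <= C * `|v - v'|) -> `|derive1 f x| <= C.
Proof.
move=> df hf; have := derive1_cvg_quotient df.
move=> /cvg_norm h; apply: (cvgr_to_le h); apply: nearW => n /=.
have n0 : 0 < n.+1%:R :> R by [].
rewrite normrM ger0_norm ?(ltW n0)// -ler_pdivlMl//.
by apply: le_trans (hf _ _) _; rewrite addrC addKr ger0_norm ?invr_ge0 ?(ltW n0)// mulrC.
Qed.

(** A derivative is a limit of difference quotients along the fixed steps
    [1 / n]. *)
Lemma derive1_measurable (e : measure_display) (S : measurableType e) (D : set S)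
    (F : S -> R -> R) (h : S -> R) :
  (forall c, measurable_fun D (fun z => F z (h z + c))) ->
  (forall z, D z -> derivable (F z) (h z) 1) ->
  measurable_fun D (fun z => derive1 (F z) (h z)).
Proof.
move=> mF dF; apply: (@measurable_fun_cvg _ _ _ _ (fun n z => n.+1%:R *
  (F z (h z + n.+1%:R^-1) - F z (h z)))) => [n|z Dz].
  apply: measurable_funM; first exact: measurable_cst.
  apply: measurable_funB => //.
  by have := mF 0; under eq_fun do rewrite addr0.
exact: derive1_cvg_quotient (dF z Dz).
Qed.

End difference_quotients.

Section regular_coefficients.
Context (R : realType) (d : measure_display) (Omega : measurableType d).
Local Notation TO := (measurableTypeR R * Omega)%type.
Variables (T : R) (U : set R).

(** What the drift, the diffusion and the generator have in common. *)
Record regular_coef (G : R -> Omega -> coef R) : Prop := {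
  regular_measurable : forall t x x1 x2 y z u, t \in `[0, T] -> U u ->
    measurable_fun setT (fun w => G t w x x1 x2 y z u);
  regular_continuous : forall w,
    {within [set v : R * (R * R * R * R * R * R) | v.1 \in `[0, T] /\ dom6 U v.2],
      continuous (fun v => uncurry6 (G v.1 w) v.2)};
  regular_derivable : forall t w x x1 x2 y z u, t \in `[0, T] -> U u ->
    [/\ derivable (fun v => G t w v x1 x2 y z u) x 1,
        derivable (fun v => G t w x v x2 y z u) x1 1 &
        derivable (fun v => G t w x x1 v y z u) x2 1] /\
    [/\ derivable (fun v => G t w x x1 x2 v z u) y 1,
        derivable (fun v => G t w x x1 x2 y v u) z 1 &
        derivable_within U (G t w x x1 x2 y z) u];
  regular_lipschitz : exists C, forall t w u x x1 x2 y z x' x1' x2' y' z',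
    t \in `[0, T] -> U u ->
    `|G t w x x1 x2 y z u - G t w x' x1' x2' y' z' u|
      <= C * (`|x - x'| + `|x1 - x1'| + `|x2 - x2'| + `|y - y'| + `|z - z'|);
  regular_growth : exists C, forall t w u x x1 x2, t \in `[0, T] -> U u ->
    `|G t w x x1 x2 0 0 u| <= C * (1 + `|x| + `|x1| + `|x2|)
}.

Section one_coefficient.
Variables (G : R -> Omega -> coef R) (hG : regular_coef G).

Local Notation dom7 := [set v : R * (R * R * R * R * R * R) |
  v.1 \in `[0, T] /\ dom6 U v.2].

Let slice (D : set R) (w : Omega) (h : R -> R * (R * R * R * R * R * R)) :
  continuous h -> (forall r, D r -> dom7 (h r)) ->
  {within D, continuous (fun r => uncurry6 (G (h r).1 w) (h r).2)}.
Proof.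
move=> ch hD.
exact: (@continuous_within_comp _ _ _ D _ h _ (@regular_continuous _ hG w) ch hD).
Qed.

Ltac pair_continuous := repeat first
  [exact: continuous_cst_fun | exact: continuous_id_fun | apply: continuous_pair_fun].

(** Caratheodory's argument replaces the constant arguments by processes, one
    coordinate after the other. *)
Lemma at_state_measurable (X X1 X2 Y Z u : TO -> R) :
  measurable_fun (cyl `[0, T]) X -> measurable_fun (cyl `[0, T]) X1 ->
  measurable_fun (cyl `[0, T]) X2 -> measurable_fun (cyl `[0, T]) Y ->
  measurable_fun (cyl `[0, T]) Z -> measurable_fun (cyl `[0, T]) u ->
  (forall z, cyl `[0, T] z -> U (u z)) ->
  measurable_fun (cyl `[0, T])
    (fun z => G z.1 z.2 (X z) (X1 z) (X2 z) (Y z) (Z z) (u z)).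
Proof.
move=> mX mX1 mX2 mY mZ mu hu.
have mD : measurable (cyl `[0, T] : set TO).
  by apply: measurable_cyl; exact: measurable_itv.
have m0 x x1 x2 y z v : U v ->
    measurable_fun (cyl `[0, T]) (fun q : TO => G q.1 q.2 x x1 x2 y z v).
  move=> Uv; apply: (@measurable_caratheodory R _ TO _ `[0, T]%classic
    (fun q t => G t q.2 x x1 x2 y z v) (fun q => q.1)) => //.
  - move=> t tT; apply: measurable_funTS.
    exact: measurableT_comp (regular_measurable hG x x1 x2 y z tT Uv) measurable_snd.
  - move=> q _; apply: (@slice _ q.2 (fun t => (t, (x, x1, x2, y, z, v)))) => //.
    by pair_continuous.
  - by apply: measurable_funTS; exact: measurable_fst.
  - by move=> q [].
have m1 x1 x2 y z v : U v ->
    measurable_fun (cyl `[0, T]) (fun q : TO => G q.1 q.2 (X q) x1 x2 y z v).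
  move=> Uv; apply: (@measurable_caratheodory R _ TO _ setT
    (fun q x => G q.1 q.2 x x1 x2 y z v) X) => //.
  - by move=> r _; exact: m0.
  - move=> q [qT _]; apply: (@slice _ q.2 (fun x => (q.1, (x, x1, x2, y, z, v)))) => //.
    by pair_continuous.
have m2 x2 y z v : U v ->
    measurable_fun (cyl `[0, T]) (fun q : TO => G q.1 q.2 (X q) (X1 q) x2 y z v).
  move=> Uv; apply: (@measurable_caratheodory R _ TO _ setT
    (fun q x1 => G q.1 q.2 (X q) x1 x2 y z v) X1) => //.
  - by move=> r _; exact: m1.
  - move=> q [qT _]; apply: (@slice _ q.2 (fun x1 => (q.1, (X q, x1, x2, y, z, v)))) => //.
    by pair_continuous.
have m3 y z v : U v ->
    measurable_fun (cyl `[0, T]) (fun q : TO => G q.1 q.2 (X q) (X1 q) (X2 q) y z v).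
  move=> Uv; apply: (@measurable_caratheodory R _ TO _ setT
    (fun q x2 => G q.1 q.2 (X q) (X1 q) x2 y z v) X2) => //.
  - by move=> r _; exact: m2.
  - move=> q [qT _]; apply: (@slice _ q.2 (fun x2 => (q.1, (X q, X1 q, x2, y, z, v)))) => //.
    by pair_continuous.
have m4 z v : U v ->
    measurable_fun (cyl `[0, T]) (fun q : TO => G q.1 q.2 (X q) (X1 q) (X2 q) (Y q) z v).
  move=> Uv; apply: (@measurable_caratheodory R _ TO _ setT
    (fun q y => G q.1 q.2 (X q) (X1 q) (X2 q) y z v) Y) => //.
  - by move=> r _; exact: m3.
  - move=> q [qT _]; apply: (@slice _ q.2 (fun y => (q.1, (X q, X1 q, X2 q, y, z, v)))) => //.
    by pair_continuous.
have m5 v : U v ->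
    measurable_fun (cyl `[0, T]) (fun q : TO => G q.1 q.2 (X q) (X1 q) (X2 q) (Y q) (Z q) v).
  move=> Uv; apply: (@measurable_caratheodory R _ TO _ setT
    (fun q z => G q.1 q.2 (X q) (X1 q) (X2 q) (Y q) z v) Z) => //.
  - by move=> r _; exact: m4.
  - move=> q [qT _]; apply: (@slice _ q.2 (fun z => (q.1, (X q, X1 q, X2 q, Y q, z, v)))) => //.
    by pair_continuous.
apply: (@measurable_caratheodory R _ TO _ U
    (fun q v => G q.1 q.2 (X q) (X1 q) (X2 q) (Y q) (Z q) v) u) => //.
move=> q [qT _]; apply: (@slice _ q.2 (fun v => (q.1, (X q, X1 q, X2 q, Y q, Z q, v)))) => //.
by pair_continuous.
Qed.

End one_coefficient.
End regular_coefficients.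

Section regular_partials.
Context (R : realType) (d : measure_display) (Omega : measurableType d).
Local Notation TO := (measurableTypeR R * Omega)%type.
Variables (T : R) (U : set R) (G : R -> Omega -> coef R).
Hypothesis hG : regular_coef T U G.

Section measurability.
Variables X X1 X2 Y Z u : TO -> R.
Hypotheses (mX : measurable_fun (cyl `[0, T]) X)
  (mX1 : measurable_fun (cyl `[0, T]) X1) (mX2 : measurable_fun (cyl `[0, T]) X2)
  (mY : measurable_fun (cyl `[0, T]) Y) (mZ : measurable_fun (cyl `[0, T]) Z)
  (m_u : measurable_fun (cyl `[0, T]) u)
  (hu : forall z, cyl `[0, T] z -> U (u z)).

Lemma partial_x_measurable : measurable_fun (cyl `[0, T])
  (fun q : TO => partial_x (G q.1 q.2) (X q) (X1 q) (X2 q) (Y q) (Z q) (u q)).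
Proof.
apply: (derive1_measurable (F := fun q v => G q.1 q.2 v (X1 q) (X2 q) (Y q) (Z q) (u q))) => [c|q qD].
  by apply: (at_state_measurable hG) => //; exact: measurable_funD.
by have [[h _ _] _] := regular_derivable hG q.2 (X q) (X1 q) (X2 q) (Y q) (Z q) qD.1 (hu qD).
Qed.

Lemma partial_x1_measurable : measurable_fun (cyl `[0, T])
  (fun q : TO => partial_x1 (G q.1 q.2) (X q) (X1 q) (X2 q) (Y q) (Z q) (u q)).
Proof.
apply: (derive1_measurable (F := fun q v => G q.1 q.2 (X q) v (X2 q) (Y q) (Z q) (u q))) => [c|q qD].
  by apply: (at_state_measurable hG) => //; exact: measurable_funD.
by have [[_ h _] _] := regular_derivable hG q.2 (X q) (X1 q) (X2 q) (Y q) (Z q) qD.1 (hu qD).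
Qed.

Lemma partial_x2_measurable : measurable_fun (cyl `[0, T])
  (fun q : TO => partial_x2 (G q.1 q.2) (X q) (X1 q) (X2 q) (Y q) (Z q) (u q)).
Proof.
apply: (derive1_measurable (F := fun q v => G q.1 q.2 (X q) (X1 q) v (Y q) (Z q) (u q))) => [c|q qD].
  by apply: (at_state_measurable hG) => //; exact: measurable_funD.
by have [[_ _ h] _] := regular_derivable hG q.2 (X q) (X1 q) (X2 q) (Y q) (Z q) qD.1 (hu qD).
Qed.

Lemma partial_y_measurable : measurable_fun (cyl `[0, T])
  (fun q : TO => partial_y (G q.1 q.2) (X q) (X1 q) (X2 q) (Y q) (Z q) (u q)).
Proof.
apply: (derive1_measurable (F := fun q v => G q.1 q.2 (X q) (X1 q) (X2 q) v (Z q) (u q))) => [c|q qD].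
  by apply: (at_state_measurable hG) => //; exact: measurable_funD.
by have [_ [h _ _]] := regular_derivable hG q.2 (X q) (X1 q) (X2 q) (Y q) (Z q) qD.1 (hu qD).
Qed.

End measurability.

(** The Lipschitz constant bounds the derivatives. *)
Lemma partial_bound : exists2 C, 0 <= C & forall t w x x1 x2 y z u,
  t \in `[0, T] -> U u ->
  [/\ `|partial_x (G t w) x x1 x2 y z u| <= C,
      `|partial_x1 (G t w) x x1 x2 y z u| <= C,
      `|partial_x2 (G t w) x x1 x2 y z u| <= C &
      `|partial_y (G t w) x x1 x2 y z u| <= C].
Proof.
have [C hC] := regular_lipschitz hG; exists `|C| => // t w x x1 x2 y z u tT Uu.
have hC' x' x1' x2' y' z' x'' x1'' x2'' y'' z'' :
  `|G t w x' x1' x2' y' z' u - G t w x'' x1'' x2'' y'' z'' u| <=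
  `|C| * (`|x' - x''| + `|x1' - x1''| + `|x2' - x2''| + `|y' - y''| + `|z' - z''|).
  apply: le_trans (hC t w u _ _ _ _ _ _ _ _ _ _ tT Uu) _.
  by rewrite ler_wpM2r ?ler_norm// !addr_ge0.
have [[h1 h2 h3] [h4 _ _]] := regular_derivable hG w x x1 x2 y z tT Uu.
have k1 v v' : `|G t w v x1 x2 y z u - G t w v' x1 x2 y z u| <= `|C| * `|v - v'|.
  apply: le_trans (hC' _ _ _ _ _ _ _ _ _ _) _.
  by rewrite !subrr !normr0 !(add0r, addr0).
have k2 v v' : `|G t w x v x2 y z u - G t w x v' x2 y z u| <= `|C| * `|v - v'|.
  apply: le_trans (hC' _ _ _ _ _ _ _ _ _ _) _.
  by rewrite !subrr !normr0 !(add0r, addr0).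
have k3 v v' : `|G t w x x1 v y z u - G t w x x1 v' y z u| <= `|C| * `|v - v'|.
  apply: le_trans (hC' _ _ _ _ _ _ _ _ _ _) _.
  by rewrite !subrr !normr0 !(add0r, addr0).
have k4 v v' : `|G t w x x1 x2 v z u - G t w x x1 x2 v' z u| <= `|C| * `|v - v'|.
  apply: le_trans (hC' _ _ _ _ _ _ _ _ _ _) _.
  by rewrite !subrr !normr0 !(add0r, addr0).
split; [exact: derive1_lipschitz h1 k1|exact: derive1_lipschitz h2 k2|
  exact: derive1_lipschitz h3 k3|exact: derive1_lipschitz h4 k4].
Qed.

Lemma growth_bound : exists2 C, 0 <= C & forall t w x x1 x2 y z u,
  t \in `[0, T] -> U u ->
  `|G t w x x1 x2 y z u| <= C * (1 + `|x| + `|x1| + `|x2| + `|y| + `|z|).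
Proof.
have [C hC] := regular_lipschitz hG; have [C' hC'] := regular_growth hG.
exists (`|C| + `|C'|) => [|t w x x1 x2 y z u tT Uu]; first exact: addr_ge0.
have h1 := hC t w u x x1 x2 y z x x1 x2 0 0 tT Uu.
have h2 := hC' t w u x x1 x2 tT Uu.
rewrite !subrr !normr0 !add0r !subr0 in h1.
rewrite -[G t w x x1 x2 y z u](subrK (G t w x x1 x2 0 0 u)).
apply: le_trans (ler_normD _ _) _; rewrite mulrDl; apply: lerD.
  apply: le_trans h1 _.
  apply: (@le_trans _ _ (`|C| * (`|y| + `|z|))).
    by rewrite ler_wpM2r ?ler_norm// addr_ge0.
  by rewrite ler_wpM2l// -[leRHS]addrA lerDr !addr_ge0.
apply: le_trans h2 _.
apply: (@le_trans _ _ (`|C'| * (1 + `|x| + `|x1| + `|x2|))).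
  by rewrite ler_wpM2r ?ler_norm// !addr_ge0.
by rewrite ler_wpM2l// -[leRHS]addrA lerDl addr_ge0.
Qed.

End regular_partials.

Section standing_regularity.
Context (R : realType) (d : measure_display) (Omega : measurableType d)
  (P : probability Omega R) (W : R -> Omega -> R)
  (hW : brownian_motion P W)
  (cp : control_problem R Omega) (hcp : standing_assumptions P W cp).

Lemma f_regular : regular_coef (T cp) (U cp) (f cp).
Proof.
split.
- move=> t x x1 x2 y z u tT Uu; apply: (Fm_measurable hW (t := t)).
  exact: (sa_f_measurable hcp).
- exact: (sa_f_continuous hcp).
- move=> t w x x1 x2 y z u tT Uu.
  have [_ _ [h _ _]] := sa_C1 hcp w tT.
  exact: h.
- exact: (sa_f_lipschitz hcp).
- have [C hC] := sa_f_phi_growth hcp; exists C => t w u x x1 x2 tT Uu.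
  by apply: le_trans (hC t w u x x1 x2 tT Uu); rewrite lerDl.
Qed.

(** Embeds functions of (t, x, x1, x2, u) into functions of all the
    coordinates. *)
Let forget (v : R * (R * R * R * R * R * R)) : R * R * R * R * R :=
  (v.1, v.2.1.1.1.1.1, v.2.1.1.1.1.2, v.2.1.1.1.2, v.2.2).

Let forget_continuous : continuous forget.
Proof.
have c1 : continuous (fun v : R * (R * R * R * R * R * R) => v.1) by move=> v; exact: cvg_fst.
have f (A B C : topologicalType) (g : A -> B * C) : continuous g -> continuous (fun v => (g v).1).
  by move=> cg v; apply: (cvg_comp g) (cg v) _; exact: cvg_fst.
have s (A B C : topologicalType) (g : A -> B * C) : continuous g -> continuous (fun v => (g v).2).
  by move=> cg v; apply: (cvg_comp g) (cg v) _; exact: cvg_snd.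
have id2 : continuous (fun v : R * (R * R * R * R * R * R) => v.2) by move=> v; exact: cvg_snd.
have c2 := f _ _ _ _ id2; have c3 := f _ _ _ _ c2; have c4 := f _ _ _ _ c3.
have c5 := f _ _ _ _ c4; have c6 := f _ _ _ _ c5.
have d4 := s _ _ _ _ c4; have d5 := s _ _ _ _ c5; have d3 := s _ _ _ _ c3.
have d1 := s _ _ _ _ id2; have d2 := s _ _ _ _ c2.
apply: continuous_pair_fun; last exact: d1.
apply: continuous_pair_fun; last exact: d4.
apply: continuous_pair_fun; last exact: d5.
by apply: continuous_pair_fun; [exact: c1|exact: c6].
Qed.

Let forward_regular (g : R -> R -> R -> R -> R -> R) :
  {within [set v : R * R * R * R * R | v.1.1.1.1 \in `[0, T cp] /\ U cp v.2],
    continuous (fun v => g v.1.1.1.1 v.1.1.1.2 v.1.1.2 v.1.2 v.2)} ->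
  (exists C, forall t u x x1 x2 x' x1' x2', t \in `[0, T cp] -> U cp u ->
    `|g t x x1 x2 u - g t x' x1' x2' u|
      <= C * (`|x - x'| + `|x1 - x1'| + `|x2 - x2'|)) ->
  (exists C, forall t u x x1 x2, t \in `[0, T cp] -> U cp u ->
    `|g t x x1 x2 u| <= C * (1 + `|x| + `|x1| + `|x2|)) ->
  (forall t, Omega -> t \in `[0, T cp] ->
    C1 (U cp) (fun x x1 x2 _ _ u => g t x x1 x2 u)) ->
  regular_coef (T cp) (U cp)
    (fun t (_ : Omega) x x1 x2 _ _ u => g t x x1 x2 u).
Proof.
move=> cg [C hC] [C' hC'] dg; split.
- by move=> t x x1 x2 y z u tT Uu; exact: measurable_cst.
- move=> w.
  have := @continuous_within_comp _ _ _
    [set v : R * (R * R * R * R * R * R) | v.1 \in `[0, T cp] /\ dom6 (U cp) v.2]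
    _ forget _ cg forget_continuous.
  rewrite (_ : (fun v => _) = (fun v => g v.1 v.2.1.1.1.1.1 v.2.1.1.1.1.2 v.2.1.1.1.2 v.2.2)).
    by apply; move=> v.
  by apply/funext => -[t [[[[[x x1] x2] y] z] u]].
- by move=> t w x x1 x2 y z u tT Uu; have [h _ _] := dg t w tT; exact: h.
- exists `|C| => t w u x x1 x2 y z x' x1' x2' y' z' tT Uu.
  apply: le_trans (hC t u x x1 x2 x' x1' x2' tT Uu) _.
  apply: (@le_trans _ _ (`|C| * (`|x - x'| + `|x1 - x1'| + `|x2 - x2'|))).
    by rewrite ler_wpM2r ?ler_norm// !addr_ge0.
  by rewrite ler_wpM2l// -[leRHS]addrA lerDl addr_ge0.
- by exists C' => t w u x x1 x2; exact: hC'.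
Qed.

Lemma b_regular : regular_coef (T cp) (U cp) (b_coef cp).
Proof.
have [C hC] := sa_b_sigma_lipschitz hcp; have [C' hC'] := sa_b_sigma_growth hcp.
apply: (forward_regular (sa_b_continuous hcp)).
- exists C => t u x x1 x2 x' x1' x2' tT Uu.
  by apply: le_trans (hC t u x x1 x2 x' x1' x2' tT Uu); rewrite lerDl.
- exists C' => t u x x1 x2 tT Uu.
  by apply: le_trans (hC' t u x x1 x2 tT Uu); rewrite lerDl.
- by move=> t w tT; have [h _ _] := sa_C1 hcp w tT.
Qed.

Lemma sigma_regular : regular_coef (T cp) (U cp) (sigma_coef cp).
Proof.
have [C hC] := sa_b_sigma_lipschitz hcp; have [C' hC'] := sa_b_sigma_growth hcp.
apply: (forward_regular (sa_sigma_continuous hcp)).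
- exists C => t u x x1 x2 x' x1' x2' tT Uu.
  by apply: le_trans (hC t u x x1 x2 x' x1' x2' tT Uu); rewrite lerDr.
- exists C' => t u x x1 x2 tT Uu.
  by apply: le_trans (hC' t u x x1 x2 tT Uu); rewrite lerDr.
- by move=> t w tT; have [_ h _] := sa_C1 hcp w tT.
Qed.

End standing_regularity.

(** * The gradient inequality *)

Lemma cvg_quotient_within (R : realType) (U : set R) (f : R -> R) x k :
  (forall n : nat, U (x + k / n.+1%:R)) -> (k != 0 -> derivable_within U f x) ->
  n.+1%:R * (f (x + k / n.+1%:R) - f x) @[n --> \oo] --> k * derive_within U f x.
Proof.
move=> Uk df; have [->|k0] := eqVneq k 0.
  rewrite mul0r [X in X @ _ --> _](_ : _ = fun=> 0); first exact: cvg_cst.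
  by apply/funext => n; rewrite mul0r addr0 subrr mulr0.
have h : (x + k / n.+1%:R : R) @[n --> \oo] --> within U x^'.
  move=> A hA.
  have : \forall n \near \oo, x + k / n.+1%:R != x -> U (x + k / n.+1%:R) -> A (x + k / n.+1%:R).
    have : (x + k / n.+1%:R : R) @[n --> \oo] --> x + k * 0.
      by apply: cvgD; [exact: cvg_cst|apply: cvgMr; exact: cvg_harmonic].
    by rewrite mulr0 addr0 => /(_ _ hA).
  apply: filterS => n; apply => //.
  by rewrite -subr_eq0 addrAC subrr add0r mulf_neq0.
rewrite [X in X @ _ --> _](_ : _ = (fun n => k *
    quotients f x (x + k / n.+1%:R))).
  by apply: cvgMr; exact: (cvg_comp _ _ h (df k0)).
apply/funext => n; rewrite /quotients.
have : n.+1%:R != 0 :> R by rewrite pnatr_eq0.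
move: (n.+1%:R : R) => N N0.
by rewrite (_ : x + k / N - x = k / N); [field; rewrite k0 N0|ring].
Qed.

Section gradient_inequality.
Context (R : realType).
Variable U : set R.
Hypothesis cU : @convex_set R R^o U.

Lemma convex_set_segment (u u' t : R) : U u -> U u' ->
  0 <= t -> t <= 1 -> U (u + t * (u' - u)).
Proof.
move=> Uu Uu' t0 t1.
rewrite (_ : u + t * (u' - u) = t * u' + (1 - t) * u); last by ring.
exact: (set_mem (@cU u' u (Itv01 t0 t1) (mem_set Uu') (mem_set Uu))).
Qed.

Variable H : coef R.
Hypothesis cH : convex6 U H.

Lemma convex6_le (t x x1 x2 y z u x' x1' x2' y' z' u' X X1 X2 Y Z V : R) :
  0 <= t -> t <= 1 -> U u -> U u' ->
  X = t * x + (1 - t) * x' -> X1 = t * x1 + (1 - t) * x1' ->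
  X2 = t * x2 + (1 - t) * x2' -> Y = t * y + (1 - t) * y' ->
  Z = t * z + (1 - t) * z' -> V = t * u + (1 - t) * u' ->
  H X X1 X2 Y Z V <= t * H x x1 x2 y z u + (1 - t) * H x' x1' x2' y' z' u'.
Proof.
move=> t0 t1 Uu Uu' -> -> -> -> -> ->.
have := @cH (Itv01 t0 t1) (x, x1, x2, y, z, u) (x', x1', x2', y', z', u').
by apply; rewrite inE.
Qed.

(** By convexity at a midpoint the left-hand side is at most the value at the
    reflected point, with all signs of [a, .., c] changed, which is the average
    of the six points on the right. These move one coordinate each, and so give
    access to the partial derivatives. The control coordinate is not reflected,
    as it might leave [U]. *)
Lemma convex6_increment (x x1 x2 y z u a a1 a2 b c v : R) :
  U u -> U (u + v) ->
  2 * H x x1 x2 y z (u + v / 6) - H (x + a / 6) (x1 + a1 / 6) (x2 + a2 / 6) (y + b / 6) (z + c / 6) (u + v / 6) <=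
  (H (x - a) x1 x2 y z u + H x (x1 - a1) x2 y z u + H x x1 (x2 - a2) y z u +
   H x x1 x2 (y - b) z u + H x x1 x2 y (z - c) u + H x x1 x2 y z (u + v)) / 6.
Proof.
move=> Uu Uv.
have Uv6 : U (u + v / 6).
  rewrite (_ : v / 6 = 6^-1 * ((u + v) - u)); last by ring.
  apply: convex_set_segment => //; lra.
have m2 : H (x - a / 2) (x1 - a1 / 2) x2 y z u <=
   2^-1 * H (x - a) x1 x2 y z u + (1 - 2^-1) * H x (x1 - a1) x2 y z u.
  by apply: convex6_le => //; lra.
have m3 : H (x - a / 3) (x1 - a1 / 3) (x2 - a2 / 3) y z u <=
   3^-1 * H x x1 (x2 - a2) y z u + (1 - 3^-1) * H (x - a / 2) (x1 - a1 / 2) x2 y z u.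
  by apply: convex6_le => //; lra.
have m4 : H (x - a / 4) (x1 - a1 / 4) (x2 - a2 / 4) (y - b / 4) z u <=
   4^-1 * H x x1 x2 (y - b) z u + (1 - 4^-1) * H (x - a / 3) (x1 - a1 / 3) (x2 - a2 / 3) y z u.
  by apply: convex6_le => //; lra.
have m5 : H (x - a / 5) (x1 - a1 / 5) (x2 - a2 / 5) (y - b / 5) (z - c / 5) u <=
   5^-1 * H x x1 x2 y (z - c) u + (1 - 5^-1) * H (x - a / 4) (x1 - a1 / 4) (x2 - a2 / 4) (y - b / 4) z u.
  by apply: convex6_le => //; lra.
have m6 : H (x - a / 6) (x1 - a1 / 6) (x2 - a2 / 6) (y - b / 6) (z - c / 6) (u + v / 6) <=
   6^-1 * H x x1 x2 y z (u + v) + (1 - 6^-1) * H (x - a / 5) (x1 - a1 / 5) (x2 - a2 / 5) (y - b / 5) (z - c / 5) u.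
  by apply: convex6_le => //; lra.
have r : H x x1 x2 y z (u + v / 6) <=
   2^-1 * H (x + a / 6) (x1 + a1 / 6) (x2 + a2 / 6) (y + b / 6) (z + c / 6) (u + v / 6) +
   (1 - 2^-1) * H (x - a / 6) (x1 - a1 / 6) (x2 - a2 / 6) (y - b / 6) (z - c / 6) (u + v / 6).
  by apply: convex6_le => //; lra.
lra.
Qed.

(** A convex function lies above its tangent plane. Along a segment convexity
    compares the slope at the origin with the full increment; the slope in a
    general direction is not assumed to be given by the partial derivatives,
    and is bounded below by them through [convex6_increment] with the steps
    divided by [n]. *)
Lemma convex6_gradient (x x1 x2 y z u x' x1' x2' y' z' u' : R) :
  U u -> U u' ->
  [/\ derivable (fun v => H v x1 x2 y z u) x 1,
      derivable (fun v => H x v x2 y z u) x1 1 &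
      derivable (fun v => H x x1 v y z u) x2 1] ->
  [/\ derivable (fun v => H x x1 x2 v z u) y 1,
      derivable (fun v => H x x1 x2 y v u) z 1 &
      derivable_within U (H x x1 x2 y z) u] ->
  partial_x H x x1 x2 y z u * (x' - x) +
  partial_x1 H x x1 x2 y z u * (x1' - x1) +
  partial_x2 H x x1 x2 y z u * (x2' - x2) +
  partial_y H x x1 x2 y z u * (y' - y) +
  partial_z H x x1 x2 y z u * (z' - z) +
  partial_u U H x x1 x2 y z u * (u' - u) <=
  H x' x1' x2' y' z' u' - H x x1 x2 y z u.
Proof.
move=> Uu Uu' [dx dx1 dx2] [dy dz du].
set a := x' - x; set a1 := x1' - x1; set a2 := x2' - x2.
set b := y' - y; set c := z' - z; set v := u' - u.
set H0 := H x x1 x2 y z u.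
have seg (k : R) : 0 <= k -> k <= 1 -> U (u + k * v) by move=> *; exact: convex_set_segment.
pose N n : R := n.+1%:R.
have N0 n : 0 < N n by rewrite /N.
have N1 n : 1 <= N n by rewrite /N ler1n.
have iN n : 0 <= (N n)^-1 by rewrite invr_ge0 ltW.
have iN1 n : (N n)^-1 <= 1 by rewrite invf_le1.
have t0 n : 0 <= 6^-1 * (N n)^-1 by rewrite mulr_ge0 ?invr_ge0.
have t1 n : 6^-1 * (N n)^-1 <= 1.
  by rewrite mulr_ile1 ?invr_ge0// invf_le1// ler1n.
have cx := cvg_quotient (k := - a) dx.
have cx1 := cvg_quotient (k := - a1) dx1.
have cx2 := cvg_quotient (k := - a2) dx2.
have cy := cvg_quotient (k := - b) dy.
have cz := cvg_quotient (k := - c) dz.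
have U1 n : U (u + v / n.+1%:R).
  by rewrite mulrC; apply: seg; [exact: iN|exact: iN1].
have U6 n : U (u + (v / 6) / n.+1%:R).
  rewrite (_ : v / 6 / n.+1%:R = (6^-1 * (N n)^-1) * v); last by rewrite /N; ring.
  exact: seg.
have cu := @cvg_quotient_within _ U (H x x1 x2 y z) u v U1 (fun=> du).
have cu6 := @cvg_quotient_within _ U (H x x1 x2 y z) u (v / 6) U6 (fun=> du).
pose q n := N n * (H (x + - a / N n) x1 x2 y z u - H0) +
  N n * (H x (x1 + - a1 / N n) x2 y z u - H0) +
  N n * (H x x1 (x2 + - a2 / N n) y z u - H0) +
  N n * (H x x1 x2 (y + - b / N n) z u - H0) +
  N n * (H x x1 x2 y (z + - c / N n) u - H0) +
  N n * (H x x1 x2 y z (u + v / N n) - H0).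
(* the lower bound of [convex6_increment] for steps divided by n, times n *)
pose l n := 2 * (N n * (H x x1 x2 y z (u + v / 6 / N n) - H0)) - 6^-1 * q n.
have cl : l n @[n --> \oo] --> 2 * (v / 6 * partial_u U H x x1 x2 y z u) -
   6^-1 * (- a * partial_x H x x1 x2 y z u + - a1 * partial_x1 H x x1 x2 y z u +
     - a2 * partial_x2 H x x1 x2 y z u + - b * partial_y H x x1 x2 y z u +
     - c * partial_z H x x1 x2 y z u + v * partial_u U H x x1 x2 y z u).
  apply: cvgB; first by apply: cvgMr; exact: cu6.
  apply: cvgMr; apply: cvgD; last exact: cu.
  apply: cvgD; last exact: cz.
  apply: cvgD; last exact: cy.
  apply: cvgD; last exact: cx2.
  apply: cvgD; last exact: cx1.
  exact: cx.
have ub n : l n <= 6^-1 * (H x' x1' x2' y' z' u' - H0).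
  have h := @convex6_increment x x1 x2 y z u (a / N n) (a1 / N n) (a2 / N n) (b / N n) (c / N n) (v / N n) Uu (U1 n).
  have h2 := @convex6_le _ x' x1' x2' y' z' u' x x1 x2 y z u
    (x + a / N n / 6) (x1 + a1 / N n / 6) (x2 + a2 / N n / 6) (y + b / N n / 6)
    (z + c / N n / 6) (u + v / N n / 6) (t0 n) (t1 n) Uu' Uu.
  have {}h2 := h2 ltac:(rewrite /a; ring) ltac:(rewrite /a1; ring) ltac:(rewrite /a2; ring)
    ltac:(rewrite /b; ring) ltac:(rewrite /c; ring) ltac:(rewrite /v; ring).
  have e : v / 6 / N n = v / N n / 6 by ring.
  rewrite /l /q e !mulNr -/H0 in h h2 *.
  move: h h2.
  set h1 := H (x - _) _ _ _ _ _; set h2 := H x (x1 - _) _ _ _ _.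
  set h3 := H x x1 (x2 - _) _ _ _; set h4 := H x x1 x2 (y - _) _ _.
  set h5 := H x x1 x2 y (z - _) _; set h6 := H x x1 x2 y z (u + v / N n).
  set h7 := H x x1 x2 y z (u + v / N n / 6).
  set h8 := H (x + _) _ _ _ _ _; set h9 := H x' _ _ _ _ _.
  move: h1 h2 h3 h4 h5 h6 h7 h8 h9 => {e cl} h1 h2 h3 h4 h5 h6 h7 h8 h9 e1 e2.
  rewrite -(ler_pM2l (N0 n)) in e1; rewrite -(ler_pM2l (N0 n)) in e2.
  have e3 : N n * (6^-1 / N n * h9 + (1 - 6^-1 / N n) * H0) = 6^-1 * (h9 - H0) + N n * H0.
    by field; rewrite gt_eqF.
  rewrite e3 in e2; lra.
have : 2 * (v / 6 * partial_u U H x x1 x2 y z u) -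
   6^-1 * (- a * partial_x H x x1 x2 y z u + - a1 * partial_x1 H x x1 x2 y z u +
     - a2 * partial_x2 H x x1 x2 y z u + - b * partial_y H x x1 x2 y z u +
     - c * partial_z H x x1 x2 y z u + v * partial_u U H x x1 x2 y z u) <=
   6^-1 * (H x' x1' x2' y' z' u' - H0).
  by apply: (cvgr_to_le cl); apply: nearW.
move: (partial_x H _ _ _ _ _ _) (partial_x1 H _ _ _ _ _ _) (partial_x2 H _ _ _ _ _ _)
  (partial_y H _ _ _ _ _ _) (partial_z H _ _ _ _ _ _) (partial_u U H _ _ _ _ _ _)
  (H x' _ _ _ _ _) => g g1 g2 g3 g4 g5 H1.
rewrite ler_pdivlMl// => h; apply: le_trans h.
by rewrite le_eqVlt; apply/orP; left; apply/eqP; field.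
Qed.

End gradient_inequality.

(** * Partial derivatives of the Hamiltonian *)

Section hamiltonian_partials.
Context (R : realType) (d : measure_display) (Omega : measurableType d)
  (P : probability Omega R) (W : R -> Omega -> R)
  (cp : control_problem R Omega) (hcp : standing_assumptions P W cp).
Variables (t : R) (w : Omega) (p1 p2 p3 q k1 k2 : R).
Variables (x x1 x2 y z u : R).
Hypotheses (tT : t \in `[0, T cp]) (Uu : U cp u).
Local Notation H := (hamiltonian cp t w p1 p2 p3 q k1 k2).
Local Notation b := (b_coef cp t w).
Local Notation s := (sigma_coef cp t w).
Local Notation g := (f cp t w).
Local Notation e := (expR (- lambda cp * delta cp)).
Let hb := sa_C1 hcp w tT.

Let is_derive_hamiltonian (B S F L : R -> R) (l v : R) :
  derivable B v 1 -> derivable S v 1 -> derivable F v 1 -> is_derive v 1 L l ->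
  is_derive v 1 (fun v => p1 * B v + p2 * L v + k1 * S v - q * F v)
    (p1 * derive1 B v + p2 * l + k1 * derive1 S v - q * derive1 F v).
Proof.
move=> dB dS dF dL.
have iB : is_derive v 1 B (derive1 B v).
  by split; [exact: dB|rewrite derive1E].
have iS : is_derive v 1 S (derive1 S v).
  by split; [exact: dS|rewrite derive1E].
have iF : is_derive v 1 F (derive1 F v).
  by split; [exact: dF|rewrite derive1E].
by apply: is_derive_eq.
Qed.

Lemma hamiltonian_x : derivable (fun v => H v x1 x2 y z u) x 1 /\
  partial_x H x x1 x2 y z u = p1 * partial_x b x x1 x2 y z u + p2
    + k1 * partial_x s x x1 x2 y z u - q * partial_x g x x1 x2 y z u.
Proof.
case: hb => -[/(_ x x1 x2 y z u Uu) [[h1 _ _] _] _ _] [/(_ x x1 x2 y z u Uu) [[h2 _ _] _] _ _] [/(_ x x1 x2 y z u Uu) [[h3 _ _] _] _ _].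
have hL : is_derive x 1 (fun v : R => v - lambda cp * x1 - e * x2) 1.
  by apply: is_derive_eq; rewrite !oppr0 !addr0.
have [hd hv] := is_derive_hamiltonian h1 h2 h3 hL; split => //.
by rewrite /partial_x derive1E -[X in _ + X + _ - _]mulr1; exact: hv.
Qed.

Lemma hamiltonian_x1 : derivable (fun v => H x v x2 y z u) x1 1 /\
  partial_x1 H x x1 x2 y z u = p1 * partial_x1 b x x1 x2 y z u - p2 * lambda cp
    + k1 * partial_x1 s x x1 x2 y z u - q * partial_x1 g x x1 x2 y z u.
Proof.
case: hb => -[/(_ x x1 x2 y z u Uu) [[_ h1 _] _] _ _] [/(_ x x1 x2 y z u Uu) [[_ h2 _] _] _ _] [/(_ x x1 x2 y z u Uu) [[_ h3 _] _] _ _].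
have hL : is_derive x1 1 (fun v : R => x - lambda cp * v - e * x2) (- lambda cp).
  apply: is_derive_eq; rewrite /GRing.scale/= ?add0r ?mul1r ?mulr1 ?mul1r ?oppr0 ?addr0; exact: erefl.
have [hd hv] := is_derive_hamiltonian h1 h2 h3 hL; split => //.
by rewrite /partial_x1 derive1E -mulrN; exact: hv.
Qed.

Lemma hamiltonian_x2 : derivable (fun v => H x x1 v y z u) x2 1 /\
  partial_x2 H x x1 x2 y z u = p1 * partial_x2 b x x1 x2 y z u - p2 * e
    + k1 * partial_x2 s x x1 x2 y z u - q * partial_x2 g x x1 x2 y z u.
Proof.
case: hb => -[/(_ x x1 x2 y z u Uu) [[_ _ h1] _] _ _] [/(_ x x1 x2 y z u Uu) [[_ _ h2] _] _ _] [/(_ x x1 x2 y z u Uu) [[_ _ h3] _] _ _].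
have hL : is_derive x2 1 (fun v : R => x - lambda cp * x1 - e * v) (- e).
  apply: is_derive_eq; rewrite /GRing.scale/= ?add0r ?mul1r ?mulr1 ?mul1r ?oppr0 ?addr0; exact: erefl.
have [hd hv] := is_derive_hamiltonian h1 h2 h3 hL; split => //.
by rewrite /partial_x2 derive1E -mulrN; exact: hv.
Qed.

Let is_derive_hamiltonian_f (F : R -> R) (c v : R) : derivable F v 1 ->
  is_derive v 1 (fun v => c - q * F v) (- (q * derive1 F v)).
Proof.
move=> dF.
have iF : is_derive v 1 F (derive1 F v).
  by split; [exact: dF|rewrite derive1E].
apply: is_derive_eq; rewrite /GRing.scale/= ?add0r ?mul1r; exact: erefl.
Qed.

Lemma hamiltonian_y : derivable (fun v => H x x1 x2 v z u) y 1 /\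
  partial_y H x x1 x2 y z u = - (q * partial_y g x x1 x2 y z u).
Proof.
case: hb => _ _ [/(_ x x1 x2 y z u Uu) [_ [h3 _ _]] _ _].
have [hd hv] := is_derive_hamiltonian_f (p1 * Defs.b cp t x x1 x2 u
    + p2 * (x - lambda cp * x1 - e * x2) + k1 * sigma cp t x x1 x2 u) h3.
by split => //; rewrite /partial_y derive1E; exact: hv.
Qed.

Lemma hamiltonian_z : derivable (fun v => H x x1 x2 y v u) z 1.
Proof.
case: hb => _ _ [/(_ x x1 x2 y z u Uu) [_ [_ h3 _]] _ _].
by have [] := is_derive_hamiltonian_f (p1 * Defs.b cp t x x1 x2 u
    + p2 * (x - lambda cp * x1 - e * x2) + k1 * sigma cp t x x1 x2 u) h3.
Qed.

Lemma hamiltonian_u : derivable_within (U cp) (H x x1 x2 y z) u.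
Proof.
case: hb => -[/(_ x x1 x2 y z u Uu) [_ [_ _ h1]] _ _] [/(_ x x1 x2 y z u Uu) [_ [_ _ h2]] _ _] [/(_ x x1 x2 y z u Uu) [_ [_ _ h3]] _ _].
rewrite /derivable_within.
rewrite (_ : quotients (H x x1 x2 y z) u = (fun v => p1 * quotients (b x x1 x2 y z) u v
  + k1 * quotients (s x x1 x2 y z) u v - q * quotients (g x x1 x2 y z) u v)); last first.
  by apply/funext => v; rewrite /quotients /hamiltonian /b_coef /sigma_coef; ring.
by apply: is_cvgB; [apply: is_cvgD|]; apply: is_cvgMr.
Qed.

Lemma hamiltonian_derivable :
  [/\ derivable (fun v => H v x1 x2 y z u) x 1,
      derivable (fun v => H x v x2 y z u) x1 1 &
      derivable (fun v => H x x1 v y z u) x2 1] /\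
  [/\ derivable (fun v => H x x1 x2 v z u) y 1,
      derivable (fun v => H x x1 x2 y v u) z 1 &
      derivable_within (U cp) (H x x1 x2 y z) u].
Proof.
split; split; [exact: hamiltonian_x.1|exact: hamiltonian_x1.1|exact: hamiltonian_x2.1|
  exact: hamiltonian_y.1|exact: hamiltonian_z|exact: hamiltonian_u].
Qed.

End hamiltonian_partials.

(** * From countably many times or controls to all of them *)

Section countably_many_conditions.
Context (R : realType) (d : measure_display) (Omega : measurableType d)
  (P : probability Omega R).
Local Notation mu := (@lebesgue_measure R).

Lemma ae_forall_rat (Q : rat -> Omega -> Prop) :
  (forall r, {ae P, forall w, Q r w}) -> {ae P, forall w, forall r, Q r w}.
Proof.
move=> hQ.
have : {ae P, forall w, forall n : nat, if unpickle n is Some r then Q r w else True}.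
  apply: ae_foralln => n; case: unpickle => [r|]; first exact: hQ.
  exact: nearW.
by apply: filterS => w h r; have := h (pickle r); rewrite pickleK.
Qed.

(** The exceptional null set may depend on [v], and [U] is uncountable. Since the
    condition on [v] only compares [v] with [c w], one representative of [U] on
    each side of every rational suffices. *)
Lemma ae_forall_sign (U : set R) (a c : Omega -> R) :
  (forall v, U v -> {ae P, forall w, a w * (c w - v) <= 0}) ->
  {ae P, forall w, forall v, U v -> a w * (c w - v) <= 0}.
Proof.
move=> h.
have hl : {ae P, forall w, forall r : rat, (exists2 v, U v & v < ratr r) ->
    exists v, v < ratr r /\ a w * (c w - v) <= 0}.
  apply: ae_forall_rat => r.
  have [[v Uv vr]|no] := pselect (exists2 v, U v & v < ratr r); last exact: nearW.
  by apply: filterS (h v Uv) => w hw _; exists v.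
have hr : {ae P, forall w, forall r : rat, (exists2 v, U v & ratr r < v) ->
    exists v, ratr r < v /\ a w * (c w - v) <= 0}.
  apply: ae_forall_rat => r.
  have [[v Uv vr]|no] := pselect (exists2 v, U v & ratr r < v); last exact: nearW.
  by apply: filterS (h v Uv) => w hw _; exists v.
apply: filterS2 hl hr => w hl hr v Uv; rewrite leNgt; apply/negP => lt0.
have [cv|vc|cv] := ltgtP (c w) v; last by move: lt0; rewrite cv subrr mulr0 ltxx.
- have [r] := rat_in_itvoo cv; rewrite in_itv/= => /andP[cr rv].
  have [v' [rv' le0]] := hr r (ex_intro2 _ _ v Uv rv).
  by nra.
- have [r] := rat_in_itvoo vc; rewrite in_itv/= => /andP[vr rc].
  have [v' [rv' le0]] := hl r (ex_intro2 _ _ v Uv vr).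
  by nra.
Qed.

Lemma continuous_eq0_of_rat (T : R) (F : R -> R) : 0 < T ->
  {within `[0, T], continuous F} ->
  (forall r : rat, ratr r \in `[0, T] -> F (ratr r) = 0) ->
  forall t, t \in `[0, T] -> F t = 0.
Proof.
move=> T0 cF F0 t tT; apply/eqP; apply: contrapT => /negP Ft.
have /subspace_continuousP/(_ t tT) cFt := cF.
have : \forall y \near nbhs t, `[0, T]%classic y -> F y != 0.
  have : nbhs (F t) [set y : R | y != 0].
    by apply: open_nbhs_nbhs; split; [exact: open_neq|exact: Ft].
  by move=> /cFt.
case => e /= e0 he.
move: (tT); rewrite in_itv/= => /andP[t0 tT'].
have lt : Num.max 0 (t - e) < Num.min T (t + e).
  by rewrite gt_max !lt_min T0/=; apply/and3P; split; lra.
have [r] := rat_in_itvoo lt.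
rewrite in_itv/= gt_max lt_min => /andP[/andP[r0 tr] /andP[rT rt]].
have rT' : ratr r \in `[0, T] by rewrite in_itv/= !ltW.
have := he (ratr r); rewrite (F0 r rT') eqxx => /(_ _ rT'); apply: contraPP => _ h.
suff : false by []; apply: h.
by rewrite /ball/= ltr_distl; lra.
Qed.

Variables (W : R -> Omega -> R).
Hypothesis hW : brownian_motion P W.

(** The martingale part is constant by the isometry, so the primitive of the
    drift vanishes at all rational times outside a single null set, hence at
    all times by continuity. *)
Lemma ito_process_drift_eq0 (T : R) (X a : R -> Omega -> R) : 0 < T ->
  ito_process P W T X a (fun _ _ => 0) ->
  (forall t, t \in `[0, T] -> {ae P, forall w, X t w = 0}) ->
  {ae P, forall w, {ae mu, forall s, s \in `[0, T] -> a s w = 0}}.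
Proof.
move=> T0 [ia [I hI hX]] X0.
have T00 : 0 \in `[0, T] by rewrite in_itv/= lexx ltW.
have I0 t : t \in `[0, T] -> {ae P, forall w, I t w - I 0 w = 0}.
  move=> tT; move: (tT); rewrite in_itv/= => /andP[t0 tT'].
  have I2 := sq_intB measurableT (ito_integral_sq_int hW hI tT)
    (ito_integral_sq_int hW hI T00).
  have := ito_isometry hW hI hI (lexx 0) t0 tT'.
  rewrite [X in _ = X -> _](_ : _ = 0); last first.
    by rewrite /inner /Rintegral (eq_integral (cst 0%E)) ?integral0// => z _; rewrite /lift mul0r.
  move=> e0; have := EFin_inner measurableT I2; rewrite e0 => /esym h.
  have mf : measurable_fun setT (fun w => ((I t w - I 0 w) ^+ 2)%:E).
    apply/measurable_EFinP/measurable_funX; exact: I2.1.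
  have [h1 _] := ae_eq_integral_abs P measurableT mf.
  have := h1; rewrite (eq_integral (fun w => ((I t w - I 0 w) ^+ 2)%:E)); last first.
    by move=> w _; rewrite gee0_abs// lee_fin sqr_ge0.
  move=> /(_ h); apply: filterS => w /(_ Logic.I)/= [] /eqP.
  by rewrite sqrf_eq0 => /eqP.
have prim t : t \in `[0, T] -> {ae P, forall w, \int[mu]_(s in `[0, t]) a s w = 0}.
  move=> tT.
  apply: filterS2 (filterI (X0 _ T00) (X0 _ tT)) (filterI (hX _ T00) (filterI (hX _ tT) (I0 _ tT))).
  move=> w [e0 et] [h0 [ht hI0]]; move: h0 ht.
  rewrite e0 et !add0r set_itv1 Rintegral_set1 add0r => i0 h.
  by move: hI0; rewrite -i0 subr0 => it; move: h; rewrite it addr0 => <-.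
have : {ae P, forall w, forall r : rat, ratr r \in `[0, T] ->
    \int[mu]_(s in `[0, ratr r]) a s w = 0}.
  apply: ae_forall_rat => r; case: (boolP (ratr r \in `[0, T])) => [rT|_].
    by apply: filterS (prim _ rT).
  exact: nearW.
apply: filterS2 ia => w ia hr; apply: ae_eq0_of_primitive => //.
apply: continuous_eq0_of_rat => //.
have := parameterized_integral_continuous (ltW T0) ia.
exact.
Qed.

End countably_many_conditions.

(** * Coefficients along a controlled solution *)

Section controlled_solution.
Context (R : realType) (d : measure_display) (Omega : measurableType d)
  (P : probability Omega R) (W : R -> Omega -> R)
  (hW : brownian_motion P W)
  (cp : control_problem R Omega) (hcp : standing_assumptions P W cp).
Local Notation mu := (@lebesgue_measure R).
Local Notation m := (mu \x P)%E.
Local Notation TO := (measurableTypeR R * Omega)%type.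
Local Notation D := (cyl `[0, T cp] : set TO).
Implicit Types G : R -> Omega -> coef R.

Let T0 : 0 <= T cp. Proof. exact: ltW (sa_T hcp). Qed.
Let mD : measurable D.
Proof. by apply: measurable_cyl; exact: measurable_itv. Qed.
Let Doo : (m D < +oo)%E.
Proof. by apply: cyl_fin; [exact: measurable_itv|exact: itvcc_fin]. Qed.

Lemma S2_process_sq_int (a : R) X : a <= 0 -> S2_process P W a (T cp) X ->
  sq_int m D (lift X).
Proof.
move=> a0 hX; have [M hM] := S2_process_second_moment hW a0 T0 hX.
by case: hX => -[mX _] _ _; exact: bounded_sq_int_lift mX hM.
Qed.

Lemma sq_int_norm (f : TO -> R) : sq_int m D f -> sq_int m D (fun z => `|f z|).
Proof.
move=> hf; apply: (le_sq_int mD _ hf); last by move=> z _; rewrite normr_id.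
by apply: measurableT_comp; [exact: measurable_realfun.normr_measurable|case: hf].
Qed.

(** The coefficients at the killed state; unlike [along] they are jointly
    measurable functions of time and outcome, and they agree with it on [A]. *)
Definition cut_along G (A : set Omega) X Y Z (u : R -> Omega -> R) t w : R :=
  G t w (X t w) (cut_avg (delta cp) (lambda cp) X A t w)
    (cut_delay (delta cp) X A t w) (Y t w) (Z t w) (u t w).

Variables (A : set Omega) (u X Y Z : R -> Omega -> R).
Hypotheses (mA : measurable A) (PA : P (~` A) = 0%E)
  (XA : forall w, A w -> forall t, t \in `[- delta cp, 0] -> X t w = varphi cp t w)
  (hu : admissible P W cp u) (hs : solution P W cp u X Y Z).
Local Notation X1 := (cut_avg (delta cp) (lambda cp) X A).
Local Notation X2 := (cut_delay (delta cp) X A).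
Local Notation at_state G := (cut_along G A X Y Z u).

Lemma cut_avgE t w : A w -> X1 t w = avg_delay cp X t w.
Proof. by move=> Aw; apply: eq_Rintegral => tau _; rewrite cutE. Qed.

Lemma cut_alongE G t w : A w -> at_state G t w = along cp G X Y Z u t w.
Proof.
move=> Aw; rewrite /cut_along /along.
rewrite cut_avgE//.
by have -> : X2 t w = pt_delay cp X t w by rewrite /cut_delay cutE.
Qed.

Let md0 : - delta cp <= 0. Proof. by rewrite oppr_le0 (sa_delta hcp). Qed.
Let mX : measurable_fun D (lift X). Proof. by case: (sol_X hs) => -[]. Qed.
Let mY : measurable_fun D (lift Y). Proof. by case: (sol_Y hs) => -[]. Qed.
Let mZ : measurable_fun D (lift Z). Proof. by case: (sol_Z hs) => -[]. Qed.
Let m_u : measurable_fun D (lift u). Proof. by case: (adm_adapted hu). Qed.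
Let mX1 : measurable_fun D (lift X1).
Proof.
exact: (cut_avg_measurable hW _ T0 (sa_delta hcp) (sol_X hs) mA PA XA
  (sa_varphi_measurable hcp)).
Qed.
Let mX2 : measurable_fun D (lift X2).
Proof.
exact: (cut_delay_measurable hW T0 (sa_delta hcp) (sol_X hs) mA PA XA
  (sa_varphi_measurable hcp)).
Qed.
Let Uu (z : TO) : D z -> U cp (lift u z).
Proof. by case=> tT _; exact: (adm_range hu). Qed.

Lemma state_X_sq_int : sq_int m D (lift X).
Proof. exact: S2_process_sq_int md0 (sol_X hs). Qed.
Lemma state_X1_sq_int : sq_int m D (lift X1).
Proof.
exact: (cut_avg_sq_int hW _ T0 (sa_delta hcp) (sol_X hs) mA PA XA
  (sa_varphi_measurable hcp)).
Qed.
Lemma state_X2_sq_int : sq_int m D (lift X2).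
Proof.
exact: (cut_delay_sq_int hW (lambda cp) T0 (sa_delta hcp) (sol_X hs) mA PA XA
  (sa_varphi_measurable hcp)).
Qed.
Lemma state_Y_sq_int : sq_int m D (lift Y).
Proof. exact: S2_process_sq_int (lexx 0) (sol_Y hs). Qed.
Lemma state_Z_sq_int : sq_int m D (lift Z).
Proof. exact: sq_int_lift (sol_Z hs). Qed.

Section one_coefficient.
Variable G : R -> Omega -> coef R.
Hypothesis hG : regular_coef (T cp) (U cp) G.

(** Linear growth along square-integrable processes. *)
Lemma cut_along_sq_int : sq_int m D (lift (at_state G)).
Proof.
have [C C0 hC] := growth_bound hG.
pose g (z : TO) : R := C * (1 + `|lift X z| + `|lift X1 z| + `|lift X2 z| + `|lift Y z| + `|lift Z z|).
have hg : sq_int m D g.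
  apply: sq_intZ => //; apply: sq_intD => //; last exact/sq_int_norm/state_Z_sq_int.
  apply: sq_intD => //; last exact/sq_int_norm/state_Y_sq_int.
  apply: sq_intD => //; last exact/sq_int_norm/state_X2_sq_int.
  apply: sq_intD => //; last exact/sq_int_norm/state_X1_sq_int.
  apply: sq_intD => //; last exact/sq_int_norm/state_X_sq_int.
  by apply: (@bounded_sq_int _ _ _ m D mD (fun=> 1) 1) => // z _; rewrite normr1.
apply: (le_sq_int mD _ hg); first exact: (at_state_measurable hG).
move=> z Dz; apply: le_trans (ler_norm _); apply: hC; last exact: Uu.
by case: Dz.
Qed.

Lemma cut_along_mul_sq_int (p : R -> Omega -> R) : sq_int m D (lift p) ->
  [/\ sq_int m D (lift (fun t w => p t w * at_state (fun t w => partial_x (G t w)) t w)),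
      sq_int m D (lift (fun t w => p t w * at_state (fun t w => partial_x1 (G t w)) t w)),
      sq_int m D (lift (fun t w => p t w * at_state (fun t w => partial_x2 (G t w)) t w)) &
      sq_int m D (lift (fun t w => p t w * at_state (fun t w => partial_y (G t w)) t w))].
Proof.
move=> hp; have [C C0 hC] := partial_bound hG.
have tT (z : TO) : D z -> z.1 \in `[0, T cp] by case.
have key (g : TO -> R) : measurable_fun D g -> (forall z, D z -> `|g z| <= C) ->
    sq_int m D (fun z => lift p z * g z).
  move=> mg gC; rewrite (_ : (fun z => _) = fun z => g z * lift p z).
    exact: bounded_mul_sq_int mg gC hp.
  by apply/funext => z; exact: mulrC.
split; apply: key.
- exact: (partial_x_measurable hG).
- move=> z Dz.
  by have [h _ _ _] := hC z.1 z.2 (lift X z) (lift X1 z) (lift X2 z) (lift Y z) (lift Z z) _ (tT z Dz) (Uu Dz).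
- exact: (partial_x1_measurable hG).
- move=> z Dz.
  by have [_ h _ _] := hC z.1 z.2 (lift X z) (lift X1 z) (lift X2 z) (lift Y z) (lift Z z) _ (tT z Dz) (Uu Dz).
- exact: (partial_x2_measurable hG).
- move=> z Dz.
  by have [_ _ h _] := hC z.1 z.2 (lift X z) (lift X1 z) (lift X2 z) (lift Y z) (lift Z z) _ (tT z Dz) (Uu Dz).
- exact: (partial_y_measurable hG).
- move=> z Dz.
  by have [_ _ _ h] := hC z.1 z.2 (lift X z) (lift X1 z) (lift X2 z) (lift Y z) (lift Z z) _ (tT z Dz) (Uu Dz).
Qed.

End one_coefficient.
End controlled_solution.

(** * Duality with the adjoint processes *)

Section integral_value.
Context (R : realType) (d : measure_display) (S : measurableType d)
  (nu : {measure set S -> \bar R}) (E : set S) (mE : measurable E).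
Implicit Types f g : S -> R.

(** Bundling integrability with the value lets long sums of products be
    integrated term by term. *)
Definition has_int f (r : R) := intg nu E f /\ \int[nu]_(x in E) f x = r.

Lemma has_intD f g r s : has_int f r -> has_int g s ->
  has_int (fun x => f x + g x) (r + s).
Proof. by move=> [fi <-] [gi <-]; split; [exact: intgD|rewrite RintegralD]. Qed.

Lemma has_intB f g r s : has_int f r -> has_int g s ->
  has_int (fun x => f x - g x) (r - s).
Proof. by move=> [fi <-] [gi <-]; split; [exact: intgB|rewrite RintegralB]. Qed.

Lemma has_int_inner f g : sq_int nu E f -> sq_int nu E g ->
  has_int (fun x => f x * g x) (inner nu E f g).
Proof. by move=> f2 g2; split => //; exact: sq_intM_integrable. Qed.

End integral_value.

Section duality.
Context (R : realType) (d : measure_display) (Omega : measurableType d)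
  (P : probability Omega R) (W : R -> Omega -> R)
  (hW : brownian_motion P W)
  (cp : control_problem R Omega) (hcp : standing_assumptions P W cp).
Local Notation mu := (@lebesgue_measure R).
Local Notation m := (mu \x P)%E.
Local Notation TO := (measurableTypeR R * Omega)%type.
Local Notation D := (cyl `[0, T cp] : set TO).
Local Notation J := (cyl `]0, T cp] : set TO).
Local Notation e := (expR (- (lambda cp * delta cp))).
Variables (A : set Omega) (mA : measurable A) (PA : P (~` A) = 0%E).
Variables (u X Y Z p1 p2 p3 q k1 k2 : R -> Omega -> R).
Hypotheses (hu : admissible P W cp u) (hs : solution P W cp u X Y Z)
  (hadj : adjoint_solution P W cp X Y Z u p1 p2 p3 q k1 k2)
  (XA : forall w, A w -> forall t, t \in `[- delta cp, 0] -> X t w = varphi cp t w).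
Local Notation at_state G := (cut_along cp G A X Y Z u).
Local Notation ham_at := (hamiltonian_at cp p1 p2 p3 q k1 k2).

Let T0 : 0 <= T cp. Proof. exact: ltW (sa_T hcp). Qed.
Let mD : measurable D.
Proof. by apply: measurable_cyl; exact: measurable_itv. Qed.
Let mJ : measurable J.
Proof. by apply: measurable_cyl; exact: measurable_itv. Qed.

(** The partial derivatives of the Hamiltonian along the solution, in a jointly
    measurable version. *)
Definition ham_x t w := p1 t w * at_state (fun t w => partial_x (b_coef cp t w)) t w
  + p2 t w + k1 t w * at_state (fun t w => partial_x (sigma_coef cp t w)) t w
  - q t w * at_state (fun t w => partial_x (f cp t w)) t w.
Definition ham_x1 t w := p1 t w * at_state (fun t w => partial_x1 (b_coef cp t w)) t w
  - p2 t w * lambda cp + k1 t w * at_state (fun t w => partial_x1 (sigma_coef cp t w)) t w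
  - q t w * at_state (fun t w => partial_x1 (f cp t w)) t w.
Definition ham_x2 t w := p1 t w * at_state (fun t w => partial_x2 (b_coef cp t w)) t w
  - p2 t w * expR (- lambda cp * delta cp)
  + k1 t w * at_state (fun t w => partial_x2 (sigma_coef cp t w)) t w
  - q t w * at_state (fun t w => partial_x2 (f cp t w)) t w.
Definition ham_y t w := - (q t w * at_state (fun t w => partial_y (f cp t w)) t w).
Definition ham_z := along cp (fun t w => partial_z (ham_at t w)) X Y Z u.

Lemma ham_partialsE t w : A w -> t \in `[0, T cp] ->
  [/\ ham_x t w = along cp (fun t w => partial_x (ham_at t w)) X Y Z u t w,
      ham_x1 t w = along cp (fun t w => partial_x1 (ham_at t w)) X Y Z u t w,
      ham_x2 t w = along cp (fun t w => partial_x2 (ham_at t w)) X Y Z u t w &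
      ham_y t w = along cp (fun t w => partial_y (ham_at t w)) X Y Z u t w].
Proof.
move=> Aw tT; have Uu := adm_range hu w tT.
rewrite /ham_x /ham_x1 /ham_x2 /ham_y !cut_alongE//; split.
- exact: esym (hamiltonian_x hcp w _ _ _ _ _ _ _ _ _ _ _ tT Uu).2.
- exact: esym (hamiltonian_x1 hcp w _ _ _ _ _ _ _ _ _ _ _ tT Uu).2.
- exact: esym (hamiltonian_x2 hcp w _ _ _ _ _ _ _ _ _ _ _ tT Uu).2.
- exact: esym (hamiltonian_y hcp w _ _ _ _ _ _ _ _ _ _ _ tT Uu).2.
Qed.

Let p1_sq : sq_int m D (lift p1).
Proof. by have [h _ _ _] := adj_spaces hadj; exact: (S2_process_sq_int hW hcp (lexx 0) h). Qed.
Let p2_sq : sq_int m D (lift p2).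
Proof. by have [_ h _ _] := adj_spaces hadj; exact: (S2_process_sq_int hW hcp (lexx 0) h). Qed.
Let q_sq : sq_int m D (lift q).
Proof. by have [_ _ _ h] := adj_spaces hadj; exact: (S2_process_sq_int hW hcp (lexx 0) h). Qed.
Let k1_sq : sq_int m D (lift k1).
Proof. by have [h _] := adj_k hadj; exact: sq_int_lift h. Qed.
Let ham_sq : [/\ sq_int m D (lift ham_x), sq_int m D (lift ham_x1),
  sq_int m D (lift ham_x2) & sq_int m D (lift ham_y)].
Proof.
have [b1 b2 b3 _] := cut_along_mul_sq_int hW hcp mA PA XA hu hs (b_regular hcp) p1_sq.
have [s1 s2 s3 _] := cut_along_mul_sq_int hW hcp mA PA XA hu hs (sigma_regular hcp) k1_sq.
have [f1 f2 f3 f4] := cut_along_mul_sq_int hW hcp mA PA XA hu hs (f_regular hW hcp) q_sq.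
have p2c (c : R) : sq_int m D (lift (fun t w => p2 t w * c)).
  rewrite (_ : lift _ = fun z => c * lift p2 z); first exact: sq_intZ.
  by apply/funext => z; rewrite /lift mulrC.
split.
- have h := sq_intB mD (sq_intD mD (sq_intD mD b1 p2_sq) s1) f1.
  exact h.
- exact (sq_intB mD (sq_intD mD (sq_intB mD b2 (p2c _)) s2) f2).
- exact (sq_intB mD (sq_intD mD (sq_intB mD b3 (p2c _)) s3) f3).
- exact: sq_intN.
Qed.

Lemma ham_x2_sq_int : sq_int m D (lift ham_x2).
Proof. by case: ham_sq. Qed.

Section one_solution.
Variables (u' X' Y' Z' : R -> Omega -> R).
Hypotheses (hu' : admissible P W cp u') (hs' : solution P W cp u' X' Y' Z')
  (XA' : forall w, A w -> forall t, t \in `[- delta cp, 0] -> X' t w = varphi cp t w).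
Local Notation at_state' G := (cut_along cp G A X' Y' Z' u').
Local Notation X1' := (cut_avg (delta cp) (lambda cp) X' A).
Local Notation X2' := (cut_delay (delta cp) X' A).

(** The quantity whose drift is computed by the product rule. *)
Definition boundary t : R := inner P setT (X' t) (p1 t) +
  inner P setT (X1' t) (p2 t) + inner P setT (Y' t) (q t).

Definition duality_density t w : R :=
  (X' t w * - ham_x t w + p1 t w * at_state' (b_coef cp) t w +
     along cp (sigma_coef cp) X' Y' Z' u' t w * k1 t w) +
  (X1' t w * - ham_x1 t w +
     p2 t w * (cut X' A t w - lambda cp * X1' t w - e * X2' t w)) +
  (Y' t w * - ham_y t w + q t w * - at_state' (f cp) t w +
     Z' t w * - ham_z t w).

(** The product rule for [X' p1], [X1' p2] and [Y' q]. The average [X1'] has no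
    martingale part, so [k2] contributes nothing. *)
Lemma duality : has_int m J (lift duality_density) (boundary (T cp) - boundary 0).
Proof.
have md0 : - delta cp <= 0 by rewrite oppr_le0 (sa_delta hcp).
have [hx2 hx12 _ hy2] := ham_sq.
have [sp1 sp2 _ sq] := adj_spaces hadj.
have ip1 : sq_ito P W (T cp) p1 (fun t w => - ham_x t w) k1.
  apply: (sq_ito_of_process hW (lexx 0) T0 mA PA sp1 (adj_p1 hadj)).
    exact (sq_intN mD hx2).
  by move=> w Aw s sT; have [-> _ _ _] := ham_partialsE Aw sT.
have ip2 : sq_ito P W (T cp) p2 (fun t w => - ham_x1 t w) k2.
  apply: (sq_ito_of_process hW (lexx 0) T0 mA PA sp2 (adj_p2 hadj)).
    exact (sq_intN mD hx12).
  by move=> w Aw s sT; have [_ -> _ _] := ham_partialsE Aw sT.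
have iq : sq_ito P W (T cp) q (fun t w => - ham_y t w) (fun t w => - ham_z t w).
  apply: (sq_ito_of_process hW (lexx 0) T0 mA PA sq (adj_q hadj)).
    exact (sq_intN mD hy2).
  by move=> w Aw s sT; have [_ _ _ ->] := ham_partialsE Aw sT.
have b2 := cut_along_sq_int hW hcp mA PA XA' hu' hs' (b_regular hcp).
have f2 := cut_along_sq_int hW hcp mA PA XA' hu' hs' (f_regular hW hcp).
have iX : sq_ito P W (T cp) X' (at_state' (b_coef cp))
    (along cp (sigma_coef cp) X' Y' Z' u').
  apply: (sq_ito_of_process hW md0 T0 mA PA (sol_X hs') (sol_forward hs') b2).
  by move=> w Aw s sT; rewrite cut_alongE.
have iY : sq_ito P W (T cp) Y' (fun t w => - at_state' (f cp) t w) Z'.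
  apply: (sq_ito_of_process hW (lexx 0) T0 mA PA (sol_Y hs') (sol_backward hs')).
    exact (sq_intN mD f2).
  by move=> w Aw s sT; rewrite cut_alongE.
have iX1 := cut_avg_sq_ito hW (lambda cp) T0 (sa_delta hcp) (sol_X hs') mA PA XA'
  (sa_varphi_measurable hcp).
have e1 := product_rule hW T0 iX ip1.
have e2 := product_rule hW T0 iX1 ip2.
have e3 := product_rule hW T0 iY iq.
have toJ (g : TO -> R) : sq_int m D g -> sq_int m J g.
  by apply: sq_int_J; rewrite ?lexx.
have iJ (g h : TO -> R) : sq_int m D g -> sq_int m D h ->
    has_int m J (fun z => g z * h z) (inner m J g h).
  by move=> g2 h2; apply: has_int_inner => //; exact: toJ.
have c2 x a c : sq_ito P W (T cp) x a c -> sq_int m D (lift c).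
  by move=> h; have [I [hI _ _] _] := sq_ito_eq h; exact: sq_int_lift hI.
have j1 := has_intD mJ (has_intD mJ (iJ _ _ (sq_ito_lift iX) (sq_ito_drift ip1))
  (iJ _ _ p1_sq b2)) (iJ _ _ (c2 _ _ _ iX) k1_sq).
have j2 := has_intD mJ (iJ _ _ (sq_ito_lift iX1) (sq_ito_drift ip2))
  (iJ _ _ p2_sq (sq_ito_drift iX1)).
have j3 := has_intD mJ (has_intD mJ (iJ _ _ (sq_ito_lift iY) (sq_ito_drift iq))
  (iJ _ _ q_sq (sq_ito_drift iY))) (iJ _ _ (c2 _ _ _ iY) (c2 _ _ _ iq)).
have j := has_intD mJ (has_intD mJ j1 j2) j3.
have z0 : inner m J (lift (fun _ _ => 0)) (lift k2) = 0.
  by rewrite /inner /Rintegral (eq_integral (cst 0%E)) ?integral0// => z _; rewrite /lift mul0r.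
rewrite z0 addr0 in e2.
rewrite -e1 -e2 -e3 in j.
rewrite (_ : boundary (T cp) - boundary 0 = inner P setT (X' (T cp)) (p1 (T cp)) -
  inner P setT (X' 0) (p1 0) +
  (inner P setT (X1' (T cp)) (p2 (T cp)) - inner P setT (X1' 0) (p2 0)) +
  (inner P setT (Y' (T cp)) (q (T cp)) - inner P setT (Y' 0) (q 0))).
  exact: j.
by rewrite /boundary; ring.
Qed.

End one_solution.
End duality.

(** * Comparison of two controls *)

Section almost_everywhere_values.
Context (R : realType) (d : measure_display) (Omega : measurableType d)
  (P : probability Omega R).
Local Notation mu := (@lebesgue_measure R).
Local Notation m := (mu \x P)%E.

Lemma full_measure_set (Q : Omega -> Prop) : {ae P, forall w, Q w} ->
  exists A : set Omega, [/\ measurable A, P (~` A) = 0%E & forall w, A w -> Q w].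
Proof.
move=> [N [mN PN NQ]]; exists (~` N); split; first exact: measurableC.
  by rewrite setCK.
by move=> w Nw; apply: contrapT => nQ; apply: Nw; exact: NQ.
Qed.

Lemma integral_ge0_ae (f : Omega -> \bar R) : measurable_fun setT f ->
  {ae P, forall w, (0 <= f w)%E} -> (0 <= \int[P]_w f w)%E.
Proof.
move=> mf f0; rewrite (@ae_eq_integral _ _ _ P setT (f^\+)%E f)//.
- by apply: integral_ge0 => w _; exact: funepos_ge0.
- exact: measurable_funepos.
- by apply: filterS f0 => w f0w _; rewrite funeposE max_l.
Qed.

Lemma has_int_ge0 (T : R) (f : R -> Omega -> R) r :
  has_int m (cyl `]0, T]) (lift f) r ->
  (forall t, t \in `]0, T] -> {ae P, forall w, 0 <= f t w}) -> 0 <= r.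
Proof.
have mJ : measurable (`]0, T]%classic : set (measurableTypeR R)) by exact: measurable_itv.
move=> [fi <-] f0; apply: fine_ge0.
rewrite (fubini_cyl mJ fi); apply: integral_ge0 => t tT; apply: integral_ge0_ae.
  exact: measurable_slice mJ tT (measurable_int _ fi).
by apply: filterS (f0 t tT) => w; rewrite lee_fin.
Qed.

Lemma has_int_ae_eq (f g : Omega -> R) r s : has_int P setT f r ->
  has_int P setT g s -> {ae P, forall w, f w = g w} -> r = s.
Proof.
move=> [fi <-] [gi <-] fg; congr fine; apply: ae_eq_integral => //.
- exact: measurable_int fi.
- exact: measurable_int gi.
- by apply: filterS fg => w -> _.
Qed.

(** A nonnegative function with zero integral vanishes almost surely. *)
Lemma has_int_gt0 (f : Omega -> R) r : has_int P setT f r ->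
  {ae P, forall w, 0 < f w} -> 0 < r.
Proof.
move=> hf f0; rewrite lt_neqAle; apply/andP; split; last first.
  case: hf => fi <-; apply: fine_ge0; apply: integral_ge0_ae.
    exact: measurable_int fi.
  by apply: filterS f0 => w /ltW; rewrite lee_fin.
apply/eqP => r0; case: hf => fi fr.
have mf := measurable_int _ fi.
have [h _] := ae_eq_integral_abs P measurableT mf.
have if0 : (\int[P]_w `|(f w)%:E| = 0)%E.
  transitivity (\int[P]_w (f w)%:E)%E.
    apply: ae_eq_integral => //; first exact: measurableT_comp mf.
    by apply: filterS f0 => w f0w _; rewrite gee0_abs// lee_fin ltW.
  rewrite -(fineK (integrable_fin_num measurableT fi)); congr EFin.
  by rewrite r0; exact: fr.
have : {ae P, forall w : Omega, False}.
  by apply: filterS2 f0 (h if0) => w f0w /(_ Logic.I)/= [] fw; move: f0w; rewrite fw ltxx.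
move=> [B [_ PB hB]].
have := probability_setT P; rewrite (_ : setT = B); last first.
  by apply/seteqP; split => // w _; exact: hB.
by rewrite PB => /eqP; rewrite eq_sym onee_eq0.
Qed.

End almost_everywhere_values.

(** Rearranges the tangent-plane inequality for the Hamiltonian: the terms linear
    in the state recombine the products with the adjoint processes into the
    densities of the duality formula. *)
Lemma tangent_gap_ge0 (R : realType) (p1 p2 k1 q lam e x x1 x2 y z x' x1' x2' y' z'
    b s g b' s' g' hx hx1 hx2 hy hz r : R) :
  hx * (x' - x) + hx1 * (x1' - x1) + hx2 * (x2' - x2) + hy * (y' - y) +
    hz * (z' - z) + r <=
  (p1 * b' + p2 * (x' - lam * x1' - e * x2') + k1 * s' - q * g') -
  (p1 * b + p2 * (x - lam * x1 - e * x2) + k1 * s - q * g) -> 0 <= r ->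
  0 <= (x' * - hx + p1 * b' + s' * k1 +
        (x1' * - hx1 + p2 * (x' - lam * x1' - e * x2')) +
        (y' * - hy + q * - g' + z' * - hz)) -
       (x * - hx + p1 * b + s * k1 +
        (x1 * - hx1 + p2 * (x - lam * x1 - e * x2)) +
        (y * - hy + q * - g + z * - hz)) - hx2 * (x2' - x2).
Proof. move=> h r0; have := lerD h r0; rewrite addr0; lra. Qed.

Section comparison.
Context (R : realType) (d : measure_display) (Omega : measurableType d)
  (P : probability Omega R) (W : R -> Omega -> R)
  (hW : brownian_motion P W)
  (cp : control_problem R Omega) (hcp : standing_assumptions P W cp).
Local Notation mu := (@lebesgue_measure R).
Local Notation m := (mu \x P)%E.
Local Notation TO := (measurableTypeR R * Omega)%type.
Local Notation D := (cyl `[0, T cp] : set TO).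
Local Notation J := (cyl `]0, T cp] : set TO).
Variables (A : set Omega) (mA : measurable A) (PA : P (~` A) = 0%E).
Variables (u X Y Z p1 p2 p3 q k1 k2 : R -> Omega -> R).
Hypotheses (hu : admissible P W cp u) (hs : solution P W cp u X Y Z)
  (hadj : adjoint_solution P W cp X Y Z u p1 p2 p3 q k1 k2)
  (XA : forall w, A w -> forall t, t \in `[- delta cp, 0] -> X t w = varphi cp t w).
Local Notation ham_at := (hamiltonian_at cp p1 p2 p3 q k1 k2).
Hypothesis hconvex : forall t : R, t \in `[0, T cp] -> {ae P, forall w,
  convex6 (U cp) (ham_at t w)}.
Hypothesis hp3 : forall t : R, t \in `[0, T cp] -> {ae P, forall w, p3 t w = 0}.
Hypothesis hmax : forall t : R, t \in `[0, T cp] -> forall v, U cp v ->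
  {ae P, forall w,
    along cp (fun t w => partial_u (U cp) (ham_at t w)) X Y Z u t w *
      (u t w - v) <= 0}.
Variables (u' X' Y' Z' : R -> Omega -> R).
Hypotheses (hu' : admissible P W cp u') (hs' : solution P W cp u' X' Y' Z')
  (XA' : forall w, A w -> forall t, t \in `[- delta cp, 0] -> X' t w = varphi cp t w).

Local Notation ham_x2 := (ham_x2 cp A u X Y Z p1 p2 q k1).
Local Notation X2 := (cut_delay (delta cp) X A).
Local Notation X2' := (cut_delay (delta cp) X' A).

(** The excess of the Hamiltonian over its tangent plane, up to the derivative in
    the control; the last term has zero integral by [ham_x2_orthogonal]. *)
Definition gap t w : R :=
  duality_density cp A u X Y Z p1 p2 p3 q k1 k2 u' X' Y' Z' t w -
  duality_density cp A u X Y Z p1 p2 p3 q k1 k2 u X Y Z t w -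
  ham_x2 t w * (X2' t w - X2 t w).

(** Convexity bounds the gap below by the derivative in the control times
    [u' - u], which the minimum condition makes nonnegative. *)
Lemma gap_ge0 t : t \in `[0, T cp] -> {ae P, forall w, 0 <= gap t w}.
Proof.
move=> tT.
have hA : {ae P, forall w, A w} by exact: ae_of_full mA PA (fun _ h => h).
apply: filterS3 hA (hconvex tT) (ae_forall_sign (hmax tT)) => w Aw cH hH.
have Uu := adm_range hu w tT; have Uu' := adm_range hu' w tT.
have [ex ex1 ex2 ey] := ham_partialsE hcp X Y Z p1 p2 p3 q k1 k2 hu Aw tT.
rewrite -!(cut_alongE cp _ _ _ _ _ _ Aw) in ex ex1 ex2 ey.
have ez : ham_z cp u X Y Z p1 p2 p3 q k1 k2 t w =
    cut_along cp (fun t w => partial_z (ham_at t w)) A X Y Z u t w.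
  by rewrite cut_alongE.
have hr : 0 <= cut_along cp (fun t w => partial_u (U cp) (ham_at t w)) A X Y Z u t w *
    (u' t w - u t w).
  by rewrite cut_alongE// -oppr_le0 -mulrN opprB; exact: hH.
pose x1 := cut_avg (delta cp) (lambda cp) X A t w.
have [dx dy] := hamiltonian_derivable hcp w (p1 t w) (p2 t w) (p3 t w) (q t w) (k1 t w)
  (k2 t w) (X t w) x1 (X2 t w) (Y t w) (Z t w) tT Uu.
have := convex6_gradient (sa_U_convex hcp) cH (X' t w)
  (cut_avg (delta cp) (lambda cp) X' A t w) (X2' t w) (Y' t w) (Z' t w) Uu Uu' dx dy.
move=> h.
rewrite /gap /duality_density.
rewrite -(cut_alongE cp u' X' Y' Z' (sigma_coef cp) t Aw).
rewrite -(cut_alongE cp u X Y Z (sigma_coef cp) t Aw).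
rewrite ex ex1 ex2 ey ez.
rewrite -(mulNr (lambda cp) (delta cp)) !cutE//.
apply: tangent_gap_ge0 hr; exact: h.
Qed.

Let T0 : 0 < T cp. Proof. exact: sa_T hcp. Qed.
Let mD : measurable D.
Proof. by apply: measurable_cyl; exact: measurable_itv. Qed.
Let mJ : measurable J.
Proof. by apply: measurable_cyl; exact: measurable_itv. Qed.
Let toJ (g : TO -> R) : sq_int m D g -> sq_int m J g.
Proof. by apply: sq_int_J; rewrite ?lexx. Qed.

(** The derivative in the delayed state is the drift of [p3], a process that
    vanishes and has no martingale part. *)
Lemma ham_x2_orthogonal (g : TO -> R) : sq_int m D g ->
  has_int m J (fun z => lift ham_x2 z * g z) 0.
Proof.
move=> g2; have h2 := ham_x2_sq_int hW hcp mA PA hu hs hadj XA.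
have hg := has_int_inner mJ (toJ h2) (toJ g2); case: (hg) => hgi _.
suff e0 : inner m J (lift ham_x2) g = 0 by rewrite e0 in hg.
have mJ' : measurable (`]0, T cp]%classic : set (measurableTypeR R)) by exact: measurable_itv.
rewrite /inner /Rintegral (fubini_cyl' mJ' hgi) (@ae_eq_integral _ _ _ P setT (cst 0%E))//.
- by rewrite integral0.
- exact: (measurable_fubini_cyl (f := fun z => lift ham_x2 z * g z) mJ' hgi).
have hA : {ae P, forall w, A w} by exact: ae_of_full mA PA (fun _ h => h).
apply: filterS2 hA (ito_process_drift_eq0 hW T0 (adj_p3 hadj) hp3) => w Aw h _.
rewrite (@ae_eq_integral _ _ _ mu `]0, T cp]%classic (cst 0%E))//.
- by rewrite integral0.
- exact: measurable_slice' mJ' (measurable_int _ hgi).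
move: h; apply: filterS; first exact: (ae_filter_ringOfSetsType mu).
move=> s hs0 sT.
have sT' : s \in `[0, T cp].
  by move: sT; rewrite /= !in_itv/= => /andP[/ltW -> ->].
have [_ _ e2 _] := ham_partialsE hcp X Y Z p1 p2 p3 q k1 k2 hu Aw sT'.
by rewrite /lift/= e2; have /eqP := hs0 sT'; rewrite oppr_eq0 => /eqP ->; rewrite mul0r.
Qed.

Lemma boundary_le :
  0 <= boundary P cp A p1 p2 q X' Y' (T cp) - boundary P cp A p1 p2 q X' Y' 0 -
  (boundary P cp A p1 p2 q X Y (T cp) - boundary P cp A p1 p2 q X Y 0).
Proof.
have d' := duality hW hcp mA PA hu hs hadj XA hu' hs' XA'.
have d0 := duality hW hcp mA PA hu hs hadj XA hu hs XA.
have x2 := ham_x2_orthogonal (sq_intB mD (state_X2_sq_int hW hcp mA PA XA' hs')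
  (state_X2_sq_int hW hcp mA PA XA hs)).
have h := has_intB mJ (has_intB mJ d' d0) x2; rewrite subr0 in h.
apply: (has_int_ge0 (f := gap) h) => t; rewrite in_itv/= => /andP[t0 tT]; apply: gap_ge0.
by rewrite in_itv/= (ltW t0).
Qed.

End comparison.

(** * Boundary terms *)

Section endpoints.
Context (R : realType) (d : measure_display) (Omega : measurableType d)
  (P : probability Omega R) (W : R -> Omega -> R)
  (hW : brownian_motion P W)
  (cp : control_problem R Omega) (hcp : standing_assumptions P W cp).
Variables (A : set Omega) (mA : measurable A) (PA : P (~` A) = 0%E).
Variables (u X Y Z p1 p2 p3 q k1 k2 : R -> Omega -> R).
Hypotheses (hs : solution P W cp u X Y Z)
  (hadj : adjoint_solution P W cp X Y Z u p1 p2 p3 q k1 k2)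
  (XA : forall w, A w -> forall t, t \in `[- delta cp, 0] -> X t w = varphi cp t w).
Variables (u' X' Y' Z' : R -> Omega -> R).
Hypotheses (hs' : solution P W cp u' X' Y' Z')
  (XA' : forall w, A w -> forall t, t \in `[- delta cp, 0] -> X' t w = varphi cp t w).
Local Notation X1 := (cut_avg (delta cp) (lambda cp) X A).
Local Notation X1' := (cut_avg (delta cp) (lambda cp) X' A).

Let T0 : 0 <= T cp. Proof. exact: ltW (sa_T hcp). Qed.
Let md0 : - delta cp <= 0. Proof. by rewrite oppr_le0 (sa_delta hcp). Qed.
Let hA : {ae P, forall w, A w}.
Proof. exact: ae_of_full mA PA (fun _ h => h). Qed.

Lemma S2_process_sq_int_at (a t : R) V : a <= 0 -> t \in `[0, T cp] ->
  S2_process P W a (T cp) V -> sq_int P setT (V t).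
Proof.
move=> a0 tT hV; have [M hM] := S2_process_second_moment hW a0 T0 hV.
case: hV => -[_ FV] _ _; split; first exact: (Fm_measurable hW (FV t tT)).
exact: le_lt_trans (hM t tT) (ltry _).
Qed.

Lemma boundaryB t : t \in `[0, T cp] ->
  has_int P setT (fun w => (X' t w - X t w) * p1 t w +
      (X1' t w - X1 t w) * p2 t w + (Y' t w - Y t w) * q t w)
    (boundary P cp A p1 p2 q X' Y' t - boundary P cp A p1 p2 q X Y t).
Proof.
move=> tT; have [sp1 sp2 _ sq] := adj_spaces hadj.
have hp1 := S2_process_sq_int_at (lexx 0) tT sp1.
have hp2 := S2_process_sq_int_at (lexx 0) tT sp2.
have hq := S2_process_sq_int_at (lexx 0) tT sq.
have hX := S2_process_sq_int_at md0 tT (sol_X hs).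
have hX' := S2_process_sq_int_at md0 tT (sol_X hs').
have hY := S2_process_sq_int_at (lexx 0) tT (sol_Y hs).
have hY' := S2_process_sq_int_at (lexx 0) tT (sol_Y hs').
have hX1 : sq_int P setT (X1 t).
  exact: (sq_ito_sq_int hW (cut_avg_sq_ito hW (lambda cp) T0 (sa_delta hcp) (sol_X hs) mA PA XA
    (sa_varphi_measurable hcp)) tT).
have hX1' : sq_int P setT (X1' t).
  exact: (sq_ito_sq_int hW (cut_avg_sq_ito hW (lambda cp) T0 (sa_delta hcp) (sol_X hs') mA PA XA'
    (sa_varphi_measurable hcp)) tT).
have mT : measurable [set: Omega] by exact: measurableT.
have h := has_intD mT (has_intD mT (has_int_inner mT (sq_intB mT hX' hX) hp1)
  (has_int_inner mT (sq_intB mT hX1' hX1) hp2)) (has_int_inner mT (sq_intB mT hY' hY) hq).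
rewrite (innerBl mT hX' hX hp1) (innerBl mT hX1' hX1 hp2) (innerBl mT hY' hY hq) in h.
rewrite (_ : boundary P cp A p1 p2 q X' Y' t - boundary P cp A p1 p2 q X Y t =
  inner P setT (X' t) (p1 t) - inner P setT (X t) (p1 t) +
  (inner P setT (X1' t) (p2 t) - inner P setT (X1 t) (p2 t)) +
  (inner P setT (Y' t) (q t) - inner P setT (Y t) (q t))); first exact: h.
rewrite /boundary; move: (inner _ _ (X' t) _) (inner _ _ (X1' t) _) (inner _ _ (Y' t) _)
  (inner _ _ (X t) _) (inner _ _ (X1 t) _) (inner _ _ (Y t) _).
by move=> *; ring.
Qed.

(** For affine [phi] the terminal conditions of the adjoint processes cancel the
    terminal value of the backward equation. *)
Lemma boundary_terminal :
  (exists M N : R, forall x x1, phi cp x x1 = M * x + N * x1) ->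
  boundary P cp A p1 p2 q X' Y' (T cp) = boundary P cp A p1 p2 q X Y (T cp).
Proof.
move=> [M [N hphi]]; apply/eqP; rewrite -subr_eq0; apply/eqP.
have TT : T cp \in `[0, T cp] by rewrite in_itv/= T0 lexx.
have hd (a c x : R) : derive1 (fun v : R => a * v + c) x = a.
  have : is_derive x 1 (fun v : R => a * v + c) a.
    by apply: is_derive_eq; rewrite /GRing.scale/= ?mulr1 ?addr0.
  by move=> h; rewrite derive1E; exact: derive_val.
have px x x1 : phi_x cp x x1 = M.
  rewrite /phi_x (_ : phi cp ^~ x1 = fun v => M * v + N * x1); last first.
    by apply/funext => v; exact: hphi.
  exact: hd.
have px1 x x1 : phi_x1 cp x x1 = N.
  rewrite /phi_x1 (_ : phi cp x = fun v => N * v + M * x); last first.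
    by apply/funext => v; rewrite hphi addrC.
  exact: hd.
apply: (has_int_ae_eq (boundaryB TT) (g := fun=> 0)).
  split; first by rewrite /intg; exact: integrable0.
  by rewrite /Rintegral integral0_eq.
apply: filterS3 hA (filterI (sol_terminal hs) (sol_terminal hs'))
  (filterI (adj_p1T hadj) (adj_p2T hadj)) => w Aw [eY eY'] [e1 e2].
by rewrite e1 e2 eY eY' px px1 !hphi !(cut_avgE cp _ _ Aw); ring.
Qed.

(** Both solutions start from the same path, and [q] starts from 1. *)
Lemma boundary_initial :
  has_int P setT (fun w => Y' 0 w - Y 0 w)
    (boundary P cp A p1 p2 q X' Y' 0 - boundary P cp A p1 p2 q X Y 0).
Proof.
have T00 : 0 \in `[0, T cp] by rewrite in_itv/= lexx.
have hY := S2_process_sq_int_at (lexx 0) T00 (sol_Y hs).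
have hY' := S2_process_sq_int_at (lexx 0) T00 (sol_Y hs').
have PT : (P setT < +oo)%E by rewrite probability_setT ltry.
split; first exact: (sq_int_finite_integrable measurableT PT (sq_intB measurableT hY' hY)).
apply/esym; apply: (has_int_ae_eq (boundaryB T00)).
  split; last by [].
  exact: (sq_int_finite_integrable measurableT PT (sq_intB measurableT hY' hY)).
apply: filterS2 hA (adj_q0 hadj) => w Aw ->.
have eX s : s \in `[- delta cp, 0] -> X' s w = X s w by move=> sd; rewrite XA// XA'.
have -> : X1' 0 w = X1 0 w.
  apply: eq_Rintegral => s; rewrite inE/= => sd.
  by rewrite add0r !cutE// eX.
by rewrite eX ?in_itv/= ?md0 ?lexx// !subrr !mul0r !add0r mulr1.
Qed.

End endpoints.

(** The event that the variable is positive has probability 0 or 1, and a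
    nonpositive mean excludes 1. *)
Lemma F0_le0_of_mean (R : realType) (d : measure_display) (Omega : measurableType d)
    (P : probability Omega R) (W : R -> Omega -> R) (g : Omega -> R) (r : R) :
  brownian_motion P W -> filtration_measurable P W 0 g ->
  has_int P setT g r -> r <= 0 -> {ae P, forall w, g w <= 0}.
Proof.
move=> hW Fg hg r0.
have FB := Fm_preimage Fg (measurable_itv `]0, +oo[).
have mB := filtration_events_measurable hW FB.
have [PB|PB] := F0_trivial hW FB.
  exists (g @^-1` `]0, +oo[); split => //.
  by move=> w /= /negP; rewrite -ltNge in_itv/= andbT.
suff : 0 < r by rewrite ltNge r0.
apply: (has_int_gt0 hg).
apply: (ae_of_full mB); first by rewrite probability_setC// PB subee.
by move=> w /=; rewrite in_itv/= andbT.
Qed.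

Unset Implicit Arguments.

Theorem theorem3p1 (R : realType) (d : measure_display)
    (Omega : measurableType d) (P : probability Omega R)
    (W : R -> Omega -> R) (hW : brownian_motion P W)
    (cp : control_problem R Omega) (hcp : standing_assumptions P W cp)
    (u X Y Z p1 p2 p3 q k1 k2 : R -> Omega -> R)
    (hu : admissible P W cp u)
    (hXYZ : solution P W cp u X Y Z)
    (hadj : adjoint_solution P W cp X Y Z u p1 p2 p3 q k1 k2)
    (hconvex : forall t : R, t \in `[0, T cp] -> {ae P, forall w,
      convex6 (U cp) (hamiltonian_at cp p1 p2 p3 q k1 k2 t w)})
    (hphi : exists M N : R, forall x x1, phi cp x x1 = M * x + N * x1)
    (hp3 : forall t : R, t \in `[0, T cp] -> {ae P, forall w, p3 t w = 0})
    (hmax : forall t : R, t \in `[0, T cp] -> forall v, U cp v ->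
      {ae P, forall w,
        along cp (fun t w =>
            partial_u (U cp) (hamiltonian_at cp p1 p2 p3 q k1 k2 t w))
          X Y Z u t w * (u t w - v) <= 0}) :
  is_essinf P (costs P W cp) (cost Y).
Proof.
have T00 : 0 \in `[0, T cp] by rewrite in_itv/= lexx ltW// (sa_T hcp).
have FY0 V : S2_process P W 0 (T cp) V -> filtration_measurable P W 0 (V 0).
  by case=> -[_ h] _ _; exact: h.
split.
- apply: measurableT_comp => //; exact: (Fm_measurable hW (FY0 _ (sol_Y hXYZ))).
- move=> _ [u' [X' [Y' [Z' [hu' hs' ->]]]]].
  have [A [mA PA hA]] := full_measure_set (filterI (sol_initial hXYZ) (sol_initial hs')).
  have XA w : A w -> forall t, t \in `[- delta cp, 0] -> X t w = varphi cp t w.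
    by move=> /hA[].
  have XA' w : A w -> forall t, t \in `[- delta cp, 0] -> X' t w = varphi cp t w.
    by move=> /hA[].
  have h0 := boundary_initial hW hcp mA PA hXYZ hadj XA hs' XA'.
  have hT := boundary_terminal hW hcp mA PA hXYZ hadj XA hs' XA' hphi.
  have hle := boundary_le hW hcp mA PA hu hXYZ hadj XA hconvex hp3 hmax hu' hs' XA'.
  have := F0_le0_of_mean hW (FmB (FY0 _ (sol_Y hs')) (FY0 _ (sol_Y hXYZ))) h0.
  move=> h; suff : {ae P, forall w, Y' 0 w - Y 0 w <= 0}.
    by apply: filterS => w; rewrite /cost lerN2 subr_le0.
  by apply: h; move: hle; rewrite hT; lra.
- by move=> zeta _ hzeta; apply: hzeta; exists u, X, Y, Z.
Qed.
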